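(* The following two statements hold. (1) Every Doeblin hidden stochastic game $\Gamma$ admits a uniform value $v:\Delta(\mathcal K)\to[0,1]$; moreover, the uniform value is independent of the initial belief, i.e. $v(b_1)=v(b_1')$ for all $b_1,b_1'\in\Delta(\mathcal K)$. (2) If the mapping $\varepsilon\mapsto(m_\varepsilon,\delta_\varepsilon)$ of the Doeblin condition is computable, then the approximation problem for Doeblin hidden stochastic games is decidable. That is: let $\mathscr C$ be a class of Doeblin hidden stochastic games with rational data for which there is an algorithm that, given $\Gamma\in\mathscr C$ and a rational $\varepsilon>0$, outputs a pair $(m_\varepsilon,\delta_\varepsilon)\in\mathbb N^*\times(0,\infty)$ (with $\delta_\varepsilon$ rational) satisfying the Doeblin condition of $\Gamma$ at $\varepsilon$. Then there is an algorithm that, given $\Gamma\in\mathscr C$, a rational initial belief $b_1\in\Delta(\mathcal K)$, a rational threshold $x\in[0,1]$ and a rational $\varepsilon>0$, always halts and answers whether $v(b_1)>x+\varepsilon$, where $v$ is the uniform value of $\Gamma$ and where any answer is considered correct if $v(b_1)\in[x-\varepsilon,x+\varepsilon]$.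
   Context: $\mathbb N^*=\{1,2,\dots\}$; $\Delta(C)$ is the set of probability distributions on a finite set $C$; $\|b\|_1=\sum_k|b(k)|$. Hidden stochastic game. A (two-player zero-sum) hidden stochastic game is a tuple $\Gamma=(\mathcal K,\mathcal I,\mathcal J,\mathcal S,p,g)$ with finite nonempty sets of states $\mathcal K$, actions $\mathcal I$ (Player 1) and $\mathcal J$ (Player 2), signals $\mathcal S$, a transition function $p:\mathcal K\times\mathcal I\times\mathcal J\to\Delta(\mathcal K\times\mathcal S)$ and a reward function $g:\mathcal K\times\mathcal I\times\mathcal J\to[0,1]$. Given an initial belief $b_1\in\Delta(\mathcal K)$, known to both players, the initial state $K_1$ is drawn from $b_1$ and not observed. At each stage $m\ge1$ the players simultaneously choose actions $I_m,J_m$; the reward $G_m=g(K_m,I_m,J_m)$ is generated (unobserved); then $(K_{m+1},S_{m+1})$ is drawn from $p(K_m,I_m,J_m)$, and both players observe $(I_m,J_m,S_{m+1})$ but not $K_{m+1}$ nor $G_m$. Histories before stage $m$: $\mathcal H_m=(\mathcal I\times\mathcal J\times\mathcal S)^{m-1}$, with $\mathcal H_1=\{\emptyset\}$. Strategies: $\sigma:\bigcup_{m\ge1}\mathcal H_m\to\Delta(\mathcal I)$ for Player 1 (set $\Sigma$), $\tau:\bigcup_{m\ge1}\mathcal H_m\to\Delta(\mathcal J)$ for Player 2 (set $\mathcal T$). $\mathbb P^{b_1}_{\sigma,\tau}$, $\mathbb E^{b_1}_{\sigma,\tau}$ are the induced probability and expectation on plays, $H_m=(I_1,J_1,S_2,\dots,I_{m-1},J_{m-1},S_m)$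 is the random history, and $B_m(\cdot)=\mathbb P^{b_1}_{\sigma,\tau}(K_m=\cdot\mid H_m)$ is the random belief at stage $m$ (so $B_1=b_1$). Payoff and uniform value. $\gamma_n(b_1,\sigma,\tau)=\mathbb E^{b_1}_{\sigma,\tau}\big(\frac1n\sum_{m=1}^nG_m\big)$. $\Gamma$ has a uniform value $v:\Delta(\mathcal K)\to[0,1]$ if for every $b_1\in\Delta(\mathcal K)$ and $\varepsilon>0$ there exist $(\sigma^*,\tau^* )\in\Sigma\times\mathcal T$ and $\overline n\in\mathbb N^*$ such that for all $n\ge\overline n$: $\gamma_n(b_1,\sigma^*,\tau)\ge v(b_1)-\varepsilon$ for all $\tau\in\mathcal T$, and $\gamma_n(b_1,\sigma,\tau^* )\le v(b_1)+\varepsilon$ for all $\sigma\in\Sigma$. Doeblin condition. $\Gamma$ is Doeblin if for every $\varepsilon>0$ there exist $m_\varepsilon\in\mathbb N^*$ and $\delta_\varepsilon>0$ such that for all $(\sigma,\tau)\in\Sigma\times\mathcal T$ there exists $\overline b\in\Delta(\mathcal K)$ such that for all $b\in\Delta(\mathcal K)$, $$\mathbb P^b_{\sigma,\tau}\big(\|B_{m_\varepsilon}-\overline b\|_1\le\varepsilon\big)\ge\delta_\varepsilon .$$ A problem is decidable if some Turing machine halts on all inputs with a correct answer. *)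

(* Defs.v *)
From HB Require Import structures.
From mathcomp Require Import all_boot all_order all_algebra.
From mathcomp Require Import reals.

Set Implicit Arguments.
Unset Strict Implicit.
Unset Printing Implicit Defensive.

Import Order.TTheory GRing.Theory Num.Theory.
Local Open Scope ring_scope.

Record dist (R : realFieldType) (C : finType) := Dist {
  dist_fun :> {ffun C -> R};
  dist_axiom : [forall c, 0 <= dist_fun c] && (\sum_c dist_fun c == 1)
}.

HB.instance Definition _ (R : realFieldType) (C : finType) :=
  [isSub for @dist_fun R C].

Record hsg (R : realFieldType) (K I J S : finType) := Hsg {
  trans : K -> I -> J -> dist R (K * S)%type;
  reward : K -> I -> J -> R;
  reward01 : forall k i j, 0 <= reward k i j <= 1;
  states_gt0 : (0 < #|K|)%N;
  actions1_gt0 : (0 < #|I|)%N;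
  actions2_gt0 : (0 < #|J|)%N;
  signals_gt0 : (0 < #|S|)%N
}.

(* A history before stage m is a sequence of length m.-1, so that the union of
   the sets of histories is the type of all finite sequences. *)
Definition history (I J S : finType) := seq (I * J * S)%type.

Definition strategy1 (R : realFieldType) (I J S : finType) :=
  history I J S -> dist R I.
Definition strategy2 (R : realFieldType) (I J S : finType) :=
  history I J S -> dist R J.

(* A play truncated after n stages: the initial state K_1, then, for each stage
   m = 1, ..., n, the triple (I_m, J_m, (K_{m+1}, S_{m+1})).  Payoffs, beliefs
   and the Doeblin condition only involve finitely many stages, so they are
   expressed with the laws of truncated plays, i.e. with the marginals of the
   law of infinite plays. *)
Definition play (K I J S : finType) (n : nat) :=
  (K * n.-tuple (I * J * (K * S)))%type.

(* Stages are counted from 0 in the next two definitions: [state_at w m] is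
   K_{m+1} and [history_at w m] is H_{m+1}, for m <= n. *)
Definition state_at (K I J S : finType) (n : nat) (w : play K I J S n)
    (m : nat) : K :=
  nth w.1 (w.1 :: [seq x.2.1 | x <- w.2]) m.

Definition history_at (K I J S : finType) (n : nat) (w : play K I J S n)
    (m : nat) : history I J S :=
  take m [seq (x.1, x.2.2) | x <- w.2].

Section Law.
Variables (R : realFieldType) (K I J S : finType) (G : hsg R K I J S).
Variables (b : dist R K) (sigma : strategy1 R I J S) (tau : strategy2 R I J S).

Definition law (n : nat) (w : play K I J S n) : R :=
  b w.1 * \prod_(m < n)
    (let k := state_at w m in
     let h := history_at w m in
     let: (i, j, ks) := tnth w.2 m in
     sigma h i * tau h j * trans G k i j ks).

Definition prob (n : nat) (E : pred (play K I J S n)) : R :=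
  \sum_(w | E w) law w.

Definition expect (n : nat) (f : play K I J S n -> R) : R :=
  \sum_w law w * f w.

Definition stage_reward (n : nat) (w : play K I J S n) (m : 'I_n) : R :=
  let: (i, j, _) := tnth w.2 m in reward G (state_at w m) i j.

Definition payoff (n : nat) : R :=
  expect (fun w : play K I J S n => n%:R^-1 * \sum_(m < n) stage_reward w m).

(* Conditional law of the current state given the history [h]; it is the zero
   function when [h] has probability zero. *)
Definition belief (h : history I J S) (k : K) : R :=
  prob (fun w : play K I J S (size h) =>
          (history_at w (size h) == h) && (state_at w (size h) == k))
  / prob (fun w : play K I J S (size h) => history_at w (size h) == h).

(* The belief B_m at stage m >= 1 is a function of H_m, hence of the first
   m.-1 stages of the play. *)
Definition random_belief (m : nat) (w : play K I J S m.-1) : K -> R :=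
  belief (history_at w m.-1).

End Law.

Definition l1norm (R : realFieldType) (K : finType) (x : K -> R) : R :=
  \sum_k `|x k|.

Definition uniform_value (R : realFieldType) (K I J S : finType)
    (G : hsg R K I J S) (v : dist R K -> R) : Prop :=
  (forall b, 0 <= v b <= 1) /\
  forall (b : dist R K) (eps : R), 0 < eps ->
    exists (sigma' : strategy1 R I J S) (tau' : strategy2 R I J S) (nbar : nat),
      (0 < nbar)%N /\
      forall n : nat, (nbar <= n)%N ->
        (forall tau, v b - eps <= payoff G b sigma' tau n) /\
        (forall sigma, payoff G b sigma tau' n <= v b + eps).

Definition doeblin_at (R : realFieldType) (K I J S : finType)
    (G : hsg R K I J S) (eps : R) (m : nat) (delta : R) : Prop :=
  forall (sigma : strategy1 R I J S) (tau : strategy2 R I J S),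
  exists bbar : dist R K, forall b : dist R K,
    delta <= prob G b sigma tau (fun w : play K I J S m.-1 =>
      l1norm (fun k => random_belief G b sigma tau w k - bbar k) <= eps).

Definition doeblin (R : realFieldType) (K I J S : finType)
    (G : hsg R K I J S) : Prop :=
  forall eps : R, 0 < eps ->
    exists (m : nat) (delta : R),
      [/\ (0 < m)%N, 0 < delta & doeblin_at G eps m delta].

Record rat_hsg := RatHsg {
  nK : nat; nI : nat; nJ : nat; nS : nat;
  rat_game :> hsg rat 'I_nK 'I_nI 'I_nJ 'I_nS
}.

Section RealOfRat.
Variable R : realType.

Lemma ratr_dist_axiom (C : finType) (d : dist rat C) :
  let f := [ffun c => ratr (d c)] : {ffun C -> R} in
  [forall c, 0 <= f c] && (\sum_c f c == 1).
Proof.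
case/andP: (dist_axiom d) => /forallP d0 /eqP d1 /=.
apply/andP; split; first by apply/forallP => c; rewrite ffunE ler0q.
under eq_bigr do rewrite ffunE.
by rewrite -rmorph_sum d1 rmorph1.
Qed.

Definition real_dist (C : finType) (d : dist rat C) : dist R C :=
  Dist (ratr_dist_axiom d).

Lemma ratr_reward01 (K I J S : finType) (G : hsg rat K I J S) k i j :
  0 <= (ratr (reward G k i j) : R) <= 1.
Proof.
by case/andP: (reward01 G k i j) => h0 h1; rewrite ler0q h0 -(rmorph1 ratr) ler_rat.
Qed.

Definition real_game (K I J S : finType) (G : hsg rat K I J S) :
    hsg R K I J S :=
  Hsg (fun k i j => real_dist (trans G k i j)) (ratr_reward01 G)
    (states_gt0 G) (actions1_gt0 G) (actions2_gt0 G) (signals_gt0 G).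

End RealOfRat.

(* Deterministic Turing machines with finitely many two-way infinite tapes.
   A tape cell holds [None] (blank), a bit, or one of finitely many auxiliary
   symbols. *)
Inductive direction := Left | Right | Stay.

Definition symbol (E : Type) := option (bool + E)%type.

Record turing_machine := TuringMachine {
  tm_tapes : nat;  (* number of tapes besides the input-output tape *)
  tm_aux : finType;
  tm_state : finType;
  tm_start : tm_state;
  tm_halting : pred tm_state;
  tm_trans : tm_state -> {ffun 'I_tm_tapes.+1 -> symbol tm_aux} ->
    tm_state * ('I_tm_tapes.+1 -> symbol tm_aux * direction)
}.

(* The cells on the left of the head (nearest first), then the scanned cell and
   the cells on its right; all the cells beyond the lists are blank. *)
Definition tape (E : Type) := (seq (symbol E) * seq (symbol E))%type.

Definition tape_read (E : Type) (t : tape E) : symbol E := head None t.2.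

Definition tape_write (E : Type) (a : symbol E) (t : tape E) : tape E :=
  (t.1, a :: behead t.2).

Definition tape_move (E : Type) (d : direction) (t : tape E) : tape E :=
  match d with
  | Left => (behead t.1, head None t.1 :: t.2)
  | Right => (head None t.2 :: t.1, behead t.2)
  | Stay => t
  end.

Section Execution.
Variable M : turing_machine.

Definition tm_config := (tm_state M * ('I_(tm_tapes M).+1 -> tape (tm_aux M)))%type.

Definition tm_step (c : tm_config) : tm_config :=
  if tm_halting c.1 then c else
  let: (q, act) := tm_trans c.1 [ffun i => tape_read (c.2 i)] in
  (q, fun i => tape_move (act i).2 (tape_write (act i).1 (c.2 i))).

(* The input is written on tape 0, rightwards from the head; the other tapes
   are blank. *)
Definition tm_init (u : seq bool) : tm_config :=
  (tm_start M,
   fun i => if i == ord0 then ([::], [seq Some (inl x) | x <- u])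
            else ([::], [::])).

Fixpoint leading_bits (E : Type) (s : seq (symbol E)) : seq bool :=
  if s is Some (inl x) :: s' then x :: leading_bits s' else [::].

(* The output is the maximal word of bits on tape 0, rightwards from the
   head. *)
Definition tm_output (c : tm_config) : seq bool := leading_bits (c.2 ord0).2.

Definition tm_computes (u v : seq bool) : Prop :=
  exists n : nat,
    let c := iter n tm_step (tm_init u) in tm_halting c.1 /\ tm_output c = v.

End Execution.

(* The number n is written in unary as 1^n 0. *)
Definition word_of_nats (s : seq nat) : seq bool :=
  flatten [seq rcons (nseq n true) false | n <- s].

(* Only used for nonnegative rationals, hence the sign is not encoded. *)
Definition nats_of_rat (q : rat) : seq nat := [:: `|numq q|%N; `|denq q|%N].

Definition nats_of_dist (C : finType) (d : dist rat C) : seq nat :=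
  flatten [seq nats_of_rat (d c) | c <- enum C].

Definition nats_of_game (G : rat_hsg) : seq nat :=
  [:: nK G; nI G; nJ G; nS G] ++
  flatten [seq nats_of_dist (trans G x.1.1 x.1.2 x.2) ++
               nats_of_rat (reward G x.1.1 x.1.2 x.2)
          | x <- enum {: 'I_(nK G) * 'I_(nI G) * 'I_(nJ G)}].

Definition computes_doeblin_mapping (R : realType) (CC : rat_hsg -> Prop)
    (M : turing_machine) : Prop :=
  forall (G : rat_hsg) (eps : rat), CC G -> 0 < eps ->
    exists (m : nat) (delta : rat),
      [/\ tm_computes M (word_of_nats (nats_of_game G ++ nats_of_rat eps))
                        (word_of_nats (m :: nats_of_rat delta)),
          (0 < m)%N, 0 < delta
        & doeblin_at (real_game R G) (ratr eps) m (ratr delta)].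

(* The answer is output as the word encoding 1 (yes) or 0 (no). *)
Definition solves_approximation_problem (R : realType) (CC : rat_hsg -> Prop)
    (M : turing_machine) : Prop :=
  forall (G : rat_hsg) (b : dist rat 'I_(nK G)) (x eps : rat),
    CC G -> 0 <= x <= 1 -> 0 < eps ->
    exists answer : bool,
      tm_computes M
        (word_of_nats (nats_of_game G ++ nats_of_dist b ++
                       nats_of_rat x ++ nats_of_rat eps))
        (word_of_nats [:: nat_of_bool answer]) /\
      forall v : dist R 'I_(nK G) -> R, uniform_value (real_game R G) v ->
        let y := v (real_dist R b) in
        ~ (ratr (x - eps) <= y <= ratr (x + eps)) ->
        (answer <-> ratr (x + eps) < y).

(* Main.v *)
Require Import Defs.
From HB Require Import structures.
From mathcomp Require Import all_boot all_order all_algebra.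
From mathcomp Require Import boolp classical_sets reals.
From mathcomp Require Import ring lra zify.

Set Implicit Arguments.
Unset Strict Implicit.
Unset Printing Implicit Defensive.

Import Order.TTheory GRing.Theory Num.Theory.
Local Open Scope ring_scope.

(** The centre of the Doeblin condition depends on the pair of strategies but not on the initial
    belief. Two beliefs can therefore be compared only under one common pair, and the pair that
    bounds V n mu - V n nu is Player 1's optimal strategy from mu against Player 2's optimal
    strategy from nu. Measures without normalisation make the comparison algebraic: the probability
    of a history splits into a factor of the strategies, common to both measures, and the mass of
    the updated measure, and no conditioning on null histories occurs. The constant m / delta^2 is
    the fixed point of c = m + (1 - delta^2) c: the first stages cost at most m, and the pairs of
    histories with nearby beliefs save a share delta^2 of c. The error from nearby beliefs is linear
    in n and does not accumulate along the induction.

    On the algorithmic side the given machine is a black box, known to halt only on encoded members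
    of the class, so it is simulated as a single command. Checking a certificate is a total
    computation written with bounded iteration; the only unbounded loop is the search, and it ends
    because an exact rational certificate exists. *)

(* Beliefs are replaced by unnormalised measures on the states, so that the value
   [V n mu] of the n-stage game started at [mu] is a recursion on matrix games
   and is homogeneous in [mu].  Playing the same pair of strategies from two
   initial beliefs, the Doeblin condition makes both final beliefs close to a
   common one with a probability that does not depend on the number of stages;
   hence the oscillation of [V n] over beliefs is at most m / delta^2 + 2 eps n.
   Therefore V n / n converges to a constant v, with |V n - n v| bounded by that
   oscillation, and playing optimally in successive long blocks guarantees v.

   For the decision problem, it suffices to compare V n with n x for an n that is
   computed from (m, delta).  Over the rationals the minimax theorem provides
   rational optimal mixed actions, so V n is determined exactly by a finite
   certificate: tables of beliefs, values and mixed actions over the tree of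
   histories, which satisfy local conditions.  The machine runs the given one to
   get (m, delta) and then searches for a certificate. *)

(** * The minimax theorem over an ordered field *)

(* Bartl's induction: if the last functional is needed, project along a point
   that violates the conclusion of the shorter system. *)
Lemma farkas (F : realFieldType) (Z : finType) (m : nat) (a : nat -> Z -> F)
    (c : Z -> F) :
  (forall x : Z -> F, (forall i, (i < m)%N -> \sum_z a i z * x z <= 0) ->
     \sum_z c z * x z <= 0) ->
  exists l : nat -> F, (forall i, (i < m)%N -> 0 <= l i) /\
    forall z, c z = \sum_(i < m) l i * a i z.
Proof.
elim: m a c => [|m IH] a c H.
  exists (fun=> 0); split=> // z; rewrite big_ord0.
  have := H c (fun i => ltac:(done)).
  have h0 : forall z, 0 <= c z * c z by move=> w; rewrite -expr2 sqr_ge0.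
  rewrite (bigD1 z) //= => h.
  have h1 : 0 <= \sum_(i | i != z) c i * c i by apply: sumr_ge0.
  have h2 : c z * c z = 0.
    by apply/eqP; rewrite eq_le h0 andbT; apply: le_trans h; rewrite lerDl.
  by move/eqP: h2; rewrite mulf_eq0 orbb => /eqP.
case: (pselect (forall x : Z -> F,
    (forall i, (i < m)%N -> \sum_z a i z * x z <= 0) -> \sum_z c z * x z <= 0)).
  case/IH=> l [l0 lE]; exists (fun i => if (i < m)%N then l i else 0).
  split=> [i _|z]; first by case: ifP => // /l0.
  rewrite big_ord_recr /= ltnn mul0r addr0 lE.
  by apply: eq_bigr => i _; rewrite ltn_ord.
case/existsNP => x /not_implyP[xle] /negP; rewrite -ltNge => cx.
pose b := \sum_z a m z * x z.
have b0 : 0 < b.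
  rewrite ltNge; apply/negP => bm; move: cx; rewrite ltNge => /negP; apply.
  by apply: H => i; rewrite ltnS leq_eqVlt => /orP[/eqP->//|]; apply: xle.
(* [d - p d * a m] vanishes at [x]; by [pE] it is [d] composed with the projection along [x] onto
   the kernel of [a m]. *)
pose p (d : Z -> F) := (\sum_z d z * x z) / b.
have pE (d : Z -> F) (y : Z -> F) :
    \sum_z (d z - p d * a m z) * y z =
    \sum_z d z * (y z - (\sum_z a m z * y z) / b * x z).
  pose s1 := \sum_z d z * y z; pose s2 := \sum_z a m z * y z.
  pose s3 := \sum_z d z * x z.
  transitivity (s1 - p d * s2).
    rewrite /s1 /s2 mulr_sumr -sumrB; apply: eq_bigr => z _; ring.
  transitivity (s1 - s2 / b * s3).
    by rewrite /p -/s3; ring.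
  rewrite /s1 /s3 mulr_sumr -sumrB; apply: eq_bigr => z _; rewrite -/s2; ring.
have [|l [l0 lE]] := IH (fun i z => a i z - p (a i) * a m z)
                        (fun z => c z - p c * a m z).
  move=> y hy; rewrite pE; apply: H => i; rewrite ltnS leq_eqVlt.
  case/orP=> [/eqP->|im]; last by rewrite -pE; apply: hy.
  rewrite -pE [X in X <= _]big1 // => z _.
  by rewrite /p -/b divff ?gt_eqF // mul1r subrr mul0r.
(* The last multiplier is nonnegative because [p c] is positive while every [p (a i)] is
   nonpositive. *)
exists (fun i => if (i < m)%N then l i else p c - \sum_(i < m) l i * p (a i)).
split=> [i|z].
  rewrite ltnS => im; case: ifP => [/l0//|_]; rewrite subr_ge0.
  apply: (@le_trans _ _ 0); last by rewrite divr_ge0 ?ltW.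
  apply: sumr_le0 => j _; apply: mulr_ge0_le0; first exact: l0.
  by rewrite mulr_le0_ge0 ?xle // invr_ge0 ltW.
rewrite big_ord_recr /= ltnn mulrBl mulr_suml.
have -> : \sum_(i < m) (if (i < m)%N then l i else
    p c - \sum_(i < m) l i * p (a i)) * a i z = \sum_(i < m) l i * a i z.
  by apply: eq_bigr => i _; rewrite ltn_ord.
rewrite addrCA -sumrB.
under eq_bigr do rewrite -mulrA -mulrBr.
by rewrite -lE; ring.
Qed.

Lemma farkas_fin (F : realFieldType) (Z T : finType) (a : T -> Z -> F)
    (c : Z -> F) :
  (forall x : Z -> F, (forall t, \sum_z a t z * x z <= 0) ->
     \sum_z c z * x z <= 0) ->
  exists l : T -> F, (forall t, 0 <= l t) /\
    forall z, c z = \sum_t l t * a t z.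
Proof.
move=> H; pose u (i : nat) z := nth (fun=> 0) [seq a t | t <- enum T] i z.
have uE (t : T) : u (enum_rank t) = a t.
  apply: funext => z; rewrite /u (nth_map t) -?cardE //.
  by rewrite nth_enum_rank.
have [|l [l0 lE]] := @farkas F Z #|T| u c.
  by move=> x hx; apply: H => t; rewrite -uE; apply: hx.
exists (fun t => l (enum_rank t)); split=> [t|z]; first exact: l0.
rewrite lE (reindex (@enum_rank T)) /=; last exact: onW_bij (enum_rank_bij T).
by apply: eq_bigr => t _; rewrite uE.
Qed.

Lemma dist_ge0 (F : realFieldType) (C : finType) (d : dist F C) c : 0 <= d c.
Proof. by case/andP: (dist_axiom d) => /forallP. Qed.

Lemma dist_sum (F : realFieldType) (C : finType) (d : dist F C) :
  \sum_c d c = 1.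
Proof. by case/andP: (dist_axiom d) => _ /eqP. Qed.

Lemma dist_mk (F : realFieldType) (C : finType) (f : C -> F) :
  (forall c, 0 <= f c) -> \sum_c f c = 1 -> exists d : dist F C, forall c, d c = f c.
Proof.
move=> f0 f1.
have h : [forall c, 0 <= [ffun c => f c] c] && (\sum_c [ffun c => f c] c == 1).
  apply/andP; split; first by apply/forallP => c; rewrite ffunE.
  by under eq_bigr do rewrite ffunE; rewrite f1.
by exists (Dist h) => c; rewrite /= ffunE.
Qed.

(* The optimality conditions form a linear system in nonnegative unknowns: the
   two mixed actions, their slacks, and the positive and negative parts of the
   value.  A Farkas certificate of infeasibility would be a pair of unnormalised
   mixed actions of equal masses, and is impossible. *)
Lemma minimax (F : realFieldType) (I J : finType) (A : I -> J -> F) :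
  (0 < #|I|)%N -> (0 < #|J|)%N ->
  exists (x : dist F I) (y : dist F J), forall i j,
    \sum_j' A i j' * y j' <= \sum_i' x i' * A i' j.
Proof.
move=> /card_gt0P[i0 _] /card_gt0P[j0 _].
pose Z : finType := ((J + I) + bool)%type.
pose T : finType := (((I + J) + (J + I)) + bool)%type.
(* The [t] are the nonnegative unknowns, the [z] the equations. Column j says that x A minus a slack
   is the value, column i that A y plus a slack is the value; the last two columns normalise x and
   y. *)
pose a (t : T) (z : Z) : F :=
  match t, z with
  | inl (inl (inl i)), inl (inl j) => A i j
  | inl (inl (inl i)), inr true => 1
  | inl (inl (inr j)), inl (inr i) => - A i j
  | inl (inl (inr j)), inr false => 1
  | inl (inr (inl j)), inl (inl j') => - (j == j')%:R
  | inl (inr (inr i)), inl (inr i') => - (i == i')%:R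
  | inr e, inl (inl _) => if e then - 1 else 1
  | inr e, inl (inr _) => if e then 1 else - 1
  | _, _ => 0
  end.
pose c (z : Z) : F := match z with inr _ => 1 | _ => 0 end.
have sumZ (f : Z -> F) : \sum_z f z =
    \sum_j f (inl (inl j)) + \sum_i f (inl (inr i)) + (f (inr true) + f (inr false)).
  by rewrite !big_sumType /= big_bool.
have sumT (f : T -> F) : \sum_t f t =
    \sum_i f (inl (inl (inl i))) + \sum_j f (inl (inl (inr j))) +
    (\sum_j f (inl (inr (inl j))) + \sum_i f (inl (inr (inr i)))) +
    (f (inr true) + f (inr false)).
  by rewrite !big_sumType /= big_bool.
have delta (C : finType) (k : C) (f : C -> F) :
    \sum_k' - (k == k')%:R * f k' = - f k.
  rewrite (bigD1 k) //= eqxx mulN1r big1 ?addr0 // => k' /negbTE.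
  by rewrite eq_sym => ->; rewrite oppr0 mul0r.
have delta' (C : finType) (k : C) (f : C -> F) :
    \sum_k' f k' * - (k' == k)%:R = - f k.
  by rewrite -delta; apply: eq_bigr => k' _; rewrite mulrC eq_sym.
have sum0 (C : finType) (f : C -> F) : \sum_k f k * 0 = 0.
  by rewrite big1 // => k _; rewrite mulr0.
have [x hx|l [l0 lE]] := @farkas_fin F Z T a c.
  pose y j := x (inl (inl j)); pose w i := x (inl (inr i)).
  pose al := x (inr true); pose be := x (inr false).
  have y0 j : 0 <= y j.
    have := hx (inl (inr (inl j))); rewrite sumZ /= delta !mul0r !addr0.
    by rewrite big1 ?addr0 ?oppr_le0 // => i _; rewrite mul0r.
  have w0 i : 0 <= w i.
    have := hx (inl (inr (inr i))); rewrite sumZ /= delta !mul0r !addr0.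
    by rewrite big1 ?add0r ?oppr_le0 // => j _; rewrite mul0r.
  have hal i : \sum_j A i j * y j + al <= 0.
    have := hx (inl (inl (inl i))); rewrite sumZ /= mul0r addr0 mul1r.
    by rewrite [X in _ + X + _]big1 ?addr0 // => j _; rewrite mul0r.
  have hbe j : - (\sum_i A i j * w i) + be <= 0.
    have := hx (inl (inl (inr j))); rewrite sumZ /= mul0r add0r mul1r.
    rewrite big1 ?add0r => [|i _]; last by rewrite mul0r.
    by under eq_bigr do rewrite mulNr; rewrite sumrN.
  have eqs : \sum_j y j = \sum_i w i.
    have := hx (inr true); have := hx (inr false); rewrite !sumZ /=.
    rewrite !mul0r !addr0 -!mulr_sumr !mulN1r !mul1r -/(y _) => h1 h2.
    by apply/eqP; rewrite eq_le -subr_le0 h1 /= -subr_ge0 -oppr_le0 opprB addrC.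
  rewrite sumZ /= !big1 ?mul1r ?add0r //; try by move=> *; rewrite mul0r.
  rewrite -/al -/be.
  rewrite leNgt; apply/negP => pos.
  set s := \sum_i w i in eqs.
  have h1 : \sum_i w i * (\sum_j A i j * y j) + al * s <= 0.
    rewrite mulr_sumr -big_split /= sumr_le0 // => i _.
    by rewrite [al * _]mulrC -mulrDr mulr_ge0_le0.
  have h2 : - (\sum_i w i * (\sum_j A i j * y j)) + be * s <= 0.
    have -> : \sum_i w i * (\sum_j A i j * y j) = \sum_j y j * (\sum_i A i j * w i).
      under eq_bigr do rewrite mulr_sumr.
      rewrite exchange_big /=; apply: eq_bigr => j _; rewrite mulr_sumr.
      by apply: eq_bigr => i _; ring.
    rewrite -eqs mulr_sumr -sumrN -big_split /= sumr_le0 // => j _.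
    by rewrite [be * _]mulrC -mulrN -mulrDr mulr_ge0_le0.
  (* [h1] and [h2] add up to (al + be) * s <= 0, so a violation forces s = 0. Then [y] and [w]
     vanish, and [hal], [hbe] give al <= 0 and be <= 0. *)
  have s0 : 0 <= s by apply: sumr_ge0.
  have s00 : s = 0.
    apply/eqP; rewrite eq_le s0 andbT leNgt; apply/negP => sp.
    have : 0 < (al + be) * s by rewrite mulr_gt0.
    by rewrite mulrDl; lra.
  have yz j : y j = 0.
    have : \sum_j y j = 0 by rewrite eqs.
    by move/eqP; rewrite psumr_eq0 // => /allP/(_ j (mem_index_enum _))/eqP.
  have wz i : w i = 0.
    by move/eqP: s00; rewrite psumr_eq0 // => /allP/(_ i (mem_index_enum _))/eqP.
  have := hal i0; have := hbe j0.
  rewrite !big1 ?add0r ?oppr0 ?add0r => [hb ha|j _|i _]; rewrite ?yz ?wz ?mulr0 //.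
  lra.
pose xf i := l (inl (inl (inl i))); pose yf j := l (inl (inl (inr j))).
have x1 : \sum_i xf i = 1.
  have := lE (inr true); rewrite sumT /= !mulr0 !addr0.
  rewrite !sum0 ?add0r ?addr0.
  by move=> ->; apply: eq_bigr => i _; rewrite mulr1.
have y1 : \sum_j yf j = 1.
  have := lE (inr false); rewrite sumT /= !mulr0 !addr0.
  rewrite !sum0 ?add0r ?addr0.
  by move=> ->; apply: eq_bigr => i _; rewrite mulr1.
have [x xE] := dist_mk (fun i => l0 (inl (inl (inl i))) : 0 <= xf i) x1.
have [y yE] := dist_mk (fun j => l0 (inl (inl (inr j))) : 0 <= yf j) y1.
exists x, y => i j.
pose v := l (inr true) - l (inr false).
have hj : v <= \sum_i' x i' * A i' j.
  have := lE (inl (inl j)); rewrite sumT /= delta' mulrN1 mulr1.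
  rewrite !sum0 ?add0r ?addr0.
  under eq_bigr do rewrite -/(xf _) -xE.
  by have := l0 (inl (inr (inl j))); rewrite /v; lra.
have hi : \sum_j' A i j' * y j' <= v.
  have := lE (inl (inr i)); rewrite sumT /= delta' mulrN1 mulr1.
  rewrite !sum0 ?add0r ?addr0.
  under eq_bigr do rewrite -/(yf _) -yE mulrN mulrC.
  by rewrite sumrN; have := l0 (inl (inr (inr i))); rewrite /v; lra.
exact: le_trans hi hj.
Qed.

(** * The recursive structure of the game *)

Lemma sum_tuple_cons (F : realFieldType) (A : finType) (n : nat) (f : seq A -> F) :
  \sum_(h : n.+1.-tuple A) f h = \sum_a \sum_(h : n.-tuple A) f (a :: h).
Proof.
rewrite pair_big /=.
rewrite (reindex (fun p : A * n.-tuple A => [tuple of p.1 :: p.2])) //=.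
exists (fun h : n.+1.-tuple A => (thead h, [tuple of behead h])) => [[a h] _|h _] /=.
  by congr pair; apply: val_inj.
by rewrite -tuple_eta.
Qed.

Lemma sum_tuple0 (F : realFieldType) (A : finType) (f : seq A -> F) :
  \sum_(h : 0.-tuple A) f h = f [::].
Proof.
rewrite (bigD1 [tuple]) //= big1 ?addr0 // => h /eqP[].
by rewrite tuple0.
Qed.

Lemma sum_triple (F : realFieldType) (I J S : finType) (f : I * J * S -> F) :
  \sum_a f a = \sum_i \sum_j \sum_s f (i, j, s).
Proof.
by rewrite !pair_big /=; apply: eq_bigr => -[[i j] s].
Qed.

Section Game.
Variables (F : realFieldType) (K I J S : finType) (G : hsg F K I J S).

Local Notation A := (I * J * S)%type.
Local Notation meas := {ffun K -> F}.
Implicit Types (mu nu : meas) (a : A) (h : seq A).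
Implicit Types (sigma : strategy1 F I J S) (tau : strategy2 F I J S).

Definition mass mu : F := \sum_k mu k.

(* Beliefs are kept unnormalised: [upd mu a] is the joint law of the event that
   the letter [a] occurs and of the next state, when the actions of [a] are
   played from [mu]. *)
Definition upd mu a : meas :=
  [ffun k' => \sum_k mu k * trans G k a.1.1 a.1.2 (k', a.2)].

Definition push mu h : meas := foldl upd mu h.

Definition rew mu i j : F := \sum_k mu k * reward G k i j.

Definition shift (X : Type) (s : seq A -> X) a : seq A -> X := fun h => s (a :: h).

(** The expected total reward of n stages when [mu] is a probability. It is linear in [mu], and
    signed [mu] are allowed. *)
Fixpoint gain n mu sigma tau : F :=
  if n is n'.+1 then
    \sum_i \sum_j sigma [::] i * tau [::] j *
      (rew mu i j + \sum_s gain n' (upd mu (i, j, s))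
                             (shift sigma (i, j, s)) (shift tau (i, j, s)))
  else 0.

(** Only the players' share of the probability of [h]: the full probability is this factor times
    [mass (push mu h)]. Its independence of [mu] is what lets two initial measures be compared. *)
Fixpoint hprob sigma tau h : F :=
  if h is a :: h' then
    sigma [::] a.1.1 * tau [::] a.1.2 * hprob (shift sigma a) (shift tau a) h'
  else 1.

(** * Values of matrix games *)

Lemma saddle_exists (B : I -> J -> F) :
  exists xy : dist F I * dist F J, forall i j,
    \sum_j' B i j' * xy.2 j' <= \sum_i' xy.1 i' * B i' j.
Proof.
by have [x [y h]] := minimax B (actions1_gt0 G) (actions2_gt0 G); exists (x, y).
Qed.

Definition saddle B := projT1 (cid (saddle_exists B)).

Definition mval (B : I -> J -> F) : F :=
  \sum_i \sum_j (saddle B).1 i * (saddle B).2 j * B i j.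

Lemma mval_le B i : \sum_j B i j * (saddle B).2 j <= mval B.
Proof.
have h := projT2 (cid (saddle_exists B)); rewrite -/(saddle B) in h.
have -> : \sum_j B i j * (saddle B).2 j =
    \sum_j' (saddle B).2 j' * \sum_j B i j * (saddle B).2 j.
  by rewrite -mulr_suml dist_sum mul1r.
rewrite /mval exchange_big /=; apply: ler_sum => j _.
under [leRHS]eq_bigr do rewrite mulrAC mulrC.
by rewrite -mulr_sumr ler_wpM2l ?dist_ge0.
Qed.

Lemma mval_ge B j : mval B <= \sum_i (saddle B).1 i * B i j.
Proof.
have h := projT2 (cid (saddle_exists B)); rewrite -/(saddle B) in h.
have -> : \sum_i (saddle B).1 i * B i j =
    \sum_i' (saddle B).1 i' * \sum_i (saddle B).1 i * B i j.
  by rewrite -mulr_suml dist_sum mul1r.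
rewrite /mval; apply: ler_sum => i _.
under eq_bigr do rewrite -mulrA.
rewrite -mulr_sumr ler_wpM2l ?dist_ge0 //.
by under eq_bigr do rewrite mulrC.
Qed.

Lemma mval_guarantee1 B (y : dist F J) :
  mval B <= \sum_i \sum_j (saddle B).1 i * y j * B i j.
Proof.
have -> : mval B = \sum_j y j * mval B by rewrite -mulr_suml dist_sum mul1r.
rewrite exchange_big /=; apply: ler_sum => j _.
under [leRHS]eq_bigr do rewrite mulrAC mulrC.
by rewrite -mulr_sumr ler_wpM2l ?dist_ge0 ?mval_ge.
Qed.

Lemma mval_guarantee2 B (x : dist F I) :
  \sum_i \sum_j x i * (saddle B).2 j * B i j <= mval B.
Proof.
have -> : mval B = \sum_i x i * mval B by rewrite -mulr_suml dist_sum mul1r.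
apply: ler_sum => i _; under eq_bigr do rewrite -mulrA.
rewrite -mulr_sumr ler_wpM2l ?dist_ge0 //.
by under eq_bigr do rewrite mulrC; rewrite mval_le.
Qed.

(** The saddle point in [mval] is an arbitrary choice. Any other pair of optimal actions identifies
    the value, which serves both for certificates and for the passage from rational to real
    games. *)
Lemma mval_unique B (x : dist F I) (y : dist F J) w :
  (forall j, w <= \sum_i x i * B i j) -> (forall i, \sum_j y j * B i j <= w) ->
  mval B = w.
Proof.
move=> hx hy; apply/eqP; rewrite eq_le; apply/andP; split.
  apply: le_trans (mval_guarantee1 B y) _.
  have -> : w = \sum_i (saddle B).1 i * w by rewrite -mulr_suml dist_sum mul1r.
  apply: ler_sum => i _; under eq_bigr do rewrite -mulrA.
  by rewrite -mulr_sumr ler_wpM2l ?dist_ge0.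
apply: le_trans (mval_guarantee2 B x).
have -> : w = \sum_j (saddle B).2 j * w by rewrite -mulr_suml dist_sum mul1r.
rewrite exchange_big; apply: ler_sum => j _.
under [leRHS]eq_bigr do rewrite mulrAC mulrC.
by rewrite -mulr_sumr ler_wpM2l ?dist_ge0.
Qed.

(** * Values and optimal strategies of the n-stage games *)

Fixpoint V n mu : F :=
  if n is n'.+1 then
    mval (fun i j => rew mu i j + \sum_s V n' (upd mu (i, j, s)))
  else 0.

Definition stage_game n mu i j : F :=
  rew mu i j + \sum_s V n (upd mu (i, j, s)).

(** The strategy replays the history, updating the measure and the number of remaining stages, and
    plays optimally in the current stage game. *)
Fixpoint opt1 n mu h : dist F I :=
  if h is a :: h' then opt1 n.-1 (upd mu a) h'
  else (saddle (stage_game n.-1 mu)).1.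

Fixpoint opt2 n mu h : dist F J :=
  if h is a :: h' then opt2 n.-1 (upd mu a) h'
  else (saddle (stage_game n.-1 mu)).2.

Lemma VS n mu : V n.+1 mu = mval (stage_game n mu).
Proof. by []. Qed.

Lemma ler_sum_strat (x : dist F I) (y : dist F J) (B C : I -> J -> F) :
  (forall i j, B i j <= C i j) ->
  \sum_i \sum_j x i * y j * B i j <= \sum_i \sum_j x i * y j * C i j.
Proof.
move=> h; apply: ler_sum => i _; apply: ler_sum => j _.
by rewrite ler_wpM2l ?mulr_ge0 ?dist_ge0.
Qed.

Lemma sum_stratD (x : dist F I) (y : dist F J) (B C : I -> J -> F) :
  \sum_i \sum_j x i * y j * (B i j + C i j) =
  \sum_i \sum_j x i * y j * B i j + \sum_i \sum_j x i * y j * C i j.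
Proof.
rewrite -big_split; apply: eq_bigr => i _; rewrite -big_split.
by apply: eq_bigr => j _; rewrite mulrDr.
Qed.

Lemma sum_hprob_cons n sigma tau (f : seq A -> F) :
  \sum_(h : n.+1.-tuple A) hprob sigma tau h * f h =
  \sum_i \sum_j sigma [::] i * tau [::] j * \sum_s \sum_(h : n.-tuple A)
    hprob (shift sigma (i, j, s)) (shift tau (i, j, s)) h * f ((i, j, s) :: h).
Proof.
rewrite (sum_tuple_cons n (fun h => hprob sigma tau h * f h)) sum_triple.
apply: eq_bigr => i _; apply: eq_bigr => j _; rewrite mulr_sumr.
apply: eq_bigr => s _; rewrite mulr_sumr; apply: eq_bigr => h _ /=.
by rewrite -!mulrA.
Qed.

(** Dynamic programming over m stages, kept one-sided with an arbitrary opponent, because the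
    opponent will be optimal for a different measure or horizon. *)
Lemma V_dp1 m n mu tau :
  V (m + n) mu <= gain m mu (opt1 (m + n) mu) tau +
    \sum_(h : m.-tuple A) hprob (opt1 (m + n) mu) tau h * V n (push mu h).
Proof.
elim: m mu tau => [|m IH] mu tau.
  rewrite add0n add0r (sum_tuple0 (fun h => hprob _ tau h * V n (push mu h))).
  by rewrite mul1r.
rewrite (sum_hprob_cons m (opt1 (m.+1 + n) mu) tau (fun h => V n (push mu h))).
rewrite addSn VS /= -sum_stratD.
apply: le_trans (mval_guarantee1 _ (tau [::])) _.
apply: ler_sum_strat => i j; rewrite /stage_game -addrA lerD2l -big_split /=.
by apply: ler_sum => s _; apply: IH.
Qed.

Lemma V_dp2 m n mu sigma :
  gain m mu sigma (opt2 (m + n) mu) +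
    \sum_(h : m.-tuple A) hprob sigma (opt2 (m + n) mu) h * V n (push mu h)
  <= V (m + n) mu.
Proof.
elim: m mu sigma => [|m IH] mu sigma.
  rewrite add0n add0r (sum_tuple0 (fun h => hprob sigma _ h * V n (push mu h))).
  by rewrite mul1r.
rewrite (sum_hprob_cons m sigma (opt2 (m.+1 + n) mu) (fun h => V n (push mu h))).
rewrite addSn VS /= -sum_stratD.
apply: le_trans (mval_guarantee2 _ (sigma [::])).
apply: ler_sum_strat => i j; rewrite /stage_game -addrA lerD2l -big_split /=.
by apply: ler_sum => s _; apply: IH.
Qed.

Lemma V_opt1 n mu tau : V n mu <= gain n mu (opt1 n mu) tau.
Proof.
have := V_dp1 n 0 mu tau; rewrite addn0 [X in _ + X]big1 ?addr0 // => h _.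
by rewrite mulr0.
Qed.

Lemma V_opt2 n mu sigma : gain n mu sigma (opt2 n mu) <= V n mu.
Proof.
have := V_dp2 n 0 mu sigma; rewrite addn0 [X in _ + X]big1 ?addr0 // => h _.
by rewrite mulr0.
Qed.

Definition nneg mu := forall k, 0 <= mu k.

Lemma upd_ge0 mu a : nneg mu -> nneg (upd mu a).
Proof.
move=> h k; rewrite ffunE; apply: sumr_ge0 => k' _.
by rewrite mulr_ge0 ?dist_ge0.
Qed.

Lemma push_ge0 mu h : nneg mu -> nneg (push mu h).
Proof. by elim: h mu => //= a h IH mu h0; apply: IH; apply: upd_ge0. Qed.

Lemma mass_ge0 mu : nneg mu -> 0 <= mass mu.
Proof. by move=> h; apply: sumr_ge0. Qed.

Lemma mass_dist (b : dist F K) : mass b = 1.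
Proof. exact: dist_sum. Qed.

Lemma mass_upd mu i j : \sum_s mass (upd mu (i, j, s)) = mass mu.
Proof.
rewrite /mass; under eq_bigr => s _ do under eq_bigr => k' _ do rewrite ffunE.
under eq_bigr => s _ do rewrite exchange_big /=.
rewrite exchange_big /=; apply: eq_bigr => k _.
under eq_bigr => s _ do rewrite -mulr_sumr.
rewrite -mulr_sumr exchange_big pair_big /=.
have -> : \sum_p trans G k i j (p.1, p.2) = \sum_c trans G k i j c.
  by apply: eq_bigr => -[].
by rewrite dist_sum mulr1.
Qed.

Lemma sum_strat_cst (x : dist F I) (y : dist F J) (c : F) :
  \sum_i \sum_j x i * y j * c = c.
Proof.
under eq_bigr do rewrite -mulr_suml -mulr_sumr dist_sum mulr1.
by rewrite -mulr_suml dist_sum mul1r.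
Qed.

Lemma hprob_ge0 sigma tau h : 0 <= hprob sigma tau h.
Proof.
by elim: h sigma tau => [|a h IH] sigma tau //=; rewrite !mulr_ge0 ?dist_ge0.
Qed.

Lemma sum_hprob_mass n mu sigma tau :
  \sum_(h : n.-tuple A) hprob sigma tau h * mass (push mu h) = mass mu.
Proof.
elim: n mu sigma tau => [|n IH] mu sigma tau.
  by rewrite (sum_tuple0 (fun h => hprob sigma tau h * mass (push mu h))) mul1r.
rewrite (sum_hprob_cons n sigma tau (fun h => mass (push mu h))) /=.
rewrite -[RHS](sum_strat_cst (sigma [::]) (tau [::])).
apply: eq_bigr => i _; apply: eq_bigr => j _; congr (_ * _).
by rewrite -(mass_upd mu i j); apply: eq_bigr => s _; rewrite IH.
Qed.

Lemma rew_ge0 mu i j : nneg mu -> 0 <= rew mu i j.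
Proof.
move=> h; apply: sumr_ge0 => k _.
by rewrite mulr_ge0 //; case/andP: (reward01 G k i j).
Qed.

Lemma rew_le mu i j : nneg mu -> rew mu i j <= mass mu.
Proof.
move=> h; apply: ler_sum => k _.
by rewrite -[leRHS]mulr1 ler_wpM2l //; case/andP: (reward01 G k i j).
Qed.

Lemma gain_ge0 n mu sigma tau : nneg mu -> 0 <= gain n mu sigma tau.
Proof.
elim: n mu sigma tau => [|n IH] mu sigma tau h //=.
apply: sumr_ge0 => i _; apply: sumr_ge0 => j _.
rewrite !mulr_ge0 ?dist_ge0 ?addr_ge0 ?rew_ge0 ?sumr_ge0 // => s _.
by apply: IH; apply: upd_ge0.
Qed.

Lemma gain_le n mu sigma tau : nneg mu -> gain n mu sigma tau <= n%:R * mass mu.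
Proof.
elim: n mu sigma tau => [|n IH] mu sigma tau h /=; first by rewrite mul0r.
rewrite -[leRHS](sum_strat_cst (sigma [::]) (tau [::])).
apply: ler_sum_strat => i j; rewrite -natr1 mulrDl mul1r addrC lerD ?rew_le //.
rewrite -(mass_upd mu i j) mulr_sumr; apply: ler_sum => s _.
by apply: IH; apply: upd_ge0.
Qed.

Lemma gain_mono n k mu sigma tau :
  nneg mu -> gain n mu sigma tau <= gain (n + k) mu sigma tau.
Proof.
elim: n mu sigma tau => [|n IH] mu sigma tau h; first exact: gain_ge0.
rewrite addSn /=; apply: ler_sum_strat => i j; rewrite lerD2l.
by apply: ler_sum => s _; apply: IH; apply: upd_ge0.
Qed.

Definition scalem c mu : meas := [ffun k => c * mu k].

Lemma updZ c mu a : upd (scalem c mu) a = scalem c (upd mu a).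
Proof.
apply/ffunP => k; rewrite !ffunE mulr_sumr.
by apply: eq_bigr => k' _; rewrite ffunE mulrA.
Qed.

Lemma updB mu nu a : upd (mu - nu) a = upd mu a - upd nu a.
Proof.
apply/ffunP => k; rewrite !ffunE -sumrB.
by apply: eq_bigr => k' _; rewrite !ffunE mulrBl.
Qed.

Lemma rewZ c mu i j : rew (scalem c mu) i j = c * rew mu i j.
Proof.
by rewrite /rew mulr_sumr; apply: eq_bigr => k _; rewrite ffunE -mulrA.
Qed.

Lemma rewB mu nu i j : rew (mu - nu) i j = rew mu i j - rew nu i j.
Proof.
by rewrite /rew -sumrB; apply: eq_bigr => k _; rewrite !ffunE mulrBl.
Qed.

Lemma gainZ n c mu sigma tau :
  gain n (scalem c mu) sigma tau = c * gain n mu sigma tau.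
Proof.
elim: n mu sigma tau => [|n IH] mu sigma tau /=; first by rewrite mulr0.
rewrite mulr_sumr; apply: eq_bigr => i _; rewrite mulr_sumr.
apply: eq_bigr => j _; rewrite rewZ.
under eq_bigr do rewrite updZ IH.
by rewrite -mulr_sumr; ring.
Qed.

Lemma gainB n mu nu sigma tau :
  gain n (mu - nu) sigma tau = gain n mu sigma tau - gain n nu sigma tau.
Proof.
elim: n mu nu sigma tau => [|n IH] mu nu sigma tau /=; first by rewrite subr0.
rewrite -sumrB; apply: eq_bigr => i _; rewrite -sumrB.
apply: eq_bigr => j _; rewrite rewB.
under eq_bigr do rewrite updB IH.
by rewrite sumrB; ring.
Qed.

(** An optimal strategy for one of the two measures is pitted against an optimal one for the other;
    [gain] is linear in the measure. *)
Lemma VZ n c mu : 0 <= c -> V n (scalem c mu) = c * V n mu.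
Proof.
move=> c0; apply/eqP; rewrite eq_le; apply/andP; split.
  apply: le_trans (V_opt1 n (scalem c mu) (opt2 n mu)) _.
  by rewrite gainZ ler_wpM2l ?V_opt2.
apply: le_trans (V_opt2 n (scalem c mu) (opt1 n mu)).
by rewrite gainZ ler_wpM2l ?V_opt1.
Qed.

Lemma V_ge0 n mu : nneg mu -> 0 <= V n mu.
Proof.
by move=> h; apply: le_trans (V_opt2 n mu (opt1 n mu)); apply: gain_ge0.
Qed.

Lemma V_le n mu : nneg mu -> V n mu <= n%:R * mass mu.
Proof.
by move=> h; apply: le_trans (V_opt1 n mu (opt2 n mu)) _; apply: gain_le.
Qed.

(** Player 1 plays optimally for [mu], Player 2 for [nu]: the difference is at most the gain from
    the signed measure [mu - nu], hence at most the gain from its positive part. *)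
Lemma V_lip n mu nu : V n mu - V n nu <= n%:R * l1norm (fun k => mu k - nu k).
Proof.
pose p : meas := [ffun k => Num.max (mu k - nu k) 0].
pose m : meas := [ffun k => Num.max (nu k - mu k) 0].
have p0 : nneg p by move=> k; rewrite ffunE le_max lexx orbT.
have m0 : nneg m by move=> k; rewrite ffunE le_max lexx orbT.
have eqpm : mu - nu = p - m.
  apply/ffunP => k; rewrite !ffunE.
  case: (leP (mu k - nu k) 0); case: (leP (nu k - mu k) 0); lra.
apply: (@le_trans _ _ (gain n (mu - nu) (opt1 n mu) (opt2 n nu))).
  by rewrite gainB lerB ?V_opt1 ?V_opt2.
rewrite eqpm gainB.
apply: (@le_trans _ _ (n%:R * mass p)).
  by rewrite lerBlDr ler_wpDr ?gain_ge0 ?gain_le.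
rewrite ler_wpM2l // ler_sum // => k _; rewrite ffunE.
by rewrite ge_max normr_ge0 ler_norm.
Qed.

(** * Oscillation of the value over initial measures *)

(** The bound V n b - V n b' <= c on beliefs, cross-multiplied by the masses so that null measures
    need no separate treatment. *)
Definition osc_le n c := forall mu nu, nneg mu -> nneg nu ->
  mass nu * V n mu - mass mu * V n nu <= c * mass mu * mass nu.

Lemma osc_n n : osc_le n n%:R.
Proof.
move=> mu nu mu0 nu0; rewrite lerBlDr ler_wpDr ?mulr_ge0 ?mass_ge0 ?V_ge0 //.
by rewrite [leRHS]mulrC ler_wpM2l ?V_le ?mass_ge0.
Qed.

Lemma osc_mono n c c' : c <= c' -> osc_le n c -> osc_le n c'.
Proof.
move=> cc' h mu nu mu0 nu0; apply: le_trans (h _ _ mu0 nu0) _.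
by rewrite !ler_wpM2r ?mass_ge0.
Qed.

Lemma V_near n mu nu e : nneg mu -> nneg nu -> 
  l1norm (fun k => mass nu * mu k - mass mu * nu k) <= e * mass mu * mass nu ->
  mass nu * V n mu - mass mu * V n nu <= n%:R * e * mass mu * mass nu.
Proof.
move=> mu0 nu0 h; rewrite -!VZ ?mass_ge0 //.
apply: le_trans (V_lip _ _ _) _; rewrite -!mulrA ler_wpM2l // mulrA.
by apply: le_trans h; rewrite /l1norm; under eq_bigr do rewrite !ffunE.
Qed.

(* Running the two initial measures with the same strategies, independently:
   both final beliefs fall near a common one with probability at least
   [delta ^+ 2]. *)
Lemma osc_step m n c e delta mu nu :
  nneg mu -> nneg nu -> mass mu = 1 -> mass nu = 1 -> 0 <= c -> 0 <= delta ->
  osc_le n (c + n%:R * e) ->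
  (forall sigma tau, exists Emu Enu : pred (seq A),
    [/\ delta <= \sum_(h : m.-tuple A | Emu h) hprob sigma tau h * mass (push mu h),
        delta <= \sum_(h : m.-tuple A | Enu h) hprob sigma tau h * mass (push nu h) &
        forall h h' : m.-tuple A, Emu h -> Enu h' ->
          l1norm (fun k => mass (push nu h') * push mu h k -
                           mass (push mu h) * push nu h' k) <=
          e * mass (push mu h) * mass (push nu h')]) ->
  V (m + n) mu - V (m + n) nu <= m%:R + (1 - delta ^+ 2) * c + n%:R * e.
Proof.
move=> mu0 nu0 mu1 nu1 c0 d0 osc near.
(* This pair is used from both measures: [sigma] bounds the value at [mu] from above by its own
   guarantee, [tau] the value at [nu] from below. *)
set sigma := opt1 (m + n) mu; set tau := opt2 (m + n) nu.
have h1 : V (m + n) mu <=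
    m%:R + \sum_(h : m.-tuple A) hprob sigma tau h * V n (push mu h).
  apply: le_trans (V_dp1 m n mu tau) _; rewrite lerD2r.
  by apply: le_trans (gain_le _ _ _ mu0) _; rewrite mu1 mulr1.
have h2 : \sum_(h : m.-tuple A) hprob sigma tau h * V n (push nu h) <= V (m + n) nu.
  by apply: le_trans (V_dp2 m n nu sigma); rewrite lerDr gain_ge0.
have [Emu [Enu [dmu dnu close]]] := near sigma tau.
pose P h := hprob sigma tau h * mass (push mu h).
pose Q h := hprob sigma tau h * mass (push nu h).
have P0 h : 0 <= P h by rewrite mulr_ge0 ?hprob_ge0 ?mass_ge0 //; apply: push_ge0.
have Q0 h : 0 <= Q h by rewrite mulr_ge0 ?hprob_ge0 ?mass_ge0 //; apply: push_ge0.
have P1 : \sum_(h : m.-tuple A) P h = 1 by rewrite sum_hprob_mass.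
have Q1 : \sum_(h : m.-tuple A) Q h = 1 by rewrite sum_hprob_mass.
pose D (h h' : seq A) := mass (push nu h') * V n (push mu h) -
                 mass (push mu h) * V n (push nu h').
(* Each sum is multiplied by the total probability 1 of the other one, which turns the difference
   into a sum over independent pairs of histories. *)
have DE : \sum_(h : m.-tuple A) hprob sigma tau h * V n (push mu h) -
          \sum_(h : m.-tuple A) hprob sigma tau h * V n (push nu h) =
          \sum_(h : m.-tuple A) \sum_(h' : m.-tuple A)
             hprob sigma tau h * hprob sigma tau h' * D h h'.
  transitivity (\sum_(h : m.-tuple A) \sum_(h' : m.-tuple A)
      (Q h' * (hprob sigma tau h * V n (push mu h)) -
       P h * (hprob sigma tau h' * V n (push nu h')))).
    transitivity ((\sum_(h : m.-tuple A) Q h) *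
        (\sum_(h : m.-tuple A) hprob sigma tau h * V n (push mu h)) -
      (\sum_(h : m.-tuple A) P h) *
        (\sum_(h : m.-tuple A) hprob sigma tau h * V n (push nu h))).
      by rewrite Q1 P1 !mul1r.
    rewrite !big_distrlr /= exchange_big -sumrB; apply: eq_bigr => h _.
    by rewrite -sumrB.
  apply: eq_bigr => h _; apply: eq_bigr => h' _; rewrite /P /Q /D; ring.
(* A pair of nearby beliefs costs only [n * e]; any other pair costs in addition the constant [c] of
   the induction hypothesis. *)
have bound (h h' : m.-tuple A) : hprob sigma tau h * hprob sigma tau h' * D h h' <=
    P h * Q h' * (n%:R * e + (1 - (Emu h && Enu h')%:R) * c).
  have -> : P h * Q h' * (n%:R * e + (1 - (Emu h && Enu h')%:R) * c) =
    hprob sigma tau h * hprob sigma tau h' *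
    ((n%:R * e + (1 - (Emu h && Enu h')%:R) * c) *
      mass (push mu h) * mass (push nu h')) by rewrite /P /Q; ring.
  apply: ler_wpM2l; first by rewrite mulr_ge0 ?hprob_ge0.
  case: (boolP (Emu h && Enu h')) => [/andP[eh eh']|_].
    rewrite subrr mul0r addr0; apply: V_near; try exact: push_ge0.
    exact: close.
  rewrite subr0 mul1r addrC; apply: osc; exact: push_ge0.
have sumE : \sum_(h : m.-tuple A) \sum_(h' : m.-tuple A)
     P h * Q h' * (n%:R * e + (1 - (Emu h && Enu h')%:R) * c) =
   n%:R * e + (1 - (\sum_(h : m.-tuple A | Emu h) P h) *
                   (\sum_(h : m.-tuple A | Enu h) Q h)) * c.
  transitivity (\sum_(h : m.-tuple A) \sum_(h' : m.-tuple A)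
     (P h * Q h' * (n%:R * e + c) - P h * (Emu h)%:R * (Q h' * (Enu h')%:R) * c)).
    apply: eq_bigr => h _; apply: eq_bigr => h' _.
    by rewrite -mulnb natrM; ring.
  under eq_bigr => h _.
    rewrite sumrB -!mulr_suml -!mulr_sumr Q1.
    over.
  rewrite sumrB -!mulr_suml P1.
  rewrite [X in _ * X * c](_ : _ = \sum_(h : m.-tuple A | Enu h) Q h); last first.
    rewrite [RHS]big_mkcond; apply: eq_bigr => h _.
    by case: (Enu h); rewrite ?mulr1 ?mulr0.
  rewrite [X in X * _ * c](_ : _ = \sum_(h : m.-tuple A | Emu h) P h); last first.
    rewrite [RHS]big_mkcond; apply: eq_bigr => h _.
    by case: (Emu h); rewrite ?mulr1 ?mulr0.
  by ring.
have main : \sum_(h : m.-tuple A) \sum_(h' : m.-tuple A)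
     hprob sigma tau h * hprob sigma tau h' * D h h' <=
     n%:R * e + (1 - delta ^+ 2) * c.
  apply: (@le_trans _ _ (n%:R * e + (1 - (\sum_(h : m.-tuple A | Emu h) P h) *
                   (\sum_(h : m.-tuple A | Enu h) Q h)) * c)).
    by rewrite -sumE; apply: ler_sum => h _; apply: ler_sum => h' _.
  by rewrite lerD2l ler_wpM2r // lerB // expr2 ler_pM.
apply: (@le_trans _ _ (m%:R + (\sum_(h : m.-tuple A) hprob sigma tau h * V n (push mu h)
   - \sum_(h : m.-tuple A) hprob sigma tau h * V n (push nu h)))).
  by rewrite addrA lerB.
by rewrite DE -addrA lerD2l [X in _ <= X]addrC.
Qed.

End Game.

(** * Laws of truncated plays and beliefs *)

Section Link.
Variables (F : realFieldType) (K I J S : finType) (G : hsg F K I J S).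

Local Notation A := (I * J * S)%type.
Local Notation X := (I * J * (K * S))%type.
Implicit Types (mu : {ffun K -> F}) (x : X) (t : seq X).
Implicit Types (sigma : strategy1 F I J S) (tau : strategy2 F I J S).

Definition letter x : A := (x.1, x.2.2).

(** [law] is a product indexed by stages; this form peels off the first stage, as the recursion of
    [gain] does. *)
Fixpoint path_weight k sigma tau t : F :=
  if t is x :: t' then
    sigma [::] x.1.1 * tau [::] x.1.2 * trans G k x.1.1 x.1.2 x.2 *
    path_weight x.2.1 (shift sigma (letter x)) (shift tau (letter x)) t'
  else 1.

Fixpoint path_reward k t : F :=
  if t is x :: t' then reward G k x.1.1 x.1.2 + path_reward x.2.1 t' else 0.

Lemma state_at_cons n (k : K) x (t : n.-tuple X) (m : nat) : (m <= n)%N ->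
  state_at (k, [tuple of x :: t]) m.+1 = state_at (x.2.1, t) m.
Proof.
by move=> mn; apply: set_nth_default; rewrite /= size_map size_tuple.
Qed.

Lemma law_path n (b : dist F K) sigma tau (w : play K I J S n) :
  law G b sigma tau w = b w.1 * path_weight w.1 sigma tau w.2.
Proof.
rewrite /law; congr (_ * _); case: w => k t /=.
elim: n k sigma tau t => [|n IH] k sigma tau t.
  by rewrite big_ord0 tuple0.
case/tupleP: t => x t; rewrite big_ord_recl /= -IH; congr (_ * _).
  by rewrite tnth0; case: x => [[i j] ks].
apply: eq_bigr => m _; rewrite tnthS state_at_cons; last exact/ltnW.
by case: (tnth t m) => [[i j] ks].
Qed.

Lemma stage_reward_path n (w : play K I J S n) :
  \sum_(m < n) stage_reward G w m = path_reward w.1 w.2.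
Proof.
case: w => k t /=; elim: n k t => [|n IH] k t.
  by rewrite big_ord0 tuple0.
case/tupleP: t => x t; rewrite big_ord_recl /= -IH; congr (_ + _).
  by rewrite /stage_reward tnth0; case: x => [[i j] ks].
apply: eq_bigr => m _; rewrite /stage_reward tnthS state_at_cons; last exact/ltnW.
by case: (tnth t m) => [[i j] ks].
Qed.

Lemma sum_play n (f : K -> seq X -> F) :
  \sum_(w : play K I J S n) f w.1 w.2 = \sum_(t : n.-tuple X) \sum_k f k t.
Proof. by rewrite exchange_big pair_big /=; apply: eq_bigr => -[k t]. Qed.

Lemma sum_step (f : I -> J -> K -> S -> F) :
  \sum_(x : X) f x.1.1 x.1.2 x.2.1 x.2.2 =
  \sum_i \sum_j \sum_s \sum_k f i j k s.
Proof.
symmetry.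
under eq_bigr => i _ do under eq_bigr => j _ do rewrite exchange_big pair_big /=.
by rewrite !pair_big /=; apply: eq_bigr => -[[i j] [k s]].
Qed.

(** Summing out the hidden intermediate states: up to the factor [hprob], [push mu h] is the joint
    law of the history and of the current state. *)
Lemma sum_path n mu sigma tau (f : seq A -> K -> F) :
  \sum_(t : n.-tuple X) \sum_k mu k * path_weight k sigma tau t *
    f [seq letter x | x <- t] (last k [seq x.2.1 | x <- t]) =
  \sum_(h : n.-tuple A) hprob sigma tau h * \sum_k push G mu h k * f h k.
Proof.
elim: n mu sigma tau f => [|n IH] mu sigma tau f.
  rewrite (sum_tuple0 (fun t => \sum_k mu k * path_weight k sigma tau t *
    f [seq letter x | x <- t] (last k [seq x.2.1 | x <- t]))).
  rewrite (sum_tuple0 (fun h => hprob sigma tau h * \sum_k push G mu h k * f h k)) /=.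
  by rewrite mul1r; apply: eq_bigr => k _; rewrite mulr1.
rewrite (sum_tuple_cons n (fun t => \sum_k mu k * path_weight k sigma tau t *
    f [seq letter x | x <- t] (last k [seq x.2.1 | x <- t]))).
rewrite (sum_hprob_cons n sigma tau (fun h => \sum_k push G mu h k * f h k)) /=.
transitivity (\sum_(x : X) sigma [::] x.1.1 * tau [::] x.1.2 *
    \sum_(t : n.-tuple X) upd G mu (x.1.1, x.1.2, x.2.2) x.2.1 *
     path_weight x.2.1 (shift sigma (x.1.1, x.1.2, x.2.2))
                       (shift tau (x.1.1, x.1.2, x.2.2)) t *
     f ((x.1.1, x.1.2, x.2.2) :: [seq letter x | x <- t])
       (last x.2.1 [seq x.2.1 | x <- t])).
  apply: eq_bigr => -[[i j] [k' s]] _ /=; rewrite mulr_sumr.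
  apply: eq_bigr => t _; rewrite ffunE /= !mulr_suml mulr_sumr.
  by apply: eq_bigr => k _; rewrite /letter /=; ring.
rewrite (sum_step (fun i j k s => sigma [::] i * tau [::] j *
    \sum_(t : n.-tuple X) upd G mu (i, j, s) k *
     path_weight k (shift sigma (i, j, s)) (shift tau (i, j, s)) t *
     f ((i, j, s) :: [seq letter x | x <- t]) (last k [seq x.2.1 | x <- t]))).
apply: eq_bigr => i _; apply: eq_bigr => j _; rewrite mulr_sumr.
apply: eq_bigr => s _; rewrite -mulr_sumr exchange_big /=; congr (_ * _).
exact: (IH (upd G mu (i, j, s)) _ _ (fun h k => f ((i, j, s) :: h) k)).
Qed.

Lemma path_weight_sum n k sigma tau :
  \sum_(t : n.-tuple X) path_weight k sigma tau t = 1.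
Proof.
elim: n k sigma tau => [|n IH] k sigma tau.
  by rewrite (sum_tuple0 (path_weight k sigma tau)).
rewrite (sum_tuple_cons n (path_weight k sigma tau)) /=.
under eq_bigr do rewrite -mulr_sumr IH mulr1.
transitivity (\sum_(x : X) sigma [::] x.1.1 * tau [::] x.1.2 *
   trans G k x.1.1 x.1.2 (x.2.1, x.2.2)).
  by apply: eq_bigr => -[[i j] [k' s]].
rewrite (sum_step (fun i j k' s => sigma [::] i * tau [::] j * trans G k i j (k', s))).
rewrite -[RHS](sum_strat_cst (sigma [::]) (tau [::])).
apply: eq_bigr => i _; apply: eq_bigr => j _.
under eq_bigr do rewrite -mulr_sumr.
rewrite -mulr_sumr exchange_big pair_big /=.
have -> : \sum_p trans G k i j (p.1, p.2) = \sum_c trans G k i j c.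
  by apply: eq_bigr => -[].
by rewrite dist_sum.
Qed.

Lemma sum_path_reward n mu sigma tau :
  \sum_(t : n.-tuple X) \sum_k mu k * path_weight k sigma tau t * path_reward k t =
  gain G n mu sigma tau.
Proof.
elim: n mu sigma tau => [|n IH] mu sigma tau.
  rewrite (sum_tuple0 (fun t => \sum_k mu k * path_weight k sigma tau t * path_reward k t)).
  by rewrite big1 // => k _; rewrite mulr0.
rewrite (sum_tuple_cons n (fun t => \sum_k mu k * path_weight k sigma tau t * path_reward k t)).
transitivity (\sum_(x : X) sigma [::] x.1.1 * tau [::] x.1.2 *
   (\sum_k mu k * trans G k x.1.1 x.1.2 (x.2.1, x.2.2) * reward G k x.1.1 x.1.2 +
    \sum_(t : n.-tuple X) upd G mu (x.1.1, x.1.2, x.2.2) x.2.1 *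
     path_weight x.2.1 (shift sigma (x.1.1, x.1.2, x.2.2))
                       (shift tau (x.1.1, x.1.2, x.2.2)) t * path_reward x.2.1 t)).
  apply: eq_bigr => -[[i j] [k' s]] _ /=.
  rewrite mulrDr.
  (* The reward of the first stage is spread over the continuations, whose weights add up to 1. *)
  have <- : \sum_(t : n.-tuple X) path_weight k' (shift sigma (i, j, s))
     (shift tau (i, j, s)) t * (sigma [::] i * tau [::] j * (\sum_k mu k *
       trans G k i j (k', s) * reward G k i j)) =
     sigma [::] i * tau [::] j *
       (\sum_k mu k * trans G k i j (k', s) * reward G k i j).
    by rewrite -mulr_suml path_weight_sum mul1r.
  rewrite [X in _ = _ + X]mulr_sumr -big_split; apply: eq_bigr => t _ /=.
  rewrite ffunE /= !mulr_suml !mulr_sumr -big_split /=.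
  by apply: eq_bigr => k _; rewrite /letter /=; ring.
rewrite (sum_step (fun i j k' s => sigma [::] i * tau [::] j *
   (\sum_k mu k * trans G k i j (k', s) * reward G k i j +
    \sum_(t : n.-tuple X) upd G mu (i, j, s) k' *
     path_weight k' (shift sigma (i, j, s)) (shift tau (i, j, s)) t *
     path_reward k' t))) /=.
apply: eq_bigr => i _; apply: eq_bigr => j _.
under eq_bigr do rewrite -mulr_sumr big_split /=.
rewrite -mulr_sumr big_split /=; congr (_ * (_ + _)).
  under eq_bigr do rewrite exchange_big /=.
  rewrite exchange_big; apply: eq_bigr => k _ /=.
  under eq_bigr do rewrite -mulr_suml -mulr_sumr.
  rewrite -mulr_suml -mulr_sumr exchange_big pair_big /=.
  have -> : \sum_p trans G k i j (p.1, p.2) = \sum_c trans G k i j c.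
    by apply: eq_bigr => -[].
  by rewrite dist_sum mulr1.
by apply: eq_bigr => s _; rewrite exchange_big; apply: IH.
Qed.

Lemma payoffE n (b : dist F K) sigma tau :
  payoff G b sigma tau n = n%:R^-1 * gain G n b sigma tau.
Proof.
rewrite /payoff /expect -sum_path_reward.
rewrite -(sum_play n (fun k t => b k * path_weight k sigma tau t * path_reward k t)).
rewrite mulr_sumr; apply: eq_bigr => w _.
by rewrite law_path stage_reward_path; ring.
Qed.

Lemma history_full n (w : play K I J S n) :
  history_at w n = [seq letter x | x <- w.2].
Proof. by rewrite /history_at take_oversize // size_map size_tuple. Qed.

Lemma state_full n (w : play K I J S n) :
  state_at w n = last w.1 [seq x.2.1 | x <- w.2].
Proof.
rewrite /state_at (last_nth w.1); congr nth.
by rewrite size_map size_tuple.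
Qed.

Lemma prob_history n (b : dist F K) sigma tau (C : seq A -> K -> bool) :
  prob G b sigma tau (fun w : play K I J S n => C (history_at w n) (state_at w n)) =
  \sum_(h : n.-tuple A) hprob sigma tau h * \sum_(k | C h k) push G b h k.
Proof.
transitivity (\sum_(h : n.-tuple A) hprob sigma tau h *
    \sum_k push G b h k * (C h k)%:R); last first.
  apply: eq_bigr => h _; congr (_ * _); rewrite [RHS]big_mkcond.
  by apply: eq_bigr => k _; case: (C h k); rewrite ?mulr1 ?mulr0.
rewrite -(sum_path n b sigma tau (fun h k => (C h k)%:R)).
rewrite -(sum_play n (fun k t => b k * path_weight k sigma tau t *
   (C [seq letter x | x <- t] (last k [seq x.2.1 | x <- t]))%:R)).
rewrite /prob big_mkcond; apply: eq_bigr => w _.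
rewrite history_full state_full law_path.
by case: (C _ _); rewrite ?mulr1 ?mulr0.
Qed.

Lemma sum_tuple_eq n (h0 : n.-tuple A) (f : seq A -> F) :
  \sum_(h : n.-tuple A) (if (h : seq A) == h0 then f h else 0) = f h0.
Proof. by rewrite -big_mkcond big_pred1_eq. Qed.

Lemma prob_eq_history (b : dist F K) sigma tau (h0 : seq A) :
  prob G b sigma tau (fun w : play K I J S (size h0) =>
    history_at w (size h0) == h0) = hprob sigma tau h0 * mass (push G b h0).
Proof.
rewrite (prob_history (size h0) b sigma tau (fun h _ => h == h0)).
rewrite -(sum_tuple_eq (in_tuple h0) (fun h => hprob sigma tau h * mass (push G b h))).
by apply: eq_bigr => h _ /=; case: eqP => // _; rewrite big_pred0_eq mulr0.
Qed.

Lemma prob_eq_history_state (b : dist F K) sigma tau (h0 : seq A) k :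
  prob G b sigma tau (fun w : play K I J S (size h0) =>
    (history_at w (size h0) == h0) && (state_at w (size h0) == k)) =
  hprob sigma tau h0 * push G b h0 k.
Proof.
rewrite (prob_history (size h0) b sigma tau (fun h k' => (h == h0) && (k' == k))).
rewrite -(sum_tuple_eq (in_tuple h0) (fun h => hprob sigma tau h * push G b h k)).
apply: eq_bigr => h _ /=; case: eqP => [->|_] /=.
  by rewrite big_pred1_eq.
by rewrite big_pred0_eq mulr0.
Qed.

Lemma belief_mass (b : dist F K) sigma tau h :
  hprob sigma tau h * mass (push G b h) != 0 ->
  forall k, mass (push G b h) * belief G b sigma tau h k = push G b h k.
Proof.
rewrite mulf_eq0 negb_or => /andP[q0 m0] k.
rewrite /belief prob_eq_history prob_eq_history_state.
by field; rewrite q0 m0.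
Qed.

(** Null histories, where [belief] is the zero function, contribute nothing; discarding them makes
    [belief_mass] applicable to every remaining one. *)
Lemma prob_random_belief m (b : dist F K) sigma tau (C : (K -> F) -> bool) :
  prob G b sigma tau (fun w : play K I J S m.-1 =>
    C (random_belief G b sigma tau w)) =
  \sum_(h : m.-1.-tuple A | C (belief G b sigma tau h) &&
                            (hprob sigma tau h * mass (push G b h) != 0))
    hprob sigma tau h * mass (push G b h).
Proof.
rewrite (prob_history m.-1 b sigma tau (fun h _ => C (belief G b sigma tau h))).
rewrite [RHS]big_mkcond; apply: eq_bigr => h _ /=.
case: (C _) => /=; last by rewrite big_pred0_eq mulr0.
by case: eqP.
Qed.

End Link.

(** * Doeblin games *)

Section Oscillation.
Variables (F : realFieldType) (K I J S : finType) (G : hsg F K I J S).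

Local Notation A := (I * J * S)%type.

Lemma dist_nneg (b : dist F K) : nneg b.
Proof. exact: dist_ge0. Qed.

Lemma mass0_V n mu : nneg mu -> mass mu = 0 -> V G n mu = 0.
Proof.
move=> mu0 m0; apply/eqP; rewrite eq_le V_ge0 // andbT.
by apply: le_trans (V_le G n mu0) _; rewrite m0 mulr0.
Qed.

Lemma normalize (mu : {ffun K -> F}) : nneg mu -> mass mu != 0 ->
  exists b : dist F K, forall n, V G n mu = mass mu * V G n b.
Proof.
move=> mu0 m0.
have [||b bE] := @dist_mk F K (fun k => (mass mu)^-1 * mu k).
- by move=> k; rewrite mulr_ge0 ?invr_ge0 ?mass_ge0.
- by rewrite -mulr_sumr mulVf.
exists b => n; rewrite -VZ ?mass_ge0 //; congr V; apply/ffunP => k.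
by rewrite ffunE bE mulVKf.
Qed.

Lemma osc_dist n c :
  (forall b b' : dist F K, V G n b - V G n b' <= c) -> osc_le G n c.
Proof.
move=> h mu nu mu0 nu0.
have [m0|m0] := eqVneq (mass mu) 0.
  by rewrite (mass0_V n mu0 m0) m0 !(mulr0, mul0r) subrr.
have [n0|n0] := eqVneq (mass nu) 0.
  by rewrite (mass0_V n nu0 n0) n0 !(mulr0, mul0r) subrr.
have [b ->] := normalize mu0 m0; have [b' ->] := normalize nu0 n0.
have -> : mass nu * (mass mu * V G n b) - mass mu * (mass nu * V G n b') =
   mass mu * mass nu * (V G n b - V G n b') by ring.
by rewrite -[leRHS]mulrA [leRHS]mulrC ler_wpM2l ?mulr_ge0 ?mass_ge0.
Qed.

Lemma l1_sum_near (x y z : K -> F) e : l1norm (fun k => x k - z k) <= e ->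
  l1norm (fun k => y k - z k) <= e -> l1norm (fun k => x k - y k) <= 2 * e.
Proof.
move=> hx hy.
apply: (@le_trans _ _ (l1norm (fun k => x k - z k) + l1norm (fun k => y k - z k))).
  rewrite -big_split; apply: ler_sum => k _.
  by rewrite [X in _ <= _ + X]distrC; apply: ler_distD.
by rewrite mulr_natl mulr2n lerD.
Qed.

(** The centre is common to [b] and [b'], so the triangle inequality through it gives the factor 2.
    The belief at stage m depends on m - 1 letters. *)
Lemma doeblin_near e m delta : doeblin_at G e m delta ->
  forall b b' : dist F K, forall sigma tau, exists Eb Eb' : pred (seq A),
    [/\ delta <= \sum_(h : m.-1.-tuple A | Eb h) hprob sigma tau h * mass (push G b h),
        delta <= \sum_(h : m.-1.-tuple A | Eb' h) hprob sigma tau h * mass (push G b' h) &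
        forall h h' : m.-1.-tuple A, Eb h -> Eb' h' ->
          l1norm (fun k => mass (push G b' h') * push G b h k -
                           mass (push G b h) * push G b' h' k) <=
          2 * e * mass (push G b h) * mass (push G b' h')].
Proof.
move=> doe b b' sigma tau; have [bbar near] := doe sigma tau.
pose E b h := (l1norm (fun k => belief G b sigma tau h k - bbar k) <= e) &&
  (hprob sigma tau h * mass (push G b h) != 0).
exists (E b), (E b'); rewrite /E.
have H b1 := prob_random_belief G m b1 sigma tau
   (fun x => l1norm (fun k => x k - bbar k) <= e).
split; [by rewrite -H; exact: near | by rewrite -H; exact: near | ].
move=> h h' /andP[c1 p1] /andP[c2 p2].
have e1 := belief_mass p1; have e2 := belief_mass p2.
have -> : 2 * e * mass (push G b h) * mass (push G b' h') =
   mass (push G b h) * mass (push G b' h') * (2 * e) by ring.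
apply: le_trans (ler_wpM2l _ (l1_sum_near c1 c2)); last first.
  by rewrite mulr_ge0 ?mass_ge0 //; apply: push_ge0; apply: dist_nneg.
rewrite /l1norm mulr_sumr; apply: ler_sum => k _.
rewrite -e1 -e2 -[X in X * `|_|]ger0_norm; last first.
  by rewrite mulr_ge0 ?mass_ge0 //; apply: push_ge0; apply: dist_nneg.
rewrite -normrM le_eqVlt; apply/orP; left; apply/eqP; congr `|_|; ring.
Qed.

Lemma dist_inhabited : exists b : dist F K, True.
Proof.
have [k0 _] := card_gt0P (states_gt0 G).
have h0 (k : K) : 0 <= (k == k0)%:R :> F by [].
have h1 : \sum_k (k == k0)%:R = 1 :> F.
  by rewrite (bigD1 k0) //= eqxx big1 ?addr0 // => k /negbTE->.
by have [b _] := dist_mk h0 h1; exists b.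
Qed.

(** Strong induction on n in steps of m - 1 stages through [osc_step], with the fixed point m /
    delta^2 as the constant. *)
Lemma doeblin_osc e m delta : 0 <= e -> 0 < delta ->
  doeblin_at G e m delta ->
  forall n, osc_le G n (m%:R / delta ^+ 2 + n%:R * (2 * e)).
Proof.
move=> e0 d0 doe; have near := doeblin_near doe.
have D0 : 0 <= m%:R / delta ^+ 2 by rewrite divr_ge0 ?ler0n ?exprn_ge0 ?(ltW d0).
(* If m = 1 no stage elapses and the induction would not progress. The empty history is then in both
   events, as [delta > 0], so the initial beliefs are themselves within 2 e. *)
case: (posnP m.-1) => [m0|m0] n.
  apply: osc_dist => b b'.
  have [Eb [Eb' [hb hb' close]]] := near b b' (opt1 G 0 b) (opt2 G 0 b).
  have sum0 b1 (E : pred (seq A)) :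
      \sum_(h : 0.-tuple A | E h) hprob (opt1 G 0 b) (opt2 G 0 b) h * mass (push G b1 h) =
      if E [::] then mass b1 else 0.
    rewrite big_mkcond (sum_tuple0 (fun h => if E h then
      hprob (opt1 G 0 b) (opt2 G 0 b) h * mass (push G b1 h) else 0)) /=.
    by rewrite mul1r.
  move: hb hb' close; rewrite m0 !sum0.
  case eb : (Eb [::]); last by move=> h; move: d0; rewrite ltNge h.
  case eb' : (Eb' [::]); last by move=> _ h; move: d0; rewrite ltNge h.
  move=> _ _ /(_ [tuple] [tuple] eb eb') /= c.
  have := V_near G n (dist_nneg b) (dist_nneg b') c.
  rewrite !mass_dist !mulr1 !mul1r => h; apply: le_trans h _.
  by rewrite lerDr.
elim/ltn_ind: n => n IH.
(* For a short horizon the trivial bound n suffices, since [delta] is at most a probability and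
   hence m <= m / delta^2. *)
have [nm|mn] := ltnP n m.-1.
  apply: osc_mono (osc_n G n).
  have [b _] := dist_inhabited.
  have [Eb [_ [hb _ _]]] := near b b (opt1 G 0 b) (opt2 G 0 b).
  have dl1 : delta <= 1.
    apply: le_trans hb _; rewrite -(mass_dist b).
    rewrite -(sum_hprob_mass G m.-1 b (opt1 G 0 b) (opt2 G 0 b)).
    rewrite [leRHS](bigID (fun h : m.-1.-tuple A => Eb h)) /= lerDl.
    apply: sumr_ge0 => h _; rewrite mulr_ge0 ?hprob_ge0 ?mass_ge0 //.
    by apply: push_ge0; apply: dist_nneg.
  apply: (@le_trans _ _ m%:R); first by rewrite ler_nat; lia.
  apply: (@le_trans _ _ (m%:R / delta ^+ 2)); last first.
    by rewrite lerDl !mulr_ge0.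
  by rewrite ler_pdivlMr ?exprn_gt0 // -[leRHS]mulr1 ler_wpM2l // exprn_ile1 // ltW.
have := IH (n - m.-1)%N ltac:(lia).
set n' := (n - m.-1)%N => osc; apply: osc_dist => b b'.
have -> : n = (m.-1 + n')%N by rewrite /n'; lia.
apply: le_trans (osc_step (dist_nneg b) (dist_nneg b') _ _ D0 (ltW d0) osc (near b b')) _;
  rewrite ?mass_dist //.
rewrite mulrBl mul1r [delta ^+ 2 * _]mulrC divfK ?expf_neq0 ?gt_eqF //.
rewrite natrD [(m.-1%:R + n'%:R) * _]mulrDl.
have : (m.-1%:R : F) <= m%:R by rewrite ler_nat leq_pred.
have : 0 <= m.-1%:R * (2 * e) by rewrite !mulr_ge0.
lra.
Qed.

(** Whatever the belief after k stages, the value of the n following ones is V n b' up to c. *)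
Lemma V_add k n c (b b' : dist F K) : osc_le G n c ->
  `|V G (k + n) b - (V G k b + V G n b')| <= c.
Proof.
move=> osc; rewrite ler_norml.
have osc1 mu : nneg mu -> V G n mu <= mass mu * (V G n b' + c).
  move=> mu0; have := osc mu b' mu0 (dist_nneg b').
  by rewrite mass_dist mul1r mulr1; lra.
have osc2 mu : nneg mu -> mass mu * (V G n b' - c) <= V G n mu.
  move=> mu0; have := osc b' mu (dist_nneg b') mu0.
  by rewrite mass_dist mul1r mulr1; lra.
have one sigma tau x :
    \sum_(h : k.-tuple A) hprob sigma tau h * (mass (push G b h) * x) = x.
  under eq_bigr do rewrite mulrA.
  by rewrite -mulr_suml sum_hprob_mass mass_dist mul1r.
apply/andP; split.
  rewrite lerBrDl; apply: le_trans (V_dp2 G k n b (opt1 G k b)).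
  rewrite -addrA lerD ?V_opt1 //.
  rewrite -(one (opt1 G k b) (opt2 G (k + n) b) (V G n b' - c)).
  apply: ler_sum => h _; rewrite ler_wpM2l ?hprob_ge0 // osc2 //.
  by apply: push_ge0; apply: dist_nneg.
rewrite lerBlDl; apply: le_trans (V_dp1 G k n b (opt2 G k b)) _.
rewrite -addrA lerD ?V_opt2 //.
rewrite -[leRHS](one (opt1 G (k + n) b) (opt2 G k b)).
apply: ler_sum => h _; rewrite ler_wpM2l ?hprob_ge0 // osc1 //.
by apply: push_ge0; apply: dist_nneg.
Qed.

Lemma V_mul q n c (b b' : dist F K) : osc_le G n c ->
  `|V G (q * n) b - q%:R * V G n b'| <= q%:R * c.
Proof.
move=> osc; elim: q => [|q IH]; first by rewrite !mul0r subrr normr0.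
have := V_add (q * n) b b' osc; rewrite addnC -mulSn => h.
have -> : V G (q.+1 * n) b - q.+1%:R * V G n b' =
  (V G (q.+1 * n) b - (V G (q * n) b + V G n b')) +
  (V G (q * n) b - q%:R * V G n b') by rewrite -natr1; ring.
apply: le_trans (ler_normD _ _) _.
by rewrite -natr1 mulrDl mul1r addrC lerD.
Qed.

(** V (m * n) is computed both as m blocks of length n and as n blocks of length m. *)
Lemma V_cross m n c d (b b' : dist F K) : osc_le G n c -> osc_le G m d ->
  `|m%:R * V G n b - n%:R * V G m b'| <= m%:R * c + n%:R * d.
Proof.
move=> oc od; have h1 := V_mul m b b oc; have h2 := V_mul n b b' od.
have -> : m%:R * V G n b - n%:R * V G m b' =
  (V G (n * m) b - n%:R * V G m b') - (V G (m * n) b - m%:R * V G n b).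
  by rewrite [(n * m)%N]mulnC; ring.
by apply: le_trans (ler_normB _ _) _; rewrite addrC lerD.
Qed.

(** [r] counts the stages left in the current block; at 0 a new block of length n starts from the
    current measure. *)
Fixpoint blk1 n r mu (h : seq A) : dist F I :=
  if h is a :: h' then blk1 n (if r is r'.+1 then r' else n.-1) (upd G mu a) h'
  else opt1 G (if r is 0 then n else r) mu [::].

Fixpoint blk2 n r mu (h : seq A) : dist F J :=
  if h is a :: h' then blk2 n (if r is r'.+1 then r' else n.-1) (upd G mu a) h'
  else opt2 G (if r is 0 then n else r) mu [::].

(** The r remaining stages of the current block are followed by q full blocks, each worth at least
    [lb] per unit of mass. Mass is preserved on average, so the guarantees add up. *)
Lemma blk1_guarantee n lb : 
  (forall mu, nneg mu -> mass mu * lb <= V G n.+1 mu) ->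
  forall q r mu tau, nneg mu ->
  V G r mu + mass mu * (q%:R * lb) <= gain G (r + q * n.+1) mu (blk1 n.+1 r mu) tau.
Proof.
move=> hlb; elim=> [|q IHq]; elim=> [|r IHr] mu tau mu0.
- by rewrite mul0r mulr0 addr0.
- rewrite addSn VS /= mul0r mulr0 addr0.
  apply: le_trans (mval_guarantee1 _ _ (tau [::])) _.
  apply: ler_sum_strat => i j; rewrite lerD2l; apply: ler_sum => s _.
  have := IHr (upd G mu (i, j, s)) (shift tau (i, j, s)) (upd_ge0 G _ mu0).
  by rewrite mul0r mulr0 addr0.
- have -> : blk1 n.+1 0 mu = blk1 n.+1 n.+1 mu by apply: funext => -[].
  have := IHq n.+1 mu tau mu0.
  rewrite [(0 + q.+1 * n.+1)%N]/= add0n mulSn => h; apply: le_trans h.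
  rewrite add0r -natr1 mulrDl mul1r mulrDr addrC lerD2r.
  exact: hlb.
- rewrite addSn VS /=.
  rewrite -[X in _ + X](sum_strat_cst (saddle G (stage_game G r mu)).1 (tau [::])).
  apply: le_trans (lerD (mval_guarantee1 _ _ (tau [::])) (lexx _)) _.
  rewrite -sum_stratD; apply: ler_sum_strat => i j.
  rewrite /stage_game -addrA lerD2l -(mass_upd G mu i j) mulr_suml -big_split /=.
  by apply: ler_sum => s _; apply: IHr; apply: upd_ge0.
Qed.

Lemma blk2_guarantee n ub :
  (forall mu, nneg mu -> V G n.+1 mu <= mass mu * ub) ->
  forall q r mu sigma, nneg mu ->
  gain G (r + q * n.+1) mu sigma (blk2 n.+1 r mu) <= V G r mu + mass mu * (q%:R * ub).
Proof.
move=> hub; elim=> [|q IHq]; elim=> [|r IHr] mu sigma mu0.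
- by rewrite mul0r mulr0 addr0.
- rewrite addSn VS /= mul0r mulr0 addr0.
  apply: le_trans (mval_guarantee2 _ _ (sigma [::])).
  apply: ler_sum_strat => i j; rewrite lerD2l; apply: ler_sum => s _.
  have := IHr (upd G mu (i, j, s)) (shift sigma (i, j, s)) (upd_ge0 G _ mu0).
  by rewrite mul0r mulr0 addr0.
- have -> : blk2 n.+1 0 mu = blk2 n.+1 n.+1 mu by apply: funext => -[].
  have := IHq n.+1 mu sigma mu0.
  rewrite [(0 + q.+1 * n.+1)%N]/= add0n mulSn => h; apply: le_trans h _.
  rewrite add0r -natr1 [(_ + 1) * _]mulrDl mul1r mulrDr addrC lerD2l.
  exact: hub.
- rewrite addSn VS /=.
  rewrite -[X in _ <= _ + X](sum_strat_cst (sigma [::]) (saddle G (stage_game G r mu)).2).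
  apply: le_trans (lerD (mval_guarantee2 _ _ (sigma [::])) (lexx _)).
  rewrite -sum_stratD; apply: ler_sum_strat => i j.
  rewrite /stage_game -addrA lerD2l -(mass_upd G mu i j) mulr_suml -big_split /=.
  by apply: ler_sum => s _; apply: IHr; apply: upd_ge0.
Qed.

End Oscillation.

(** * The limit value and the uniform value *)

Section UniformValue.
Variables (R : realType) (K I J S : finType) (G : hsg R K I J S).

Lemma nat_ge (x : R) : exists n : nat, (0 < n)%N /\ x <= n%:R.
Proof.
exists (Num.bound `|x|).+1; split=> //.
apply: le_trans (ler_norm x) _.
by rewrite ltW // (lt_trans (archi_boundP (normr_ge0 x))) // ltr_nat.
Qed.

Lemma doeblin_osc_small : doeblin G -> forall eps : R, 0 < eps ->
  exists n0, (0 < n0)%N /\ forall n, (n0 <= n)%N -> osc_le G n (n%:R * eps).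
Proof.
move=> doe eps e0; have e4 : 0 < eps / 4 by rewrite divr_gt0.
have [m [delta [_ d0 hd]]] := doe _ e4.
have [n0 [n00 hn0]] := nat_ge (m%:R / delta ^+ 2 / (eps / 2)).
exists n0; split=> // n nn0; apply: osc_mono (doeblin_osc (ltW e4) d0 hd n).
have : m%:R / delta ^+ 2 <= n%:R * (eps / 2).
  rewrite -ler_pdivrMr ?divr_gt0 //; apply: le_trans hn0 _.
  by rewrite ler_nat.
set x := m%:R / _; have -> : n%:R * eps = n%:R * (eps / 2) + n%:R * (2 * (eps / 4)).
  by field.
by rewrite lerD2r.
Qed.

(** By [V_cross] each (V n b0 - c) / n is below each (V m b + d) / m; v is the supremum of the
    former. Small oscillations at large horizons close the gap. *)
Lemma limit_value : doeblin G -> exists v : R, 0 <= v <= 1 /\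
  forall n c (b : dist R K), (0 < n)%N -> osc_le G n c -> `|V G n b - n%:R * v| <= c.
Proof.
move=> doe; have [b0 _] := dist_inhabited G.
pose E := [set x : R | exists n c, [/\ (0 < n)%N, osc_le G n c &
   x = (V G n b0 - c) / n%:R]]%classic.
have ub n c (b : dist R K) : (0 < n)%N -> osc_le G n c -> ubound E ((V G n b + c) / n%:R).
  move=> n0 oc x [m [d [m0 od ->]]].
  have := V_cross b b0 oc od; rewrite ler_norml => /andP[h _].
  rewrite ler_pdivrMr ?ltr0n // mulrAC ler_pdivlMr ?ltr0n //; lra.
have lb n c : (0 < n)%N -> osc_le G n c -> (V G n b0 - c) / n%:R <= sup E.
  move=> n0 oc; apply: ub_le_sup; last by exists n, c.
  by exists ((V G n b0 + c) / n%:R); apply: ub.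
have osc1 n : osc_le G n n%:R := osc_n G n.
have Ene : (E !=set0)%classic by exists ((V G 1 b0 - 1%:R) / 1%:R); exists 1%N, 1%:R.
have leE n c (b : dist R K) : (0 < n)%N -> osc_le G n c -> sup E <= (V G n b + c) / n%:R.
  by move=> n0 oc; apply: ge_sup => //; apply: ub.
have bnd n c (b : dist R K) : (0 < n)%N -> osc_le G n c -> `|V G n b - n%:R * sup E| <= c.
  move=> n0 oc; have := leE n c b n0 oc.
  rewrite ler_pdivlMr ?ltr0n // => h1.
  rewrite ler_norml; apply/andP; split; first lra.
  have [//|h] := leP (V G n b - n%:R * sup E) c; exfalso.
  (* Comparison with a horizon m of oscillation at most m eps bounds the excess by 2 n eps, whereas
     it equals 4 n eps. *)
  pose eps := (V G n b - n%:R * sup E - c) / n%:R / 4.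
  have eps0 : 0 < eps by rewrite !divr_gt0 ?ltr0n ?subr_gt0.
  have [m [m0 /(_ m (leqnn m)) om]] := doeblin_osc_small doe eps0.
  have := V_cross b b0 oc om; rewrite ler_norml => /andP[_ h2].
  have := lb _ _ m0 om; rewrite ler_pdivrMr ?ltr0n // => h3.
  have : n%:R * (V G m b0 - m%:R * eps) <= n%:R * (sup E * m%:R) by rewrite ler_wpM2l.
  have : m%:R * (n%:R * (4 * eps)) = m%:R * (V G n b - n%:R * sup E - c).
    by rewrite /eps; field; rewrite pnatr_eq0 -lt0n.
  have : 0 < m%:R * (n%:R * eps) by apply: mulr_gt0; last apply: mulr_gt0; rewrite ?ltr0n.
  lra.
exists (sup E); split=> //.
have small eps : 0 < eps -> - eps <= sup E <= 1 + eps.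
  move=> e0; have [m [m0 /(_ m (leqnn m)) om]] := doeblin_osc_small doe e0.
  have := bnd _ _ b0 m0 om; rewrite ler_norml => /andP[h1 h2].
  have := V_ge0 G m (dist_nneg b0); have := V_le G m (dist_nneg b0).
  rewrite mass_dist mulr1 => h3 h4.
  have mp : 0 < m%:R :> R by rewrite ltr0n.
  by apply/andP; split; rewrite -(ler_pM2l mp); lra.
apply/andP; split.
  by apply/ler_addgt0Pr => eps /small/andP[]; lra.
by apply/ler_addgt0Pr => eps /small/andP[].
Qed.

Lemma mass_scale n (x : R) mu : nneg mu ->
  ((forall b : dist R K, x <= V G n b) -> mass mu * x <= V G n mu) /\
  ((forall b : dist R K, V G n b <= x) -> V G n mu <= mass mu * x).
Proof.
move=> mu0; have [m0|m0] := eqVneq (mass mu) 0.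
  by rewrite (mass0_V _ _ mu0 m0) m0 !mul0r.
have [b ->] := normalize G mu0 m0.
by split=> h; rewrite ler_wpM2l ?mass_ge0.
Qed.

Lemma uniform_value_exists (v : R) : doeblin G -> 0 <= v <= 1 ->
  (forall n c (b : dist R K), (0 < n)%N -> osc_le G n c ->
     `|V G n b - n%:R * v| <= c) ->
  uniform_value G (fun=> v).
Proof.
move=> doe v01 bnd; split=> // b eps eps0; have /andP[v0 v1] := v01.
have e2 : 0 < eps / 2 by rewrite divr_gt0.
have [n [n0 /(_ n (leqnn n)) osc]] := doeblin_osc_small doe e2.
case: n n0 osc => // n _ osc.
set lb := n.+1%:R * (v - eps / 2); set ub := n.+1%:R * (v + eps / 2).
have hlb mu : nneg mu -> mass mu * lb <= V G n.+1 mu.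
  case/(mass_scale n.+1 lb) => h _; apply: h => b'.
  by have := bnd _ _ b' (ltn0Sn n) osc; rewrite ler_norml /lb => /andP[]; lra.
have hub mu : nneg mu -> V G n.+1 mu <= mass mu * ub.
  case/(mass_scale n.+1 ub) => _ h; apply: h => b'.
  by have := bnd _ _ b' (ltn0Sn n) osc; rewrite ler_norml /ub => /andP[]; lra.
(* An incomplete block changes the total by at most n.+1 * (1 + eps), which [M * (eps / 2)] absorbs
   for M >= N. *)
have [N [N0 hN]] := nat_ge (n.+1%:R * (1 + eps) / (eps / 2)).
exists (blk1 G n.+1 0 b), (blk2 G n.+1 0 b), N; split=> // M NM.
have Mp : 0 < M%:R :> R by rewrite ltr0n (leq_trans N0).
have hM : n.+1%:R * (1 + eps) <= M%:R * (eps / 2).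
  by rewrite -ler_pdivrMr //; apply: le_trans hN _; rewrite ler_nat.
pose q := (M %/ n.+1)%N.
have qM : (q * n.+1 <= M)%N by apply: leq_divM.
have Mq : (M <= q.+1 * n.+1)%N by rewrite ltnW // ltn_ceil.
have qMR : q%:R * n.+1%:R <= M%:R :> R by rewrite -natrM ler_nat.
have MqR : M%:R <= (q%:R + 1) * n.+1%:R :> R by rewrite natr1 -natrM ler_nat.
split=> [tau|sigma]; rewrite payoffE.
  have h1 := blk1_guarantee hlb q 0 tau (dist_nneg b).
  have h2 := gain_mono G (q * n.+1) (M - q * n.+1) (blk1 G n.+1 0 b) tau (dist_nneg b).
  rewrite subnKC // in h2; rewrite add0n in h1.
  have h3 := le_trans h1 h2; rewrite add0r mass_dist mul1r in h3.
  rewrite mulrC ler_pdivlMr //; apply: le_trans h3; rewrite /lb.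
  (* Player 1 rounds down to q full blocks. A negative guarantee per stage only improves when stages
     are dropped; a positive one loses at most one block. *)
  have [vs|vs] := leP (v - eps / 2) 0.
    have : M%:R * (v - eps / 2) <= (q%:R * n.+1%:R) * (v - eps / 2).
      by rewrite ler_wnM2r.
    have := mulr_gt0 Mp e2; lra.
  have : (M%:R - q%:R * n.+1%:R) * (v - eps / 2) <= n.+1%:R * 1.
    by apply: ler_pM; rewrite ?subr_ge0 // ?(ltW vs) //; lra.
  have : 0 <= n.+1%:R * eps :> R by rewrite mulr_ge0 // ltW.
  lra.
(* Player 2 rounds up instead: rewards are nonnegative, so M stages yield at most as much as q + 1
   blocks. *)
have h1 := blk2_guarantee hub q.+1 0 sigma (dist_nneg b).
have h2 := gain_mono G M (q.+1 * n.+1 - M) sigma (blk2 G n.+1 0 b) (dist_nneg b).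
rewrite subnKC // in h2; rewrite add0n in h1.
have h3 := le_trans h2 h1; rewrite add0r mass_dist mul1r in h3.
rewrite mulrC ler_pdivrMr //; apply: le_trans h3 _; rewrite /ub -natr1.
have : ((q%:R + 1) * n.+1%:R - M%:R) * (v + eps / 2) <= n.+1%:R * (1 + eps).
  apply: ler_pM; rewrite ?subr_ge0 //; lra.
lra.
Qed.

(** At the horizon q * n, the uniformly good strategies meet the optimal ones of the finite game, so
    V (q * n) is within q * eps of q * n * v; [V_mul] then divides by q. *)
Lemma uniform_value_bound (v : dist R K -> R) n c (b : dist R K) : uniform_value G v ->
  (0 < n)%N -> osc_le G n c -> `|V G n b - n%:R * v b| <= c.
Proof.
move=> [_ uv] n0 osc; apply/ler_addgt0Pr => eps eps0.
have np : 0 < n%:R :> R by rewrite ltr0n.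
(* The threshold [q] of the uniform value also serves as the number of blocks, since q * n >= q. *)
have [sg [ta [q [q0 hq]]]] := uv b (eps / n%:R) (divr_gt0 eps0 np).
have [h1 h2] := hq (q * n)%N (leq_pmulr q n0).
have qp : 0 < q%:R :> R by rewrite ltr0n.
have := h1 (opt2 G (q * n) b); have := h2 (opt1 G (q * n) b).
rewrite !payoffE ![_^-1 * _]mulrC ler_pdivrMr ?ler_pdivlMr ?ltr0n ?muln_gt0 ?q0 //.
have := V_opt1 G (q * n) b ta; have := V_opt2 G (q * n) b sg.
set x := gain _ _ _ _ _; set y := gain _ _ _ _ _ => hx hy.
rewrite natrM !mulrDl.
have -> : eps / n%:R * (q%:R * n%:R) = q%:R * eps.
  by field; rewrite pnatr_eq0 -lt0n.
have -> : - (eps / n%:R) * (q%:R * n%:R) = - (q%:R * eps).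
  by field; rewrite pnatr_eq0 -lt0n.
move=> k2 k1.
have := V_mul q b b osc; rewrite ler_norml => /andP[m1 m2].
rewrite -(ler_pM2l qp) -[X in X * `|_|](ger0_norm (ltW qp)) -normrM ler_norml.
apply/andP; split; lra.
Qed.

Lemma uniform_value_unique (v : dist R K -> R) : doeblin G -> uniform_value G v ->
  forall b b', v b = v b'.
Proof.
move=> doe uv b b'; apply/eqP; rewrite -subr_eq0 -normr_le0.
apply/ler_addgt0Pr => eps eps0; rewrite add0r.
have [n [n0 /(_ n (leqnn n)) osc]] := doeblin_osc_small doe (divr_gt0 eps0 (ltr0n R 3)).
have h1 := uniform_value_bound b uv n0 osc; have h2 := uniform_value_bound b' uv n0 osc.
have h3 := osc b b' (dist_nneg b) (dist_nneg b').
have h4 := osc b' b (dist_nneg b') (dist_nneg b).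
rewrite !mass_dist !mul1r !mulr1 in h3 h4.
have np : 0 < n%:R :> R by rewrite ltr0n.
rewrite -(ler_pM2l np) -[X in X * `|_|](ger0_norm (ltW np)) -normrM ler_norml.
move: h1 h2; rewrite !ler_norml => /andP[a1 a2] /andP[a3 a4].
apply/andP; split; lra.
Qed.

End UniformValue.

Local Close Scope ring_scope.

(** * From tape programs to Turing machines *)

(* A tape seen from its head: the content of the cell at each signed distance,
   so that the trailing blanks of [tape] disappear. *)
Definition atape (E : Type) := int -> symbol E.

Section Tapes.
Variable E : Type.

Definition abs_tape (t : tape E) : atape E :=
  fun z => match z with Posz n => nth None t.2 n | Negz n => nth None t.1 n end.

Definition ashift (d : direction) (t : atape E) : atape E :=
  match d with
  | Left => fun z => t (z - 1)%R
  | Right => fun z => t (z + 1)%R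
  | Stay => t
  end.

Definition awrite (a : symbol E) (t : atape E) : atape E :=
  fun z => if z == 0%R then a else t z.

Lemma abs_read (t : tape E) : abs_tape t 0%R = tape_read t.
Proof. by case: t => l [|x r]. Qed.

Lemma abs_write a (t : tape E) : abs_tape (tape_write a t) = awrite a (abs_tape t).
Proof.
apply: funext => -[[|n]|n]; rewrite /awrite //=.
by case: t => l [|x r] //=; rewrite nth_nil.
Qed.

Lemma abs_move d (t : tape E) : abs_tape (tape_move d t) = ashift d (abs_tape t).
Proof.
case: t => l r; apply: funext => z; case: d => //=.
  case: z => [[|n]|n].
  - by rewrite /=; case: l.
  - by rewrite (_ : (Posz n.+1 - 1)%R = Posz n) //; lia.
  - rewrite (_ : (Negz n - 1)%R = Negz n.+1); last by lia.
    by rewrite /= nth_behead.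
case: z => [n|[|n]].
- rewrite (_ : (Posz n + 1)%R = Posz n.+1); last by lia.
  by rewrite /= nth_behead.
- by rewrite /=; case: r.
- by rewrite (_ : (Negz n.+1 + 1)%R = Negz n) //; lia.
Qed.

Lemma awrite_id (t : atape E) : awrite (t 0%R) t = t.
Proof. by apply: funext => z; rewrite /awrite; case: eqP => [->|]. Qed.

End Tapes.

Definition upd_at (X : Type) (f : nat -> X) (i : nat) (x : X) : nat -> X :=
  fun j => if j == i then x else f j.

Lemma upd_atE (X : Type) (f : nat -> X) i x : upd_at f i x i = x.
Proof. by rewrite /upd_at eqxx. Qed.

Section Commands.
Variable M : turing_machine.

Local Notation aux := (option (tm_aux M)).
Local Notation sym := (symbol aux).
Local Notation store := (nat -> atape aux).
Local Notation ntapes := (tm_tapes M).+1.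

(** The simulating alphabet has one more symbol, [inr None], foreign to [M]; it marks the origin of
    the registers. *)
Definition embed (s : symbol (tm_aux M)) : sym :=
  omap (fun x => match x with inl b => inl b | inr e => inr (Some e) end) s.

Definition unembed (s : sym) : symbol (tm_aux M) :=
  match s with
  | Some (inl b) => Some (inl b)
  | Some (inr (Some e)) => Some (inr e)
  | _ => None
  end.

Lemma embedK : cancel embed unembed.
Proof. by case=> [[]|]. Qed.

(* Programs acting on one tape at a time, where [Run] executes [M] on the tapes
   1, ..., [ntapes]; tape 0 will be the input-output tape. *)
Inductive cmd :=
| Do (i : nat) (f : sym -> sym * direction)
| Seq (c1 c2 : cmd)
| While (i : nat) (p : pred sym) (c : cmd)
| Run.

Definition act (x : sym * direction) (t : atape aux) := ashift x.2 (awrite x.1 t).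

Definition agree (c : tm_config M) (T : store) :=
  forall j : 'I_ntapes, T j.+1 = embed \o abs_tape (c.2 j).

(** A big-step semantics, restricted to terminating runs. In [exec_run] the configuration is any one
    that agrees with the store, because stores forget trailing blanks; the last premise freezes the
    tapes foreign to [M]. *)
Inductive exec : cmd -> store -> store -> Prop :=
| exec_do i f (T : store) : exec (Do i f) T (upd_at T i (act (f (T i 0%R)) (T i)))
| exec_seq c1 c2 (T1 T2 T3 : store) :
    exec c1 T1 T2 -> exec c2 T2 T3 -> exec (Seq c1 c2) T1 T3
| exec_stop i (p : pred sym) c (T : store) : ~~ p (T i 0%R) -> exec (While i p c) T T
| exec_loop i (p : pred sym) c (T1 T2 T3 : store) : p (T1 i 0%R) -> exec c T1 T2 ->
    exec (While i p c) T2 T3 -> exec (While i p c) T1 T3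
| exec_run (T1 T2 : store) c n : c.1 = tm_start M -> agree c T1 ->
    tm_halting (iter n (@tm_step M) c).1 -> agree (iter n (@tm_step M) c) T2 ->
    (forall i, (i == 0) || (ntapes < i) -> T2 i = T1 i) -> exec Run T1 T2.

Fixpoint cbound (c : cmd) : nat :=
  match c with
  | Do i _ => i
  | Seq c1 c2 => maxn (cbound c1) (cbound c2)
  | While i _ c => maxn i (cbound c)
  | Run => ntapes
  end.

(** A finite control with an exit [None], acting on infinitely many tapes so that fragments compose
    without counting tapes; [fbounded] later cuts down to finitely many. *)
Record frag := Frag {
  fQ : finType;
  fstart : fQ;
  fstep : fQ -> (nat -> sym) -> option fQ * (nat -> sym * direction)
}.

Inductive reach (f : frag) : fQ f -> store -> store -> Prop :=
| reach_exit q T a : fstep q (fun i => T i 0%R) = (None, a) ->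
    reach q T (fun i => act (a i) (T i))
| reach_step q q' T T' a : fstep q (fun i => T i 0%R) = (Some q', a) ->
    reach q' (fun i => act (a i) (T i)) T' -> reach q T T'.

Definition idle (r : nat -> sym) : nat -> sym * direction := fun i => (r i, Stay).

Lemma act_idle (T : store) : (fun i => act (idle (fun i => T i 0%R) i) (T i)) = T.
Proof. by apply: funext => i; rewrite /act /= awrite_id. Qed.

Definition frag_do i (f : sym -> sym * direction) := @Frag unit tt
  (fun _ r => (None, fun k => if k == i then f (r i) else (r k, Stay))).

Definition frag_seq (f1 f2 : frag) := @Frag (fQ f1 + fQ f2)%type (inl (fstart f1))
  (fun q r => match q with
   | inl q => let: (o, a) := fstep q r in
       (Some (if o is Some q' then inl q' else inr (fstart f2)), a)
   | inr q => let: (o, a) := fstep q r in (omap inr o, a)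
   end).

Definition frag_while i (p : pred sym) (f : frag) := @Frag (option (fQ f)) None
  (fun q r => match q with
   | None => (if p (r i) then Some (Some (fstart f)) else None, idle r)
   | Some q => let: (o, a) := fstep q r in (Some o, a)
   end).

Definition frag_run := @Frag (tm_state M) (tm_start M)
  (fun q r => if tm_halting q then (None, idle r) else
    let: (q', a) := tm_trans q [ffun j : 'I_ntapes => unembed (r j.+1)] in
    (Some q', fun i => if (0 < i <= ntapes) then
                         let x := a (inord i.-1) in (embed x.1, x.2)
                       else (r i, Stay))).

Fixpoint frag_of (c : cmd) : frag :=
  match c with
  | Do i f => frag_do i f
  | Seq c1 c2 => frag_seq (frag_of c1) (frag_of c2)
  | While i p c => frag_while i p (frag_of c)
  | Run => frag_run
  end.

Lemma reach_seqr f1 f2 (q : fQ f2) T T' : reach q T T' ->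
  @reach (frag_seq f1 f2) (inr q) T T'.
Proof.
elim=> {q T T'} [q T a h|q q' T T' a h _ IH].
  by apply: (@reach_exit (frag_seq f1 f2)); rewrite /= h.
by apply: (@reach_step (frag_seq f1 f2) _ (inr q') _ _ a) => //; rewrite /= h.
Qed.

Lemma reach_seq f1 f2 (q : fQ f1) T T1 T2 : reach q T T1 ->
  reach (fstart f2) T1 T2 -> @reach (frag_seq f1 f2) (inl q) T T2.
Proof.
move=> h1 h2; elim: h1 h2 => {q T T1} [q T a h|q q' T T' a h _ IH] h2.
  apply: (@reach_step (frag_seq f1 f2) _ (inr (fstart f2)) _ _ a).
    by rewrite /= h.
  exact: reach_seqr.
apply: (@reach_step (frag_seq f1 f2) _ (inl q') _ _ a); first by rewrite /= h.
exact: IH.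
Qed.

Lemma reach_while i p f (q : fQ f) T T1 T2 : reach q T T1 ->
  @reach (frag_while i p f) None T1 T2 -> @reach (frag_while i p f) (Some q) T T2.
Proof.
move=> h1 h2; elim: h1 h2 => {q T T1} [q T a h|q q' T T' a h _ IH] h2.
  by apply: (@reach_step (frag_while i p f) _ None _ _ a); rewrite //= h.
apply: (@reach_step (frag_while i p f) _ (Some q') _ _ a); first by rewrite /= h.
exact: IH.
Qed.

Lemma iter_halted n (c : tm_config M) : tm_halting c.1 -> iter n (@tm_step M) c = c.
Proof. by move=> h; elim: n => //= n ->; rewrite /tm_step h. Qed.

Lemma reach_run n (c : tm_config M) T1 T2 : agree c T1 ->
  tm_halting (iter n (@tm_step M) c).1 -> agree (iter n (@tm_step M) c) T2 ->
  (forall i, (i == 0) || (ntapes < i) -> T2 i = T1 i) ->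
  @reach frag_run c.1 T1 T2.
Proof.
have stop T q : tm_halting q -> @reach frag_run q T T.
  move=> h; rewrite -[X in reach _ _ X]act_idle.
  by apply: (@reach_exit frag_run); rewrite /= h.
have same (c' : tm_config M) T T' : agree c' T -> agree c' T' ->
    (forall i, (i == 0) || (ntapes < i) -> T' i = T i) -> T' = T.
  move=> ag ag' h; apply: funext => -[|i]; first exact: h.
  case: (ltnP i ntapes) => hi; last by apply: h.
  by rewrite (ag (Ordinal hi)) (ag' (Ordinal hi)).
elim: n c T1 => [|n IH] c T1 ag hh ag2 frame.
  by rewrite (same _ _ _ ag ag2 frame); apply: stop.
have [hc|hc] := boolP (tm_halting c.1).
  move: ag2; rewrite iter_halted // => ag2.
  by rewrite (same _ _ _ ag ag2 frame); apply: stop.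
rewrite !iterSr in hh ag2.
have readE : [ffun j : 'I_ntapes => unembed (T1 j.+1 0%R)] =
             [ffun j => tape_read (c.2 j)].
  by apply/ffunP => j; rewrite !ffunE ag -abs_read; apply: embedK.
case tE : (tm_trans c.1 [ffun j => tape_read (c.2 j)]) => [q' a].
have stepE : tm_step c = (q', fun i => tape_move (a i).2 (tape_write (a i).1 (c.2 i))).
  by rewrite /tm_step (negbTE hc) tE.
pose b i := if (0 < i <= ntapes) then let x := a (inord i.-1) in (embed x.1, x.2)
            else (T1 i 0%R, Stay).
apply: (@reach_step frag_run _ q' _ _ b).
  by rewrite /= (negbTE hc) readE tE.
have -> : q' = (tm_step c).1 by rewrite stepE.
apply: IH => //.
  move=> j; have jn : 0 < j.+1 <= ntapes by rewrite ltn_ord.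
  rewrite stepE /b jn [j.+1.-1]/= inord_val [in RHS]/= abs_move abs_write ag.
  apply: funext => z; rewrite /act /=.
  by case: (a j).2 => /=; rewrite /awrite /=; case: eqP.
move=> i hi; rewrite frame // /b.
rewrite (_ : (0 < i <= ntapes) = false); last by lia.
by rewrite /act /= awrite_id.
Qed.

Lemma reach_cmd c T T' : exec c T T' -> reach (fstart (frag_of c)) T T'.
Proof.
elim=> {c T T'} [i f T|c1 c2 T1 T2 T3 _ h1 _ h2|i p c T hp|i p c T1 T2 T3 hp _ h1 _ h2|
  T1 T2 c n c1 ag hh ag2 frame].
- have -> : upd_at T i (act (f (T i 0%R)) (T i)) =
    (fun k => act (if k == i then f (T i 0%R) else (T k 0%R, Stay)) (T k)).
    apply: funext => k; rewrite /upd_at; case: eqP => [->//|_].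
    by rewrite /act /= awrite_id.
  exact: (@reach_exit (frag_do i f)).
- exact: reach_seq h1 h2.
- rewrite -[X in reach _ _ X]act_idle.
  by apply: (@reach_exit (frag_while i p (frag_of c))); rewrite /= (negbTE hp).
- apply: (@reach_step (frag_while i p (frag_of c)) _ (Some (fstart (frag_of c))) _ _
    (idle (fun i => T1 i 0%R))); first by rewrite /= hp.
  by rewrite act_idle; apply: reach_while h1 h2.
- by rewrite /= -c1; apply: reach_run ag hh ag2 frame.
Qed.

Definition fbounded N (f : frag) := forall (q : fQ f) (r r' : nat -> sym),
  (forall i, i <= N -> r i = r' i) ->
  (fstep q r).1 = (fstep q r').1 /\
  forall i, i <= N -> (fstep q r).2 i = (fstep q r').2 i.

Lemma cbound_frag N c : cbound c <= N -> fbounded N (frag_of c).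
Proof.
elim: c => [i f|c1 IH1 c2 IH2|i p c IH|] /=.
- move=> iN q r r' h; split=> //= k kN; case: eqP => _; last by rewrite h.
  by rewrite h.
- rewrite geq_max => /andP[/IH1 h1 /IH2 h2] [q|q] r r' h /=.
    have [] := h1 q r r' h.
    by case: (fstep q r) => o a; case: (fstep q r') => o' a' /= -> h'.
  have [] := h2 q r r' h.
  by case: (fstep q r) => o a; case: (fstep q r') => o' a' /= -> h'.
- rewrite geq_max => /andP[iN /IH h1] [q|] r r' h /=; last first.
    by rewrite h //; split=> // k kN; rewrite /idle h.
  have [] := h1 q r r' h.
  by case: (fstep q r) => o a; case: (fstep q r') => o' a' /= -> h'.
- move=> nN q r r' h /=; case: ifP => _.
    by split=> // i iN /=; rewrite /idle h.
  have -> : [ffun j : 'I_ntapes => unembed (r j.+1)] =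
            [ffun j : 'I_ntapes => unembed (r' j.+1)].
    by apply/ffunP => j; rewrite !ffunE h // (leq_trans _ nN).
  case: (tm_trans _ _) => q' a; split=> // i iN /=.
  by rewrite h.
Qed.

Section Machine.
Variables (f : frag) (N : nat).

(** [inord] sends indices beyond N to tape 0, which a fragment bounded by N cannot notice. *)
Definition machine := @TuringMachine N aux (option (fQ f)) (Some (fstart f))
  (fun q => q == None)
  (fun q (r : {ffun 'I_N.+1 -> sym}) => match q with
   | None => (None, fun i => (r i, Stay))
   | Some q => let: (o, a) := fstep q (fun i => r (inord i)) in
               (o, fun i : 'I_N.+1 => a i)
   end).

Definition magree (c : tm_config machine) (T : store) :=
  forall i : 'I_N.+1, T i = abs_tape (c.2 i).

Lemma machine_reach (q : fQ f) (c : tm_config machine) T T' :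
  fbounded N f -> reach q T T' -> c.1 = Some q -> magree c T ->
  exists n, let c' := iter n (@tm_step machine) c in
    tm_halting c'.1 /\ magree c' T'.
Proof.
move=> fb h; elim: h c => {q T T'} [q T a h|q q' T T' a h _ IH] c cq ag;
  pose r i := tape_read (c.2 (inord i)).
  all: have rE i : i <= N -> T i 0%R = r i by move=> iN; rewrite /r -abs_read -ag inordK.
  all: have := fb q _ _ rE; rewrite h => -[/= e1 e2].
  all: have rE' : (fun i => [ffun i : 'I_N.+1 => tape_read (c.2 i)] (inord i)) = r
    by apply: funext => i; rewrite ffunE.
  exists 1; rewrite /= /tm_step cq /= rE'.
  case: (fstep q r) e1 e2 => o b /= <- e2 /=; split=> // i /=.
  by rewrite abs_move abs_write -ag e2 // -ltnS.
have [] := IH (tm_step c).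
- by rewrite /tm_step cq /= rE'; case: (fstep q r) e1 e2 => o b /= <-.
- rewrite /tm_step cq /= rE'; case: (fstep q r) e1 e2 => o b /= <- e2 i /=.
  by rewrite abs_move abs_write -ag e2 // -ltnS.
- by move=> n hn; exists n.+1; rewrite iterSr.
Qed.

End Machine.

Definition isbit (s : sym) : bool := if s is Some (inl _) then true else false.

Fixpoint reads (u : seq bool) (t : atape aux) : Prop :=
  if u is b :: u' then t 0%R = Some (inl b) /\ reads u' (ashift Right t)
  else ~~ isbit (t 0%R).

Lemma eq_reads u (t t' : atape aux) :
  (forall n : nat, t n = t' n) -> reads u t -> reads u t'.
Proof.
elim: u t t' => [|b u IH] t t' h /=; first by rewrite (h 0).
case=> h0 h1; split; first by rewrite -(h 0).
apply: IH h1 => n /=; have -> : (Posz n + 1)%R = Posz n.+1 by lia.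
exact: h.
Qed.

Lemma reads_leading (u : seq bool) (t : tape aux) :
  reads u (abs_tape t) -> leading_bits t.2 = u.
Proof.
elim: u t => [|b u IH] [l r] /=.
  by case: r => [|[[]|] r].
case=> h0 h1; case: r h0 h1 => [|x r] //= -> h1; congr (_ :: _).
apply: (IH (tape_move Right (l, Some (inl b) :: r))).
by rewrite abs_move.
Qed.

Lemma leading_reads (l r : seq (symbol (tm_aux M))) :
  reads (leading_bits r) (embed \o abs_tape (l, r)).
Proof.
elim: r l => [|x r IH] l //=.
case: x => [[b|e]|] //=; split=> //.
apply: eq_reads (IH l) => n.
have e : (Posz n + 1)%R = Posz n.+1 by lia.
by rewrite -[RHS]/(embed (abs_tape (l, _ :: r) (Posz n + 1)%R)) e.
Qed.

Definition blank : atape aux := fun=> None.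

Definition word_tape (u : seq bool) : atape aux :=
  embed \o abs_tape ([::], [seq Some (inl b) | b <- u]).

Lemma exec_computes (c : cmd) (N : nat) (u v : seq bool) (T T' : store) :
  cbound c <= N -> T 0 = word_tape u ->
  (forall i, 0 < i <= N -> T i = blank) ->
  exec c T T' -> reads v (T' 0) -> tm_computes (machine (frag_of c) N) u v.
Proof.
move=> cN T0 Tb /reach_cmd h rv.
have [||n [hn ag]] := machine_reach (cbound_frag cN) h
   (c := tm_init (machine (frag_of c) N) u) => //.
  move=> i /=; case: eqP => [->|/eqP i0].
    rewrite T0; apply: funext => -[k|k] /=; last by rewrite /word_tape /= !nth_nil.
    rewrite /word_tape /=.
    by elim: u k {T0} => [|b u IH] [|k] //=.
  rewrite Tb; last by rewrite lt0n -ltnS ltn_ord andbT.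
  by apply: funext => -[k|k]; rewrite /= nth_nil.
exists n; split=> //; rewrite /tm_output; apply: reads_leading.
by rewrite -ag.
Qed.

End Commands.

(** * Registers and first-order terms *)

Definition scons (x : nat) (s : nat -> nat) : nat -> nat :=
  fun i => if i is j.+1 then s j else x.

Fixpoint iter_down (n : nat) (f : nat -> nat -> nat) (a : nat) : nat :=
  if n is m.+1 then iter_down m f (f m a) else a.

(* First-order terms with de Bruijn variables.  [Iter n a f] updates an
   accumulator, initially [a], for the values m = n-1, ..., 0 of a counter; in
   [f], variable 0 is the accumulator and variable 1 the counter. *)
Inductive expr :=
| Var (i : nat)
| Zero
| Suc (e : expr)
| Iter (n a f : expr).

(** [a] is evaluated with the bound as variable 0, since the compiled code already holds the bound
    in register d. Counting down lets that register serve as the counter. *)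
Fixpoint eval (e : expr) (s : nat -> nat) : nat :=
  match e with
  | Var i => s i
  | Zero => 0
  | Suc e => (eval e s).+1
  | Iter n a f =>
      let k := eval n s in
      iter_down k (fun m x => eval f (scons x (scons m s)))
                (eval a (scons k s))
  end.

Section Registers.
Variable M : turing_machine.

Local Notation aux := (option (tm_aux M)).
Local Notation sym := (symbol aux).
Local Notation store := (nat -> atape aux).
Local Notation base := (tm_tapes M).+2.
Local Notation cmd := (cmd M).

Definition mark : sym := Some (inr None).

(* A register holds n when the head is n cells to the right of the only mark. *)
Definition reg (n : nat) : atape aux :=
  fun z => if z == (- Posz n)%R then mark else None.

(** The first [base] tapes are the input-output tape and the tapes of [M]; the registers follow. *)
Definition mkstore (w : store) (v : nat -> nat) : store :=
  fun i => if i < base then w i else reg (v (i - base)).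

Definition rex (c : cmd) (v v' : nat -> nat) :=
  forall w, exec c (mkstore w v) (mkstore w v').

Definition inc r : cmd := @Do M (base + r) (fun s => (s, Right)).
Definition dec r : cmd := @Do M (base + r) (fun s => (s, Left)).
Definition loopnz r c : cmd := @While M (base + r) (fun s => s != mark) c.

Lemma mkstore_reg w v r : mkstore w v (base + r) = reg (v r).
Proof. by rewrite /mkstore ltnNge leq_addr /= addKn. Qed.

Lemma reg_mark n : (reg n 0%R == mark) = (n == 0).
Proof. by rewrite /reg; case: n => [|n]; rewrite ?eqxx. Qed.

Lemma mkstore_upd w v r n :
  upd_at (mkstore w v) (base + r) (reg n) = mkstore w (upd_at v r n).
Proof.
apply: funext => i; rewrite /upd_at /mkstore.
case: (ltnP i base) => h; first by rewrite ltn_eqF // (leq_trans h) ?leq_addr.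
by rewrite -{1}(subnKC h) eqn_add2l; case: eqP.
Qed.

Lemma rex_inc r v : rex (inc r) v (upd_at v r (v r).+1).
Proof.
move=> w; rewrite -mkstore_upd.
have -> : reg (v r).+1 = act (mkstore w v (base + r) 0%R, Right) (mkstore w v (base + r)).
  rewrite /act /= awrite_id mkstore_reg; apply: funext => z; rewrite /reg.
  by congr (if _ then _ else _); lia.
exact: exec_do.
Qed.

Lemma rex_dec r v n : v r = n.+1 -> rex (dec r) v (upd_at v r n).
Proof.
move=> vr w; rewrite -mkstore_upd.
have -> : reg n = act (mkstore w v (base + r) 0%R, Left) (mkstore w v (base + r)).
  rewrite /act /= awrite_id mkstore_reg vr; apply: funext => z; rewrite /reg.
  by congr (if _ then _ else _); lia.
exact: exec_do.
Qed.

Lemma rex_seq c1 c2 v1 v2 v3 : rex c1 v1 v2 -> rex c2 v2 v3 -> rex (Seq c1 c2) v1 v3.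
Proof. by move=> h1 h2 w; apply: exec_seq (h1 w) (h2 w). Qed.

Lemma rex_stop r c v : v r = 0 -> rex (loopnz r c) v v.
Proof. by move=> vr w; apply: exec_stop; rewrite mkstore_reg reg_mark vr. Qed.

Lemma rex_loop r c v1 v2 v3 : v1 r != 0 -> rex c v1 v2 ->
  rex (loopnz r c) v2 v3 -> rex (loopnz r c) v1 v3.
Proof.
by move=> vr h1 h2 w; apply: exec_loop (h1 w) (h2 w); rewrite mkstore_reg reg_mark.
Qed.

Lemma rex_eq c v v1 v2 : v1 = v2 -> rex c v v1 -> rex c v v2.
Proof. by move->. Qed.

Ltac upd_eq := let i := fresh "i" in try (apply: funext => i); rewrite /upd_at;
  repeat case: eqP => ?; subst; try lia; try congruence.

Definition clear d := loopnz d (dec d).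

Lemma rex_clear d v : rex (clear d) v (upd_at v d 0).
Proof.
move: {2}(v d) (erefl (v d)) => n; elim: n v => [|n IH] v vd.
  apply: (rex_eq _ (rex_stop _ vd)); upd_eq.
apply: (rex_loop _ (rex_dec vd)); first by rewrite vd.
by apply: (rex_eq _ (IH _ _)); rewrite ?upd_atE //; upd_eq.
Qed.

Definition addto a d := loopnz d (Seq (dec d) (inc a)).

Lemma rex_addto a d v : a <> d ->
  rex (addto a d) v (upd_at (upd_at v a (v a + v d)) d 0).
Proof.
move=> ad; move: {2}(v d) (erefl (v d)) => n; elim: n v => [|n IH] v vd.
  apply: (rex_eq _ (rex_stop _ vd)); upd_eq.
apply: (rex_loop _ (rex_seq (rex_dec vd) (rex_inc _ _))); first by rewrite vd.
apply: (rex_eq _ (IH _ _)); upd_eq.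
Qed.

Definition move_to t s := Seq (clear t) (addto t s).

Lemma rex_move t s v : t <> s ->
  rex (move_to t s) v (upd_at (upd_at v t (v s)) s 0).
Proof.
move=> ts; apply: rex_eq (rex_seq (rex_clear _ _) (rex_addto _ ts)); upd_eq.
Qed.

(** Emptying [a] is the only way to read it; the second copy in [d.+1] restores it. *)
Definition copy_to d a :=
  Seq (loopnz a (Seq (dec a) (Seq (inc d) (inc d.+1)))) (addto a d.+1).

Lemma rex_copy d a v : a < d -> v d = 0 -> v d.+1 = 0 ->
  rex (copy_to d a) v (upd_at v d (v a)).
Proof.
move=> ad vd vd1.
have h : rex (loopnz a (Seq (dec a) (Seq (inc d) (inc d.+1)))) v
  (upd_at (upd_at (upd_at v d (v d + v a)) d.+1 (v d.+1 + v a)) a 0).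
  clear vd vd1; move: {2}(v a) (erefl (v a)) => n; elim: n v => [|n IH] v va.
    apply: (rex_eq _ (rex_stop _ va)); upd_eq.
  apply: (rex_loop _ (rex_seq (rex_dec va) (rex_seq (rex_inc _ _) (rex_inc _ _)))).
    by rewrite va.
  apply: (rex_eq _ (IH _ _)); upd_eq.
apply: (rex_eq _ (rex_seq h (rex_addto _ _))); last by lia.
upd_eq.
Qed.

(* The environment of depth d is stored in registers d-1, ..., 0; the value of
   [e] is put in register d and the registers above it are scratch space. *)
Fixpoint compile (e : expr) (d : nat) : cmd :=
  match e with
  | Var i => if i < d then copy_to d (d.-1 - i) else clear d
  | Zero => clear d
  | Suc e => Seq (compile e d) (inc d)
  | Iter n a f =>
      Seq (compile n d) (Seq (compile a d.+1)
        (Seq (loopnz d (Seq (dec d)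
                (Seq (compile f d.+2) (move_to d.+1 d.+2))))
             (move_to d d.+1)))
  end.

Definition env d (v : nat -> nat) : nat -> nat :=
  fun i => if i < d then v (d.-1 - i) else 0.

Lemma env_upd d v x : env d.+1 (upd_at v d x) = scons x (env d v).
Proof.
apply: funext => -[|i]; rewrite /env /= /upd_at; first by rewrite subn0 eqxx.
rewrite ltnS; case: ltnP => // h; case: eqP => [|_]; first lia.
by congr v; lia.
Qed.

Lemma rex_compile e d v : (forall j, d <= j -> v j = 0) ->
  rex (compile e d) v (upd_at v d (eval e (env d v))).
Proof.
elim: e d v => [i||e IH|n IHn a IHa f IHf] d v v0 /=.
- rewrite /env; case: ltnP => h; last exact: rex_clear.
  by apply: rex_copy; rewrite ?v0 //; lia.
- exact: rex_clear.
- apply: (rex_eq _ (rex_seq (IH _ _ v0) (rex_inc _ _))); upd_eq.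
set k := eval n _; set x := eval a _.
have v1 y j : d.+1 <= j -> upd_at v d y j = 0.
  by move=> h; rewrite /upd_at; case: eqP => [|_]; [lia | apply: v0; lia].
have v2 y z j : d.+2 <= j -> upd_at (upd_at v d y) d.+1 z j = 0.
  by move=> h; rewrite /upd_at; case: eqP => [|_]; [lia | apply: v1; lia].
pose F m x := eval f (scons x (scons m (env d v))).
(* Register d is the counter and d + 1 the accumulator. The counter is decremented before the body,
   which therefore sees m - 1, ..., 0. *)
have loop m y : rex (loopnz d (Seq (dec d) (Seq (compile f d.+2) (move_to d.+1 d.+2))))
   (upd_at (upd_at v d m) d.+1 y) (upd_at (upd_at v d 0) d.+1 (iter_down m F y)).
  elim: m y => [|m IH] y /=.
    by apply: rex_stop; rewrite /upd_at eqxx ltn_eqF.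
  have vd : upd_at (upd_at v d m.+1) d.+1 y d = m.+1 by rewrite /upd_at eqxx ltn_eqF.
  apply: (rex_loop _ _ (IH _)); first by rewrite vd.
  apply: (rex_seq (rex_dec vd)).
  have -> : upd_at (upd_at (upd_at v d m.+1) d.+1 y) d m = upd_at (upd_at v d m) d.+1 y.
    upd_eq.
  apply: (rex_eq _ (rex_seq (IHf _ _ (v2 _ _)) (rex_move _ _))); last lia.
  by rewrite env_upd env_upd -/(F m y); upd_eq; rewrite v0 //; lia.
apply: (rex_eq _ (rex_seq (IHn _ _ v0) (rex_seq (IHa _ _ (v1 _))
   (rex_seq (rex_eq _ (loop _ _)) (rex_move _ _))))) => //.
by rewrite -/k env_upd -/x; upd_eq; rewrite ?v0.
Qed.

End Registers.

Fixpoint rename (xi : nat -> nat) (e : expr) : expr :=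
  let up xi := fun i => if i is j.+1 then (xi j).+1 else 0 in
  match e with
  | Var i => Var (xi i)
  | Zero => Zero
  | Suc e => Suc (rename xi e)
  | Iter n a f => Iter (rename xi n) (rename (up xi) a) (rename (up (up xi)) f)
  end.

Lemma eval_rename e xi s : eval (rename xi e) s = eval e (s \o xi).
Proof.
have up xi' s' x : scons x s' \o (fun i => if i is j.+1 then (xi' j).+1 else 0) =
    scons x (s' \o xi') by apply: funext => -[].
elim: e xi s => [i||e IH|n IHn a IHa f IHf] xi s //=.
- by rewrite IH.
rewrite IHn IHa up; congr iter_down; apply: funext => m; apply: funext => x.
by rewrite IHf !up.
Qed.

(** * Computable functions *)

(** Total functions obtained by bounded iteration. Taking a whole environment as argument turns
    binders into shifts of the variables. *)
Definition cpt (f : (nat -> nat) -> nat) := exists e, forall s, eval e s = f s.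
Definition cptb (b : (nat -> nat) -> bool) := cpt (fun s => b s).

Lemma cpt_ext f g : (forall s, f s = g s) -> cpt f -> cpt g.
Proof. by move=> fg [e h]; exists e => s; rewrite h. Qed.

Lemma cpt_var i : cpt (fun s => s i).
Proof. by exists (Var i). Qed.

Lemma cpt_S f : cpt f -> cpt (fun s => (f s).+1).
Proof. by case=> e h; exists (Suc e) => s /=; rewrite h. Qed.

Lemma cpt_const n : cpt (fun _ => n).
Proof. by elim: n => [|n IH]; [exists Zero | apply: cpt_S]. Qed.

Lemma cpt_shift f : cpt f -> cpt (fun s => f (fun i => s i.+1)).
Proof. by case=> e h; exists (rename succn e) => s; rewrite eval_rename h. Qed.

Lemma cpt_iter_down (n a : (nat -> nat) -> nat) (F : nat -> nat -> (nat -> nat) -> nat) :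
  cpt n -> cpt a -> cpt (fun s => F (s 1) (s 0) (fun i => s i.+2)) ->
  cpt (fun s => iter_down (n s) (fun m x => F m x s) (a s)).
Proof.
move=> [en hn] /cpt_shift[ea ha] [ef hf]; exists (Iter en ea ef) => s /=.
rewrite hn ha; congr iter_down.
by apply: funext => m; apply: funext => x; rewrite hf.
Qed.

(** Overwriting [x] by [y] exactly r times leaves [x] only if r = 0. *)
Lemma cpt_ifz r x y : cpt r -> cpt x -> cpt y ->
  cpt (fun s => if r s == 0 then x s else y s).
Proof.
move=> cr cx cy.
apply: cpt_ext (cpt_iter_down (F := fun _ _ s => y s) cr cx _) => [s|]; last first.
  exact: cpt_shift (cpt_shift cy).
have const n b : iter_down n (fun _ _ => y s) b = if n == 0 then b else y s.
  by elim: n b => //= n IH b; rewrite IH if_same.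
exact: const.
Qed.

Lemma cpt_if b x y : cptb b -> cpt x -> cpt y ->
  cpt (fun s => if b s then x s else y s).
Proof.
move=> cb cx cy; apply: cpt_ext (cpt_ifz cb cy cx) => s.
by case: (b s).
Qed.

Lemma cptb_eq0 f : cpt f -> cptb (fun s => f s == 0).
Proof.
move=> cf; apply: cpt_ext (cpt_ifz cf (cpt_const 1) (cpt_const 0)) => s.
by case: eqP.
Qed.

Lemma cptb_neg b : cptb b -> cptb (fun s => ~~ b s).
Proof.
by move=> cb; apply: cpt_ext (cptb_eq0 cb) => s; case: (b s).
Qed.

Lemma cptb_and b c : cptb b -> cptb c -> cptb (fun s => b s && c s).
Proof.
move=> cb cc; apply: cpt_ext (cpt_if cb cc (cpt_const 0)) => s.
by case: (b s).
Qed.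

Lemma iter_downS n a : iter_down n (fun _ x => x.+1) a = n + a.
Proof. by elim: n a => //= n IH a; rewrite IH addnS. Qed.

Lemma cpt_add a b : cpt a -> cpt b -> cpt (fun s => a s + b s).
Proof.
move=> ca cb.
apply: cpt_ext (cpt_iter_down (F := fun _ x _ => x.+1) ca cb (cpt_S (cpt_var 0))).
by move=> s; rewrite iter_downS.
Qed.

Lemma cpt_pred a : cpt a -> cpt (fun s => (a s).-1).
Proof.
move=> ca; apply: cpt_ext (cpt_iter_down
  (F := fun m x _ => if m == 0 then x else x.+1) ca (cpt_const 0)
  (cpt_ifz (cpt_var 1) (cpt_var 0) (cpt_S (cpt_var 0)))) => s.
have h n x : iter_down n (fun m x => if m == 0 then x else x.+1) x = n.-1 + x.
  by elim: n x => //= -[|n] IH x; rewrite // IH /=; lia.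
by rewrite h addn0.
Qed.

Lemma cpt_sub a b : cpt a -> cpt b -> cpt (fun s => a s - b s).
Proof.
move=> ca cb; apply: cpt_ext (cpt_iter_down (F := fun _ x _ => x.-1) cb ca
  (cpt_pred (cpt_var 0))) => s.
have h n x : iter_down n (fun _ x => x.-1) x = x - n.
  by elim: n x => [|n IH] x /=; rewrite ?IH; lia.
exact: h.
Qed.

Definition sumf (n : nat) (f : nat -> nat) : nat := \sum_(i < n) f i.

Lemma cpt_sum n (F : nat -> (nat -> nat) -> nat) :
  cpt n -> cpt (fun s => F (s 0) (fun i => s i.+1)) ->
  cpt (fun s => sumf (n s) (fun i => F i s)).
Proof.
move=> cn cF; apply: cpt_ext (cpt_iter_down (F := fun m x s => F m s + x) cn
  (cpt_const 0) _) => [s|].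
  have h k x : iter_down k (fun m x => F m s + x) x = sumf k (fun i => F i s) + x.
    elim: k x => [|k IH] x /=; first by rewrite /sumf big_ord0.
    by rewrite IH /sumf big_ord_recr /= addnA.
  by rewrite h addn0.
apply: cpt_add (cpt_var 0).
exact: (@cpt_shift (fun s => F (s 0) (fun i => s i.+1))).
Qed.

Lemma cpt_mul a b : cpt a -> cpt b -> cpt (fun s => a s * b s).
Proof.
move=> ca cb; apply: cpt_ext (cpt_sum (F := fun _ s => b s) ca (cpt_shift cb)) => s.
by rewrite /sumf sum_nat_const card_ord.
Qed.

Lemma cpt_exp a b : cpt a -> cpt b -> cpt (fun s => a s ^ b s).
Proof.
move=> ca cb; apply: cpt_ext (cpt_iter_down (F := fun _ x s => x * a s) cb
  (cpt_const 1) (cpt_mul (cpt_var 0) (cpt_shift (cpt_shift ca)))) => s.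
have h n x : iter_down n (fun _ x => x * a s) x = x * a s ^ n.
  by elim: n x => [|n IH] x /=; rewrite ?muln1 // IH expnS mulnA.
by rewrite h mul1n.
Qed.

Lemma cptb_leq a b : cpt a -> cpt b -> cptb (fun s => a s <= b s).
Proof. by move=> ca cb; apply: cptb_eq0; apply: cpt_sub. Qed.

Lemma cpt_iter n a (F : nat -> (nat -> nat) -> nat) :
  cpt n -> cpt a -> cpt (fun s => F (s 0) (fun i => s i.+1)) ->
  cpt (fun s => iter (n s) (fun x => F x s) (a s)).
Proof.
move=> cn ca cF; apply: cpt_ext (cpt_iter_down (F := fun _ x s => F x s) cn ca _).
  move=> s; have h k x : iter_down k (fun _ x => F x s) x = iter k (fun x => F x s) x.
    by elim: k x => [//|k IH] x /=; rewrite IH -iterSr.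
  exact: h.
(* The renaming skips the counter, which is variable 1. *)
case: cF => e h; pose xi i := if i is j.+1 then j.+2 else 0.
by exists (rename xi e) => s; rewrite eval_rename h.
Qed.

(** The quotient counts the positive multiples of b up to a. *)
Lemma cpt_div a b : cpt a -> cpt b -> cpt (fun s => a s %/ b s).
Proof.
move=> ca cb; apply: (@cpt_ext (fun s => if b s == 0 then 0 else
    sumf (a s) (fun i => b s * i.+1 <= a s))) => [s|].
  case: eqP => [->|/eqP b0]; first by rewrite divn0.
  have h k : sumf k (fun i => b s * i.+1 <= a s) = minn k (a s %/ b s).
    elim: k => [|k IH]; first by rewrite /sumf big_ord0 min0n.
    rewrite /sumf big_ord_recr /= -/(sumf k (fun i => b s * i.+1 <= a s)) IH.
    by rewrite mulnC -leq_divRL ?lt0n //; case: leqP => /=; lia.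
  by rewrite h; apply/minn_idPr; apply: leq_div.
apply: cpt_ifz => //; first exact: cpt_const.
apply: (cpt_sum (F := fun i s => b s * i.+1 <= a s)) => //.
apply: cptb_leq (cpt_shift ca); apply: cpt_mul (cpt_shift cb) _.
exact: cpt_S (cpt_var 0).
Qed.

Lemma cpt_mod a b : cpt a -> cpt b -> cpt (fun s => a s %% b s).
Proof.
move=> ca cb; apply: (@cpt_ext (fun s => a s - a s %/ b s * b s)) => [s|].
  by rewrite {1}(divn_eq (a s) (b s)) addKn.
by apply: cpt_sub => //; apply: cpt_mul => //; apply: cpt_div.
Qed.

Definition allf (n : nat) (p : nat -> bool) : bool := all p (iota 0 n).

Lemma allfP n (p : nat -> bool) : reflect (forall i, i < n -> p i) (allf n p).
Proof.
apply: (iffP allP) => h i; last by rewrite mem_iota add0n => /h.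
by move=> hi; apply: h; rewrite mem_iota.
Qed.

Lemma cptb_all n (p : nat -> (nat -> nat) -> bool) :
  cpt n -> cptb (fun s => p (s 0) (fun i => s i.+1)) ->
  cptb (fun s => allf (n s) (fun i => p i s)).
Proof.
move=> cn cp.
apply: cpt_ext (cptb_eq0 (cpt_sum (F := fun i s => ~~ p i s) cn (cptb_neg cp))) => s.
congr nat_of_bool; rewrite /sumf sum_nat_eq0.
apply/idP/allfP => [/forallP h i hi|h].
  by have := h (Ordinal hi) => /=; case: (p i s).
by apply/forallP => i /=; rewrite h.
Qed.

Lemma cpt_log2 a : cpt a -> cpt (fun s => logn 2 (a s)).
Proof.
move=> ca; apply: (@cpt_ext (fun s => sumf (a s) (fun k =>
   (0 < k) && (a s %% 2 ^ k == 0)))) => [s|].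
  case: (posnP (a s)) => [->|a0]; first by rewrite /sumf big_ord0 logn0.
  rewrite logn_count_dvd // /sumf -(big_mkord xpredT (fun k =>
    nat_of_bool ((0 < k) && (a s %% 2 ^ k == 0)))).
  rewrite big_ltn //= add0n; apply: eq_big_nat => k /andP[k0 _].
  by rewrite k0.
apply: (cpt_sum (F := fun k s => (0 < k) && (a s %% 2 ^ k == 0))) => //.
apply: cptb_and; first exact: cptb_leq (cpt_const 1) (cpt_var 0).
apply: cptb_eq0; apply: cpt_mod (cpt_shift ca) _.
exact: cpt_exp (cpt_const 2) (cpt_var 0).
Qed.

(** * Lists of numbers coded by a single number *)

(* The last element is on top, so that a list is decoded from its end. *)
Definition snoc (c x : nat) : nat := 2 ^ c * x.*2.+1.
Definition pop (c : nat) : nat := logn 2 c.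
Definition top (c : nat) : nat := (c %/ 2 ^ logn 2 c)./2.
Definition code (L : seq nat) : nat := foldl snoc 0 L.

Lemma pop_snoc c x : pop (snoc c x) = c.
Proof.
rewrite /pop /snoc lognM ?expn_gt0 // pfactorK // lognE /=.
by rewrite dvdn2 /= odd_double /= addn0.
Qed.

Lemma top_snoc c x : top (snoc c x) = x.
Proof.
rewrite /top -/(pop _) pop_snoc /snoc mulKn ?expn_gt0 //.
by rewrite -addn1 -[_ + 1]addnC (half_bit_double x true).
Qed.

Lemma snoc_neq0 c x : snoc c x != 0.
Proof. by rewrite -lt0n muln_gt0 expn_gt0. Qed.

Lemma code_rcons L x : code (rcons L x) = snoc (code L) x.
Proof. exact: foldl_rcons. Qed.

Lemma cpt_snoc a b : cpt a -> cpt b -> cpt (fun s => snoc (a s) (b s)).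
Proof.
move=> ca cb; apply: cpt_mul; first exact: cpt_exp (cpt_const 2) ca.
apply: cpt_S; apply: cpt_ext (cpt_add cb cb) => s.
by rewrite addnn.
Qed.

Lemma cpt_pop a : cpt a -> cpt (fun s => pop (a s)).
Proof. exact: cpt_log2. Qed.

Lemma cpt_top a : cpt a -> cpt (fun s => top (a s)).
Proof.
move=> ca; apply: (@cpt_ext (fun s => a s %/ 2 ^ logn 2 (a s) %/ 2)) => [s|].
  by rewrite divn2.
exact: cpt_div (cpt_div ca (cpt_exp (cpt_const 2) (cpt_log2 ca))) (cpt_const 2).
Qed.

(** The number of pops before the empty list, whose code is 0. The code itself bounds the search, by
    [size_code]. *)
Definition clen (c : nat) : nat := sumf c (fun k => iter k pop c != 0).
Definition get (c i : nat) : nat := top (iter (clen c - i.+1) pop c).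

Lemma iter_pop_code L k : iter k pop (code L) = code (take (size L - k) L).
Proof.
elim: k L => [|k IH] L; first by rewrite subn0 take_size.
case/lastP: L => [|L x].
  by rewrite iterSr (_ : pop (code [::]) = code [::]) // IH.
rewrite iterSr code_rcons pop_snoc IH size_rcons subSS -cats1 take_cat.
case: ltnP => // h; have -> : size L - k = size L by lia.
by rewrite subnn take0 cats0 take_size.
Qed.

Lemma code_neq0 L : (code L != 0) = (L != [::]).
Proof.
case/lastP: L => // L x; rewrite code_rcons snoc_neq0.
by apply/esym/eqP; case: L.
Qed.

Lemma size_code L : size L <= code L.
Proof.
elim/last_ind: L => // L x IH; rewrite code_rcons size_rcons /snoc.
apply: (@leq_trans (2 ^ code L)); last by rewrite leq_pmulr.
by apply: leq_ltn_trans IH _; apply: ltn_expl.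
Qed.

Lemma clen_code L : clen (code L) = size L.
Proof.
rewrite /clen /sumf; have -> : \sum_(i < code L) (iter i pop (code L) != 0) =
    \sum_(i < code L) (i < size L).
  apply: eq_bigr => i _; congr nat_of_bool.
  rewrite iter_pop_code code_neq0 -size_eq0 size_takel ?leq_subr //.
  by rewrite subn_eq0 -ltnNge.
have h k : \sum_(i < k) (i < size L) = minn k (size L).
  elim: k => [|k IH]; first by rewrite big_ord0 min0n.
  by rewrite big_ord_recr /= IH; case: ltnP => /=; lia.
by rewrite h; apply/minn_idPr; apply: size_code.
Qed.

Lemma get_code L i : i < size L -> get (code L) i = nth 0 L i.
Proof.
move=> hi; rewrite /get clen_code iter_pop_code.
have -> : size L - (size L - i.+1) = i.+1 by lia.
by rewrite (take_nth 0) // code_rcons top_snoc.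
Qed.

Lemma cpt_get a b : cpt a -> cpt b -> cpt (fun s => get (a s) (b s)).
Proof.
move=> ca cb; apply: cpt_top.
apply: (cpt_iter (F := fun x _ => pop x) _ ca (cpt_pop (cpt_var 0))).
apply: cpt_sub; last exact: cpt_S.
apply: (cpt_sum (F := fun k s => iter k pop (a s) != 0)) => //.
apply: cptb_neg; apply: cptb_eq0.
exact: (cpt_iter (F := fun x _ => pop x) (cpt_var 0) (cpt_shift ca)
  (cpt_pop (cpt_var 0))).
Qed.

(** * Search around a call to a given machine *)

Lemma cpt_rename f (xi : nat -> nat) : cpt f -> cpt (fun s => f (s \o xi)).
Proof. by case=> e h; exists (rename xi e) => s; rewrite eval_rename h. Qed.

Section Program.
Variable M : turing_machine.

Local Notation aux := (option (tm_aux M)).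
Local Notation sym := (symbol aux).
Local Notation store := (nat -> atape aux).
Local Notation ntapes := (tm_tapes M).+1.
Local Notation base := (tm_tapes M).+2.
Implicit Types (w : store) (v : nat -> nat).

(* Registers 0, ..., 4 hold the program variables. *)
Definition scratch0 v := forall j, 5 <= j -> v j = 0.

Lemma scratch0_upd v r n : r < 5 -> scratch0 v -> scratch0 (upd_at v r n).
Proof.
by move=> r5 v0 j hj; rewrite /upd_at; case: eqP => [|_]; [lia | apply: v0].
Qed.

Lemma assign_ex f r : cpt f -> r < 5 -> exists c : cmd M, forall v,
  scratch0 v -> rex c v (upd_at v r (f (env 5 v))).
Proof.
case=> e h r5; exists (Seq (compile M e 5) (move_to M r 5)) => v v0.
apply: (rex_eq _ (rex_seq (rex_compile e v0) (rex_move _ _))); last by lia.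
apply: funext => i; rewrite /upd_at h.
case: (eqVneq i 5) => [->|n5]; last by case: eqP.
by rewrite (gtn_eqF r5) v0.
Qed.

Lemma mkstore_io w v i t : i < base ->
  upd_at (mkstore w v) i t = mkstore (upd_at w i t) v.
Proof.
move=> hi; apply: funext => j; rewrite /upd_at /mkstore.
by case: eqP => [->|//]; rewrite hi.
Qed.

Lemma upd_at_id (X : Type) (f : nat -> X) i x : f i = x -> upd_at f i x = f.
Proof. by move=> <-; apply: funext => j; rewrite /upd_at; case: eqP => // ->. Qed.

Lemma upd_upd (X : Type) (f : nat -> X) i x y :
  upd_at (upd_at f i x) i y = upd_at f i y.
Proof. by apply: funext => j; rewrite /upd_at; case: eqP. Qed.

Lemma exec_io i f w v : i < base ->
  exec (@Do M i f) (mkstore w v) (mkstore (upd_at w i (act (f (w i 0%R)) (w i))) v).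
Proof.
move=> hi; rewrite -mkstore_io //.
have -> : w i = mkstore w v i by rewrite /mkstore hi.
exact: exec_do.
Qed.

Lemma env_var v r : r < 5 -> env 5 v (4 - r) = v r.
Proof.
move=> r5; rewrite /env (_ : 4 - r < 5); last by lia.
by congr v; lia.
Qed.

Definition right i : cmd M := @Do M i (fun s => (s, Right)).

Lemma exec_right i w v : i < base ->
  exec (right i) (mkstore w v) (mkstore (upd_at w i (ashift Right (w i))) v).
Proof.
by move=> hi; have := exec_io (fun s => (s, Right)) w v hi; rewrite /act /= awrite_id.
Qed.

Definition istrue (s : sym) : bool := if s is Some (inl true) then true else false.

Lemma word_cons n L : word_of_nats (n :: L) = nseq n true ++ false :: word_of_nats L.
Proof. by rewrite /word_of_nats /= -cats1 -catA. Qed.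

Lemma word_rcons L n : word_of_nats (rcons L n) = word_of_nats L ++ rcons (nseq n true) false.
Proof. by rewrite /word_of_nats map_rcons flatten_rcons. Qed.

Lemma exec_unary i n u w v : i < base -> reads (nseq n true ++ false :: u) (w i) ->
  exists t, reads (false :: u) t /\
    exec (@While M i istrue (Seq (inc M 1) (right i))) (mkstore w v)
         (mkstore (upd_at w i t) (upd_at v 1 (v 1 + n))).
Proof.
move=> hi; elim: n w v => [|n IH] w v /= hr.
  exists (w i); split=> //; rewrite addn0.
  rewrite !upd_at_id //.
  by apply: exec_stop; rewrite /mkstore hi; case: hr => ->.
case: hr => h0 h1.
have [|t [ht he]] := IH (upd_at w i (ashift Right (w i))) (upd_at v 1 (v 1).+1).
  by rewrite upd_atE.
exists t; split=> //.
apply: exec_loop; first by rewrite /mkstore hi h0.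
  exact: exec_seq (rex_inc 1 v w) (exec_right _ _ hi).
by move: he; rewrite !upd_upd upd_atE addSnnS.
Qed.

(** Register 1 counts each unary block before it is appended to the code. Of the final tape only a
    non-bit under the head is recorded: a word pushed to its left is then read back exactly. *)
Lemma read_ex i r : i < base -> r < 5 -> r != 1 -> exists c : cmd M,
  forall L w v, scratch0 v -> v 1 = 0 -> reads (word_of_nats L) (w i) ->
  exists t, ~~ isbit (t 0%R) /\
    exec c (mkstore w v) (mkstore (upd_at w i t) (upd_at v r (foldl snoc (v r) L))).
Proof.
move=> hi r5 r1.
have [c hc] := assign_ex (cpt_snoc (cpt_var (4 - r)) (cpt_var 3)) r5.
exists (@While M i (@isbit M) (Seq (@While M i istrue (Seq (inc M 1) (right i)))
          (Seq c (Seq (clear M 1) (right i))))).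
elim=> [|n L IH] w v v0 v1.
  move=> /= hr; exists (w i); split=> //.
  rewrite !upd_at_id //.
  by apply: exec_stop; rewrite /mkstore hi.
rewrite word_cons => hr; have [t [[t0 t1] he]] := exec_unary v hi hr.
set v2 := upd_at v 1 _ in he.
have v20 : scratch0 v2 by apply: scratch0_upd.
have v21 : v2 1 = n by rewrite /v2 upd_atE v1.
have v2r : v2 r = v r by rewrite /v2 /upd_at (negbTE r1).
have [t' [ht' he']] := IH (upd_at w i (ashift Right t)) (upd_at v r (snoc (v r) n))
   (scratch0_upd _ r5 v0) ltac:(by rewrite /upd_at eq_sym (negbTE r1)) ltac:(by rewrite upd_atE).
exists t'; split=> //; apply: exec_loop; last first.
- by move: he'; rewrite !upd_upd upd_atE; apply.
- apply: exec_seq he _; apply: exec_seq (hc _ v20 _) _.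
  apply: exec_seq (rex_clear 1 _ _) _.
  have -> : upd_at w i (ashift Right t) =
      upd_at (upd_at w i t) i (ashift Right (upd_at w i t i)).
    by rewrite upd_upd upd_atE.
  have -> : upd_at v r (snoc (v r) n) =
     upd_at (upd_at v2 r (snoc (env 5 v2 (4 - r)) (env 5 v2 3))) 1 0.
    rewrite env_var // v2r (_ : env 5 v2 3 = n) //.
    apply: funext => j; rewrite /v2 /upd_at.
    case: (eqVneq j r) => [->|_]; first by rewrite (negbTE r1).
    by case: eqP => [->|//].
  exact: exec_right.
rewrite /mkstore hi; move: hr; case: {+}n => [|k] /=; first by case=> ->.
by case=> ->.
Qed.

Definition apush b (t : atape aux) : atape aux := awrite (Some (inl b)) (ashift Left t).

Definition push_bit i b : cmd M :=
  Seq (@Do M i (fun s => (s, Left))) (@Do M i (fun _ => (Some (inl b), Stay))).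

Lemma exec_push i b w v : i < base ->
  exec (push_bit i b) (mkstore w v) (mkstore (upd_at w i (apush b (w i))) v).
Proof.
move=> hi; apply: exec_seq (exec_io _ _ _ hi) _.
have := exec_io (fun _ => (Some (inl b), Stay))
  (upd_at w i (act (w i 0%R, Left) (w i))) v hi.
by rewrite upd_upd upd_atE /act /= awrite_id.
Qed.

(** Numbers are popped from the end of the list, so the word is written from right to left. *)
Lemma write_ex i r : i < base -> r < 5 -> r != 1 -> exists c : cmd M,
  forall L w v, scratch0 v -> v 1 = 0 -> v r = code L ->
  exec c (mkstore w v)
    (mkstore (upd_at w i (foldr apush (w i) (word_of_nats L))) (upd_at v r 0)).
Proof.
move=> hi r5 r1.
have [c1 h1] := assign_ex (cpt_top (cpt_var (4 - r))) (isT : 1 < 5).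
have [c2 h2] := assign_ex (cpt_pop (cpt_var (4 - r))) r5.
exists (loopnz r (Seq c1 (Seq c2 (Seq (push_bit i false)
  (loopnz 1 (Seq (dec M 1) (push_bit i true))))))).
have unary n w v : v 1 = n -> exec (loopnz 1 (Seq (dec M 1) (push_bit i true))) (mkstore w v)
    (mkstore (upd_at w i (foldr apush (w i) (nseq n true))) (upd_at v 1 0)).
  elim: n w v => [|n IH] w v vn /=.
    rewrite !upd_at_id //.
    exact: rex_stop.
  apply: exec_loop; last first.
  - have := IH (upd_at w i (apush true (w i))) (upd_at v 1 n).
    rewrite !upd_upd !upd_atE => /(_ erefl).
    have -> : foldr apush (apush true (w i)) (nseq n true) =
              apush true (foldr apush (w i) (nseq n true)).
      by elim: n {IH vn} => //= n ->.
    apply.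
  - exact: exec_seq (rex_dec vn w) (exec_push _ _ _ hi).
  - by rewrite mkstore_reg reg_mark vn.
elim/last_ind => [|L n IH] w v v0 v1 vr.
  rewrite /= !upd_at_id //.
  exact: rex_stop.
rewrite code_rcons in vr.
apply: exec_loop; first by rewrite mkstore_reg reg_mark vr snoc_neq0.
  apply: exec_seq (h1 _ v0 _) _; apply: exec_seq (h2 _ (scratch0_upd _ _ v0) _) _ => //.
  apply: exec_seq (exec_push _ _ _ hi) _; apply: (unary n).
  rewrite /upd_at eqxx [1 == r]eq_sym (negbTE r1).
  by rewrite env_var // vr top_snoc.
rewrite !upd_upd upd_atE.
have -> : foldr apush (w i) (word_of_nats (rcons L n)) =
  foldr apush (foldr apush (apush false (w i)) (nseq n true)) (word_of_nats L).
  by rewrite word_rcons foldr_cat foldr_rcons.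
set w' := upd_at w i _; set v' := upd_at _ 1 0.
have v'0 : scratch0 v' by do !apply: scratch0_upd => //.
have v'r : v' r = code L.
  rewrite /v' /upd_at (negbTE r1) eqxx env_var //.
  by rewrite (negbTE r1) vr pop_snoc.
have := IH w' v' v'0 (upd_atE _ _ _) v'r.
rewrite /w' upd_upd upd_atE.
have -> // : upd_at v' r 0 = upd_at v r 0.
apply: funext => j; rewrite /v' /upd_at.
by case: eqP => // jr; case: eqP => // ->.
Qed.

Lemma foldr_apush_blank u : foldr apush (@blank M) u = word_tape M u.
Proof.
elim: u => [|b u IH] /=; first by apply: funext => -[k|k]; rewrite /word_tape /= nth_nil.
rewrite IH; apply: funext => -[[|k]|k]; rewrite /apush /awrite //=.
  by rewrite (_ : (Posz k.+1 - 1)%R = Posz k); last by lia.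
rewrite (_ : (Negz k - 1)%R = Negz k.+1); last by lia.
by rewrite /word_tape /= !nth_nil.
Qed.

Lemma reads_apush u t : ~~ isbit (t 0%R) -> reads u (foldr apush t u).
Proof.
move=> t0; elim: u => [//|b u IH] /=; split; first by rewrite /apush /awrite eqxx.
apply: eq_reads IH => n /=; rewrite /apush /awrite /=.
case: eqP => [|_]; first by lia.
by rewrite (_ : (Posz n + 1 - 1)%R = Posz n); last by lia.
Qed.

Definition mark_cell i : cmd M := @Do M i (fun _ => (mark M, Stay)).

Fixpoint setup n : cmd M :=
  if n is n'.+1 then Seq (mark_cell (base + n')) (setup n')
  else @Do M 0 (fun s => (s, Stay)).

Lemma cbound_setup n : cbound (setup n) <= base + n.-1.
Proof. by elim: n => //= n IH; rewrite geq_max; lia. Qed.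

(** The first n registers are blank tapes still to be marked; those beyond the tapes of the final
    machine are regarded as marked from the start. *)
Definition init_store w n : store :=
  fun i => if i < base then w i else if i - base < n then @blank M else reg M 0.

Lemma exec_setup n w : exec (setup n) (init_store w n) (mkstore w (fun=> 0)).
Proof.
elim: n => [|n IH] /=.
  have -> : init_store w 0 = mkstore w (fun=> 0).
    by apply: funext => i; rewrite /init_store /mkstore; case: ifP.
  have := exec_io (fun s => (s, Stay)) w (fun=> 0) (isT : 0 < base).
  rewrite /act /= awrite_id.
  by have -> : upd_at w 0 (w 0) = w by apply: funext => -[].
apply: exec_seq IH.
have -> : init_store w n = upd_at (init_store w n.+1) (base + n)
   (act (mark M, Stay) (init_store w n.+1 (base + n))).
  apply: funext => i; rewrite /upd_at /init_store.
  case: eqP => [->|h].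
    rewrite ltnNge leq_addr /= addKn ltnn ltnSn.
    by apply: funext => z; rewrite /act /awrite /reg /=; case: eqP.
  case: (ltnP i base) => // hb; congr (if _ then _ else _).
  by rewrite ltnS leq_eqVlt; case: eqP => //; lia.
exact: (exec_do (base + n) (fun _ => (mark M, Stay)) (init_store w n.+1)).
Qed.

Lemma exec_run_store w v (L1 L2 : seq nat) :
  w 1 = word_tape M (word_of_nats L1) ->
  (forall i, 1 < i <= ntapes -> w i = @blank M) ->
  tm_computes M (word_of_nats L1) (word_of_nats L2) ->
  exists w', [/\ exec (Run M) (mkstore w v) (mkstore w' v), w' 0 = w 0 &
    reads (word_of_nats L2) (w' 1)].
Proof.
move=> w1 wb [n [hh ho]].
set cn := iter n _ _ in hh ho.
pose w' i := if 0 < i <= ntapes then @embed M \o abs_tape (cn.2 (inord i.-1)) else w i.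
exists w'; split=> //; last first.
  rewrite /w' /= (_ : inord 0 = ord0); last by apply: val_inj; rewrite /= inordK.
  rewrite -ho /tm_output; case: (cn.2 ord0) => l r; exact: leading_reads.
apply: (@exec_run M _ _ (tm_init M (word_of_nats L1)) n) => //.
- move=> j; rewrite /mkstore ltnS ltn_ord /=.
  case: eqP => [->|/eqP j0]; first exact: w1.
  rewrite wb; last by rewrite ltnS lt0n ltn_ord andbT; apply: contra j0 => /eqP h; apply/eqP/val_inj.
  by apply: funext => -[k|k]; rewrite /= nth_nil.
- by move=> j; rewrite /mkstore ltnS ltn_ord /w' /= ltnS -ltnS ltn_ord inord_val.
- move=> i hi; rewrite /mkstore /w'; case: ifP => // ib.
  by rewrite (_ : (0 < i <= ntapes) = false); last by lia.
Qed.

(** [pre] turns the input into the query for [M], [chk] is 0 on a successful candidate and [ans]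
    extracts the answer. Registers 0, 2, 3 hold the input, the reply of [M] and the candidate; 1 is
    used for unary transfers, 4 for the last computed value. *)
Theorem search_machine (pre : nat -> nat) (chk ans : nat -> nat -> nat -> nat) :
  cpt (fun s => pre (s 0)) -> cpt (fun s => chk (s 0) (s 1) (s 2)) ->
  cpt (fun s => ans (s 0) (s 1) (s 2)) ->
  exists M', forall L L1 L2 La t,
    pre (code L) = code L1 ->
    tm_computes M (word_of_nats L1) (word_of_nats L2) ->
    (forall t', t' < t -> chk (code L) (code L2) t' != 0) ->
    chk (code L) (code L2) t = 0 ->
    ans (code L) (code L2) t = code La ->
    tm_computes M' (word_of_nats L) (word_of_nats La).
Proof.
move=> cpre cchk cans.
(* Variable i of [env 5] is register 4 - i, so these are the registers 0, 2 and 3. *)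
pose xi (i : nat) := nth 0 [:: 4; 2; 1] i.
have [crd hrd] := @read_ex 0 0 isT isT isT.
have [cpr hpr] := assign_ex (cpt_rename xi cpre) (isT : 4 < 5).
have [cwr hwr] := @write_ex 1 4 isT isT isT.
have [crd2 hrd2] := @read_ex 1 2 isT isT isT.
have [cck hck] := assign_ex (cpt_rename xi cchk) (isT : 4 < 5).
have [can han] := assign_ex (cpt_rename xi cans) (isT : 4 < 5).
have [cwo hwo] := @write_ex 0 4 isT isT isT.
pose loop := loopnz 4 (Seq (inc M 3) cck).
pose main := Seq crd (Seq cpr (Seq cwr (Seq (Run M) (Seq crd2 (Seq cck (Seq loop
   (Seq can cwo))))))).
pose n := (cbound main).+1.
exists (machine (frag_of (Seq (setup n) main)) (base + n.-1)).
move=> L L1 L2 La t pL cM ht h0 hans.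
pose w0 i : atape aux := if i is 0 then word_tape M (word_of_nats L) else @blank M.
pose T0 := init_store w0 n.
suff [T' [hT hr]] : exists T', exec main (mkstore w0 (fun=> 0)) T' /\
    reads (word_of_nats La) (T' 0).
  apply: (exec_computes (T := T0) (T' := T')) hr => //.
  - change (maxn (cbound (setup n)) (cbound main) <= base + n.-1).
    by rewrite geq_max cbound_setup leq_addl.
  - move=> i /andP[i0 iN]; rewrite /T0 /init_store.
    case: ltnP => ib; first by case: i i0 {iN ib}.
    by case: ltnP => //; rewrite /n in iN *; lia.
  exact: exec_seq (exec_setup n w0) hT.
have hw0 : reads (word_of_nats L) (w0 0).
  rewrite /w0 /word_tape -[X in abs_tape X]/(_, _).
  have := @leading_reads M [::] [seq Some (inl b) | b <- word_of_nats L].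
  have -> // : forall u : seq bool,
      leading_bits [seq Some (inl b) : symbol (tm_aux M) | b <- u] = u.
  by elim=> //= b u ->.
have [t1 [ht1 e1]] := hrd L w0 (fun=> 0) (fun _ _ => erefl) erefl hw0.
set w1 := upd_at w0 0 t1 in e1.
pose v1 := upd_at (fun=> 0) 0 (code L).
have sv1 : scratch0 v1 by apply: scratch0_upd.
have e2 := hpr v1 sv1 w1.
set v2 := upd_at v1 4 _ in e2.
have v24 : v2 4 = code L1 by rewrite -pL.
have sv2 : scratch0 v2 by apply: scratch0_upd.
have e3 := hwr L1 w1 v2 sv2 erefl v24.
rewrite [w1 1]/= foldr_apush_blank in e3.
set w3 := upd_at w1 1 _ in e3.
have v3E : upd_at v2 4 0 = v1 by apply: funext => -[|[|[|[|[|j]]]]].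
rewrite v3E in e3.
have [w4 [e4 w40 w41]] := @exec_run_store w3 v1 L1 L2 erefl
   ltac:(by move=> [|[|i]]) cM.
have [t5 [_ e5]] := hrd2 L2 w4 v1 sv1 erefl w41.
set w5 := upd_at w4 1 t5 in e5.
rewrite -/(code L2) in e5.
pose v5 k z := upd_at (upd_at (upd_at v1 2 (code L2)) 3 k) 4 z.
have sv5 k z : scratch0 (v5 k z) by do !apply: scratch0_upd => //.
have v5E : upd_at v1 2 (foldl snoc (v1 2) L2) = v5 0 0.
  by apply: funext => -[|[|[|[|[|j]]]]].
rewrite v5E in e5.
have e6 k z : rex cck (v5 k z) (v5 k (chk (code L) (code L2) k)).
  by have := hck _ (sv5 k z); rewrite /v5 upd_upd.
(* Induction on the number k of candidates still to be tried. *)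
have e7 k : k <= t -> rex loop (v5 (t - k) (chk (code L) (code L2) (t - k))) (v5 t 0).
  elim: k => [|k IH] kt; first by rewrite subn0 h0; apply: rex_stop.
  apply: rex_loop; [by apply: ht; lia | | exact: IH (ltnW kt)].
  apply: rex_seq (rex_inc 3 _) _.
  have -> : upd_at (v5 (t - k.+1) (chk (code L) (code L2) (t - k.+1))) 3
     (v5 (t - k.+1) (chk (code L) (code L2) (t - k.+1)) 3).+1 =
     v5 (t - k) (chk (code L) (code L2) (t - k.+1)).
    apply: funext => -[|[|[|[|[|j]]]]] //=.
    by rewrite /v5 /upd_at /=; lia.
  exact: e6.
have := e7 t (leqnn t); rewrite subnn => e7'.
have e8 := han (v5 t 0) (sv5 t 0) w5.
have e8E : upd_at (v5 t 0) 4 (((fun s => ans (s 0) (s 1) (s 2)) \o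
     (fun s => s \o xi)) (env 5 (v5 t 0))) = v5 t (code La).
  by rewrite /v5 upd_upd -hans.
have e9 := hwo La w5 (v5 t (code La)) (sv5 _ _) erefl erefl.
eexists; split.
  apply: exec_seq e1 _; apply: exec_seq e2 _; apply: exec_seq e3 _.
  apply: exec_seq e4 _; apply: exec_seq e5 _; apply: exec_seq (e6 0 0 _) _.
  apply: exec_seq (e7' _) _; apply: exec_seq _ e9.
  by rewrite -e8E.
have -> : mkstore (upd_at w5 0 (foldr apush (w5 0) (word_of_nats La)))
   (upd_at (v5 t (code La)) 4 0) 0 = foldr apush (w5 0) (word_of_nats La) by [].
by apply: reads_apush; rewrite /w5 /upd_at /= w40.
Qed.

End Program.

Local Open Scope ring_scope.

(** * Certificates for the finitely repeated game *)

Definition sumq (n : nat) (f : nat -> rat) : rat := \sum_(i < n) f i.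

(* [nodes a n] is the number of nodes of depth less than n in the a-ary tree,
   numbered breadth first: the children of [nd] are a * nd + 1, ..., a * nd + a. *)
Definition nodes (a n : nat) : nat := \sum_(l < n) a ^ l.

Lemma nodesS a n : nodes a n.+1 = (a * nodes a n).+1.
Proof.
rewrite /nodes big_ord_recl /= expn0 add1n big_distrr /=; congr _.+1.
by apply: eq_bigr => l _; rewrite expnS.
Qed.

Lemma leq_nodes a m n : (m <= n)%N -> (nodes a m <= nodes a n)%N.
Proof.
move/subnKC <-; rewrite /nodes big_split_ord /=.
exact: leq_addr.
Qed.

Definition child (I J S nd i j s : nat) : nat :=
  (I * J * S * nd + ((i * J + j) * S + s)).+1.

Definition stage_value (K I J S : nat) (g : nat -> nat -> nat -> rat)
    (mu : nat -> nat -> rat) (w : nat -> rat) (nd i j : nat) : rat :=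
  sumq K (fun k => mu nd k * g k i j) + sumq S (fun s => w (child I J S nd i j s)).

(* Tables over the tree of histories: the unnormalised beliefs [mu], the values
   [w] of the remaining game and optimal mixed actions [x] and [y].  All the
   conditions are local, and they determine [w 0]. *)
Definition certificate (K I J S : nat) (P : nat -> nat -> nat -> nat -> nat -> rat)
    (g : nat -> nat -> nat -> rat) (b : nat -> rat) (n : nat)
    (mu : nat -> nat -> rat) (w : nat -> rat) (x y : nat -> nat -> rat) : bool :=
  [&& allf K (fun k => mu 0%N k == b k),
      allf (nodes (I * J * S) n) (fun nd =>
        [&& sumq I (fun i => x nd i) == 1, sumq J (fun j => y nd j) == 1,
            allf I (fun i => allf J (fun j => allf S (fun s => allf K (fun k' =>
              mu (child I J S nd i j s) k' ==
              sumq K (fun k => mu nd k * P k i j k' s))))),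
            allf J (fun j => w nd <=
              sumq I (fun i => x nd i * stage_value K I J S g mu w nd i j)) &
            allf I (fun i =>
              sumq J (fun j => y nd j * stage_value K I J S g mu w nd i j) <= w nd)]) &
      allf (nodes (I * J * S) n.+1) (fun nd =>
        (nodes (I * J * S) n <= nd)%N ==> (w nd == 0))].

Section Certificate.
Variables (K I J S : nat) (G : hsg rat 'I_K 'I_I 'I_J 'I_S) (b : dist rat 'I_K).
Variables (P : nat -> nat -> nat -> nat -> nat -> rat).
Variables (g : nat -> nat -> nat -> rat) (bb : nat -> rat).

Local Notation A := ('I_I * 'I_J * 'I_S)%type.
Local Notation a := (I * J * S)%N.
Implicit Types (h : seq A) (l : A).

Hypothesis PE : forall (k : 'I_K) (i : 'I_I) (j : 'I_J) (k' : 'I_K) (s : 'I_S),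
  P k i j k' s = trans G k i j (k', s).
Hypothesis gE : forall (k : 'I_K) (i : 'I_I) (j : 'I_J), g k i j = reward G k i j.
Hypothesis bE : forall k : 'I_K, bb k = b k.

Definition letter_num l : nat := ((l.1.1 * J + l.1.2) * S + l.2)%N.
Definition node h : nat := foldl (fun nd l => (a * nd + letter_num l).+1) 0%N h.

Lemma letter_num_lt l : (letter_num l < a)%N.
Proof.
case: l => [[i j] s]; rewrite /letter_num /=.
have hi := ltn_ord i; have hj := ltn_ord j; have hs := ltn_ord s.
have h1 : (i * J + j < I * J)%N by nia.
nia.
Qed.

Lemma letter_num_surj d : (d < a)%N -> exists l, letter_num l = d.
Proof.
move=> hd; have S0 : (0 < S)%N by case: (S) hd => //; rewrite muln0.
have J0 : (0 < J)%N by case: (J) hd => //; rewrite muln0.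
have h1 : (d %/ S < I * J)%N by rewrite ltn_divLR.
have h2 : (d %/ S %/ J < I)%N by rewrite ltn_divLR.
have h3 : (d %/ S %% J < J)%N by rewrite ltn_mod.
have h4 : (d %% S < S)%N by rewrite ltn_mod.
exists (Ordinal h2, Ordinal h3, Ordinal h4); rewrite /letter_num /=.
by rewrite -!divn_eq.
Qed.

Lemma letter_num_inj : injective letter_num.
Proof.
move=> [[i j] s] [[i' j'] s']; rewrite /letter_num /= => e.
have hs := ltn_ord s; have hs' := ltn_ord s'.
have hj := ltn_ord j; have hj' := ltn_ord j'.
have e1 : (i * J + j = i' * J + j')%N.
  have := congr1 (divn^~ S) e; rewrite /= !divnMDl ?(leq_ltn_trans _ hs) //.
  by rewrite !divn_small // !addn0.
have e2 : (s = s' :> nat)%N by move: e; rewrite e1 => /addnI.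
have e3 : (i = i' :> nat)%N.
  have := congr1 (divn^~ J) e1; rewrite /= !divnMDl ?(leq_ltn_trans _ hj) //.
  by rewrite !divn_small // !addn0.
have e4 : (j = j' :> nat)%N by move: e1; rewrite e3 => /addnI.
by congr (_, _, _); apply: val_inj.
Qed.

Lemma node_rcons h l : node (rcons h l) = (a * node h + letter_num l).+1.
Proof. by rewrite /node foldl_rcons. Qed.

Lemma node_bounds h : (nodes a (size h) <= node h < nodes a (size h).+1)%N.
Proof.
elim/last_ind: h => [|h l IH]; first by rewrite /nodes big_ord0 big_ord1.
rewrite size_rcons node_rcons; move: IH => /andP[h1 h2].
have hl := letter_num_lt l; rewrite !nodesS !ltnS; apply/andP; split; first nia.
rewrite -nodesS; nia.
Qed.

Lemma node_inj : injective node.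
Proof.
elim/last_ind => [|h l IH] h'.
  by case/lastP: h' => // h' l'; rewrite node_rcons.
case/lastP: h' => [|h' l']; rewrite !node_rcons // => -[e].
have hl := letter_num_lt l; have hl' := letter_num_lt l'.
have a0 : (0 < a)%N by apply: leq_ltn_trans hl.
have e1 : node h = node h'.
  have := congr1 (divn^~ a) e; rewrite /= ![(a * _)%N]mulnC !divnMDl //.
  by rewrite !divn_small // !addn0.
rewrite (IH _ e1); congr rcons; apply: letter_num_inj.
by move: e; rewrite e1 => /addnI.
Qed.

Lemma node_surj nd : (0 < a)%N -> exists h, node h = nd.
Proof.
move=> a0; elim/ltn_ind: nd => -[|nd] IH; first by exists [::].
have [|h hE] := IH (nd %/ a)%N; first by rewrite ltnS leq_div.
have [l lE] := letter_num_surj (ltn_pmod nd a0).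
by exists (rcons h l); rewrite node_rcons hE lE mulnC -divn_eq.
Qed.

Lemma child_node h l :
  child I J S (node h) l.1.1 l.1.2 l.2 = node (rcons h l).
Proof. by rewrite node_rcons. Qed.

Lemma push_rcons (mu : {ffun 'I_K -> rat}) h l :
  push G mu (rcons h l) = upd G (push G mu h) l.
Proof. by rewrite /push foldl_rcons. Qed.

Lemma sumqE n (f : nat -> rat) (f' : 'I_n -> rat) :
  (forall i : 'I_n, f i = f' i) -> sumq n f = \sum_i f' i.
Proof. by move=> h; apply: eq_bigr => i _; rewrite h. Qed.

(** Beliefs are identified from the root downwards, then values from the leaves upwards by
    [mval_unique]. The signs of [x] and [y] are left out of the check because quotients of natural
    numbers are nonnegative. *)
Lemma certificate_sound n mu w x y :
  certificate K I J S P g bb n mu w x y ->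
  (forall nd i, 0 <= x nd i) -> (forall nd j, 0 <= y nd j) ->
  V G n b = w 0%N.
Proof.
case/and3P=> /allfP c1 /allfP c2 /allfP c3 x0 y0.
have muE h : (size h <= n)%N -> forall k : 'I_K, mu (node h) k = push G b h k.
  elim/last_ind: h => [|h l IH] hs k.
    by rewrite /= (eqP (c1 _ _)).
  rewrite size_rcons in hs; have := IH (ltnW hs) => {}IH.
  have nh : (node h < nodes a n)%N.
    by have /andP[_ h1] := node_bounds h; apply: leq_trans h1 (leq_nodes _ hs).
  have /and5P[_ _ /allfP h1 _ _] := c2 _ nh.
  have /allfP h2 := h1 _ (ltn_ord l.1.1).
  have /allfP h3 := h2 _ (ltn_ord l.1.2).
  have /allfP h4 := h3 _ (ltn_ord l.2).
  have /eqP := h4 _ (ltn_ord k); rewrite child_node => ->.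
  rewrite push_rcons ffunE; apply: sumqE => k1.
  by rewrite IH PE.
have wE r h : (size h + r = n)%N -> w (node h) = V G r (push G b h).
  elim: r h => [|r IH] h hs.
    have /andP[h1 h2] := node_bounds h; rewrite addn0 in hs; rewrite hs in h1 h2.
    by apply/eqP; have := c3 _ h2; rewrite h1.
  have hn : (size h < n)%N by rewrite -hs addnS ltnS leq_addr.
  have nh : (node h < nodes a n)%N.
    by have /andP[_ h1] := node_bounds h; apply: leq_trans h1 (leq_nodes _ hn).
  have /and5P[/eqP sx /eqP sy _ /allfP h1 /allfP h2] := c2 _ nh.
  have stE (i : 'I_I) (j : 'I_J) :
      stage_value K I J S g mu w (node h) i j = stage_game G r (push G b h) i j.
    rewrite /stage_value /stage_game; congr (_ + _).
      by apply: sumqE => k; rewrite muE ?gE // ltnW.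
    apply: sumqE => s; rewrite (child_node h (i, j, s)) IH ?push_rcons //.
    by rewrite size_rcons -hs addnS.
  have [X XE] := @dist_mk rat 'I_I (fun i => x (node h) i) (fun i => x0 _ i) sx.
  have [Y YE] := @dist_mk rat 'I_J (fun i => y (node h) i) (fun i => y0 _ i) sy.
  rewrite VS; apply/esym/(@mval_unique _ _ _ _ _ G _ X Y) => [j|i].
    apply: le_trans (h1 _ (ltn_ord j)) _.
    by rewrite le_eqVlt; apply/orP; left; apply/eqP/sumqE => i; rewrite stE XE.
  apply: le_trans _ (h2 _ (ltn_ord i)).
  by rewrite le_eqVlt; apply/orP; left; apply/eqP/esym/sumqE => j; rewrite stE YE.
by rewrite (wE n [::]).
Qed.

Lemma certificate_exists n : exists mu w x y,
  [/\ certificate K I J S P g bb n mu w x y,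
      forall nd k, 0 <= mu nd k, forall nd, 0 <= w nd,
      forall nd i, 0 <= x nd i & forall nd j, 0 <= y nd j].
Proof.
have a0 : (0 < a)%N.
  have := actions1_gt0 G; have := actions2_gt0 G; have := signals_gt0 G.
  by rewrite !card_ord !muln_gt0 => -> -> ->.
pose hist nd := projT1 (cid (node_surj nd a0)).
have histK nd : node (hist nd) = nd := projT2 (cid (node_surj nd a0)).
have nodeK h : hist (node h) = h by apply: node_inj; rewrite histK.
pose ext N (f : 'I_N -> rat) (k : nat) : rat := if insub k is Some k' then f k' else 0.
have extE N (f : 'I_N -> rat) (k : 'I_N) : ext N f k = f k by rewrite /ext valK.
have ext0 N (f : 'I_N -> rat) k : (forall k', 0 <= f k') -> 0 <= ext N f k.
  by move=> f0; rewrite /ext; case: insub.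
(* The truncated subtraction gives 0 remaining stages from depth n on, hence [w nd = 0] there. *)
pose M nd := push G b (hist nd); pose r nd := (n - size (hist nd))%N.
have M0 nd : nneg (M nd) by apply: push_ge0; apply: dist_nneg.
pose mu nd k := ext K (M nd) k.
pose w nd := V G (r nd) (M nd).
pose sad nd := saddle G (stage_game G (r nd).-1 (M nd)).
pose x nd i := ext I (sad nd).1 i.
pose y nd j := ext J (sad nd).2 j.
have w0 nd : 0 <= w nd by apply: V_ge0.
have x0 nd i : 0 <= x nd i by apply: ext0 => k; apply: dist_ge0.
have y0 nd i : 0 <= y nd i by apply: ext0 => k; apply: dist_ge0.
have mu0 nd k : 0 <= mu nd k by apply: ext0 => k'; apply: M0.
exists mu, w, x, y; split=> //.
have histS nd (i : 'I_I) (j : 'I_J) (s : 'I_S) :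
    hist (child I J S nd i j s) = rcons (hist nd) (i, j, s).
  by rewrite -{1}(histK nd) (child_node _ (i, j, s)) nodeK.
have sizeh nd m : (nd < nodes a m)%N -> (size (hist nd) < m)%N.
  move=> h; rewrite ltnNge; apply/negP => hm.
  have /andP[h1 _] := node_bounds (hist nd); rewrite histK in h1.
  by have := leq_trans (leq_nodes a hm) h1; rewrite leqNgt h.
have stE nd (i : 'I_I) (j : 'I_J) : (nd < nodes a n)%N ->
    stage_value K I J S g mu w nd i j = stage_game G (r nd).-1 (M nd) i j.
  move=> hnd; rewrite /stage_value /stage_game; congr (_ + _).
    by apply: sumqE => k; rewrite /mu extE gE.
  apply: sumqE => s; rewrite /w /M /r histS push_rcons size_rcons.
  by rewrite subnS.
have rS nd : (nd < nodes a n)%N -> r nd = (r nd).-1.+1.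
  by move=> h; rewrite prednK // subn_gt0; apply: sizeh.
apply/and3P; split.
- apply/allfP => k hk; apply/eqP.
  by rewrite -[k]/(val (Ordinal hk)) bE /mu extE /M -[0%N]/(node [::]) nodeK.
- apply/allfP => nd hnd; apply/and5P; split.
  + rewrite (sumqE (f' := fun i => (sad nd).1 i)) ?dist_sum // => i.
    by rewrite /x extE.
  + rewrite (sumqE (f' := fun i => (sad nd).2 i)) ?dist_sum // => i.
    by rewrite /y extE.
  + apply/allfP => i hi; apply/allfP => j hj; apply/allfP => s hs; apply/allfP => k hk.
    rewrite -[i]/(val (Ordinal hi)) -[j]/(val (Ordinal hj)) -[s]/(val (Ordinal hs)).
    rewrite -[k]/(val (Ordinal hk)) /mu extE /M histS push_rcons ffunE eq_sym.
    by apply/eqP/sumqE => k1; rewrite extE PE.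
  + apply/allfP => j hj; rewrite -[j]/(val (Ordinal hj)) /w rS // VS.
    apply: le_trans (mval_ge _ _ (Ordinal hj)) _; rewrite -/(sad nd).
    rewrite le_eqVlt; apply/orP; left; apply/eqP/esym/sumqE => i.
    by rewrite stE // /x extE.
  + apply/allfP => i hi; rewrite -[i]/(val (Ordinal hi)) /w rS // VS.
    apply: le_trans _ (mval_le _ _ (Ordinal hi)); rewrite -/(sad nd).
    rewrite le_eqVlt; apply/orP; left; apply/eqP/sumqE => j.
    by rewrite stE // /y extE mulrC.
- apply/allfP => nd hnd; apply/implyP => hn; apply/eqP.
  rewrite /w /r (_ : n - size (hist nd) = 0)%N //; apply/eqP; rewrite subn_eq0.
  rewrite leqNgt; apply/negP => h.
  have /andP[_ h1] := node_bounds (hist nd); rewrite histK in h1.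
  by have := leq_trans h1 (leq_nodes a h); rewrite ltnNge hn.
Qed.

End Certificate.

(** A rational saddle point remains one over the reals, so the real value at rational data is the
    rational value. *)
Lemma V_ratr (R : realType) (K I J S : finType) (G : hsg rat K I J S) n
    (mu : {ffun K -> rat}) (nu : {ffun K -> R}) :
  (forall k, nu k = ratr (mu k)) -> V (real_game R G) n nu = ratr (V G n mu).
Proof.
elim: n mu nu => [|n IH] mu nu e; first by rewrite /= rmorph0.
have stE i j : stage_game (real_game R G) n nu i j = ratr (stage_game G n mu i j).
  rewrite /stage_game rmorphD rmorph_sum /=; congr (_ + _).
    by apply: eq_bigr => k _; rewrite e rmorphM.
  rewrite rmorph_sum; apply: eq_bigr => s _; apply: IH => k; rewrite !ffunE rmorph_sum.
  by apply: eq_bigr => k' _; rewrite e rmorphM /= ffunE.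
rewrite !VS; apply: (@mval_unique _ _ _ _ _ _ _
  (real_dist R (saddle G (stage_game G n mu)).1)
  (real_dist R (saddle G (stage_game G n mu)).2)) => [j|i].
  have := mval_ge G (stage_game G n mu) j; rewrite -(ler_rat R) => h.
  apply: le_trans h _; rewrite rmorph_sum le_eqVlt; apply/orP; left; apply/eqP.
  by apply: eq_bigr => i _; rewrite stE rmorphM ffunE.
have := mval_le G (stage_game G n mu) i; rewrite -(ler_rat R) => h.
apply: le_trans _ h; rewrite rmorph_sum le_eqVlt; apply/orP; left; apply/eqP.
by apply: eq_bigr => j _; rewrite stE rmorphM ffunE mulrC.
Qed.

(** * Computability of the certificate check *)

(** Nonnegative unreduced fractions: all the certificate conditions are sums, products and
    comparisons, free of subtraction. *)
Definition cptQ (f : (nat -> nat) -> rat) := exists p q, [/\ cpt p, cpt q &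
  forall s, (0 < q s)%N /\ f s = (p s)%:R / (q s)%:R].

Lemma cptQ_frac a b : cpt a -> cpt b -> cptQ (fun s => (a s)%:R / (b s)%:R).
Proof.
move=> ca cb; exists (fun s => if b s == 0%N then 0%N else a s),
  (fun s => if b s == 0%N then 1%N else b s); split.
- exact: (cpt_ifz cb (cpt_const 0) ca).
- exact: (cpt_ifz cb (cpt_const 1) cb).
move=> s; case: (posnP (b s)) => [->|b0]; first by rewrite invr0 mulr0 mul0r.
by [].
Qed.

Lemma cptQ_nat a : cpt a -> cptQ (fun s => (a s)%:R).
Proof.
move=> ca; exists a, (fun=> 1%N); split=> //; first exact: cpt_const.
by move=> s; rewrite divr1.
Qed.

Lemma cptQ_add f g : cptQ f -> cptQ g -> cptQ (fun s => f s + g s).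
Proof.
move=> [p [q [cp cq h]]] [p' [q' [cp' cq' h']]].
exists (fun s => p s * q' s + p' s * q s)%N, (fun s => q s * q' s)%N; split.
- by apply: cpt_add; apply: cpt_mul.
- exact: cpt_mul.
move=> s; have [q0 ->] := h s; have [q'0 ->] := h' s; rewrite muln_gt0 q0; split=> //.
by rewrite natrD !natrM; field; rewrite !pnatr_eq0 -!lt0n q0 q'0.
Qed.

Lemma cptQ_mul f g : cptQ f -> cptQ g -> cptQ (fun s => f s * g s).
Proof.
move=> [p [q [cp cq h]]] [p' [q' [cp' cq' h']]].
exists (fun s => p s * p' s)%N, (fun s => q s * q' s)%N; split; try exact: cpt_mul.
move=> s; have [q0 ->] := h s; have [q'0 ->] := h' s; rewrite muln_gt0 q0; split=> //.
by rewrite !natrM; field; rewrite !pnatr_eq0 -!lt0n q0 q'0.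
Qed.

Lemma cpt_prod n (F : nat -> (nat -> nat) -> nat) :
  cpt n -> cpt (fun s => F (s 0%N) (fun i => s i.+1)) ->
  cpt (fun s => \prod_(i < n s) F i s)%N.
Proof.
move=> cn cF; apply: cpt_ext (cpt_iter_down (F := fun m x s => F m s * x)%N cn
  (cpt_const 1) _) => [s|].
  have h k x : iter_down k (fun m x => F m s * x)%N x = ((\prod_(i < k) F i s) * x)%N.
    elim: k x => [|k IH] x /=; first by rewrite big_ord0 mul1n.
    by rewrite IH big_ord_recr /= mulnA.
  by rewrite h muln1.
apply: cpt_mul (cpt_var 0).
exact: (@cpt_shift (fun s => F (s 0%N) (fun i => s i.+1))).
Qed.

(** The product of all the denominators is a common denominator and is computable by bounded
    iteration. *)
Lemma cptQ_sum n (F : nat -> (nat -> nat) -> rat) :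
  cpt n -> cptQ (fun s => F (s 0%N) (fun i => s i.+1)) ->
  cptQ (fun s => sumq (n s) (fun i => F i s)).
Proof.
move=> cn [p [q [cp cq h]]].
have sc (f : (nat -> nat) -> nat) : cpt f ->
    cpt (fun s => f (scons (s 0%N) (fun i => s i.+1))).
  by apply: cpt_ext => s; congr f; apply: funext => -[].
pose D s := (\prod_(j < n s) q (scons j s))%N.
have cD : cpt D by apply: (cpt_prod (F := fun j s => q (scons j s))) => //; apply: sc.
exists (fun s => sumf (n s) (fun i => p (scons i s) * (D s %/ q (scons i s)))%N), D.
split=> // [|s].
  apply: (cpt_sum (F := fun i s => p (scons i s) * (D s %/ q (scons i s)))%N) => //.
  by apply: cpt_mul; [exact: sc | apply: cpt_div; [exact: cpt_shift | exact: sc]].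
have q0 i : (0 < q (scons i s))%N by case: (h (scons i s)).
have D0 : (0 < D s)%N by apply: prodn_gt0.
split=> //; rewrite /sumq /sumf natr_sum mulr_suml; apply: eq_bigr => i _.
have [_] := h (scons i s); rewrite /= => ->.
have dv : (q (scons i s) %| D s)%N by rewrite /D (bigD1 i) //= dvdn_mulr.
have : (D s)%:R = (D s %/ q (scons i s))%:R * (q (scons i s))%:R :> rat.
  by rewrite -natrM divnK.
move=> e; rewrite natrM e.
have u0 : (D s %/ q (scons i s))%:R != 0 :> rat.
  by rewrite pnatr_eq0 -lt0n divn_gt0 // dvdn_leq.
by field; rewrite u0 pnatr_eq0 -lt0n q0.
Qed.

Lemma cptb_leQ f g : cptQ f -> cptQ g -> cptb (fun s => f s <= g s).
Proof.
move=> [p [q [cp cq h]]] [p' [q' [cp' cq' h']]].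
apply: (@cpt_ext (fun s => p s * q' s <= p' s * q s)%N) => [s|].
  have [q0 ->] := h s; have [q'0 ->] := h' s.
  by rewrite ler_pdivrMr ?ltr0n // mulrAC ler_pdivlMr ?ltr0n // -!natrM ler_nat.
by apply: cptb_leq; apply: cpt_mul.
Qed.

Lemma cptb_eqQ f g : cptQ f -> cptQ g -> cptb (fun s => f s == g s).
Proof.
move=> cf cg; apply: cpt_ext (cptb_and (cptb_leQ cf cg) (cptb_leQ cg cf)) => s.
by rewrite eq_le.
Qed.

(** * Layout of the input and of the tables *)

(** The input lists the four sizes, one block per triple (k, i, j) with the transition law and the
    reward, then b, x and eps; each rational takes two entries. *)
Definition block (c : nat) : nat := (2 * (get c 0 * get c 3) + 2)%N.
Definition offset (c k i j : nat) : nat :=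
  (4 + ((k * get c 1 + i) * get c 2 + j) * block c)%N.
Definition frac_at (c i : nat) : rat := (get c i)%:R / (get c i.+1)%:R.
Definition inP c k i j k' s := frac_at c (offset c k i j + (k' * get c 3 + s) * 2).
Definition ing c k i j := frac_at c (offset c k i j + 2 * (get c 0 * get c 3)).
Definition inb c k :=
  frac_at c (4 + get c 0 * get c 1 * get c 2 * block c + k * 2).

(** The number 2 m d^2 q, with d and q the denominators of delta and eps; [precision_bound] explains
    it. *)
Definition horizon (c c2 : nat) : nat := (2 * get c2 0 * get c2 2 ^ 2 * top c)%N.

(** Entry 0 of a table is the denominator shared by all cells. Each node has a row of [width] cells:
    belief, value and the two mixed actions. *)
Definition cell (t i : nat) : rat := (get t i.+1)%:R / (get t 0)%:R.
Definition width (c : nat) : nat := (get c 0 + 1 + get c 1 + get c 2)%N.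
Definition cmu c t nd k := cell t (nd * width c + k).
Definition cw c t nd := cell t (nd * width c + get c 0).
Definition cx c t nd i := cell t (nd * width c + (get c 0 + 1 + i)).
Definition cy c t nd j := cell t (nd * width c + (get c 0 + 1 + get c 1 + j)).

Definition valid (c c2 t : nat) : bool :=
  certificate (get c 0) (get c 1) (get c 2) (get c 3) (inP c) (ing c) (inb c)
    (horizon c c2) (cmu c t) (cw c t) (cx c t) (cy c t).

Definition check (c c2 t : nat) : nat := ~~ valid c c2 t.

(** Whether V n > n x. Two pops discard eps and expose the denominator of x, a third its
    numerator. *)
Definition answer (c c2 t : nat) : nat :=
  snoc 0 (~~ (cw c t 0 <=
    (horizon c c2)%:R * ((top (iter 3 pop c))%:R / (top (iter 2 pop c))%:R))).

(** Drops b, x and eps, which take 2 K + 4 entries, and appends the fraction 1 / (4 q), with q the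
    denominator of eps. *)
Definition precode (c : nat) : nat :=
  snoc (snoc (iter (get c 0 * 2 + 4) pop c) 1) (4 * top c).

Ltac cpt_nat := match goal with
  | |- cpt (fun s => s ?i) => exact (cpt_var i)
  | |- cpt (fun _ => ?n) => exact (cpt_const n)
  | |- cpt (fun s => S (@?a s)) => refine (@cpt_S a _)
  | |- cpt (fun s => addn (@?a s) (@?b s)) => refine (@cpt_add a b _ _)
  | |- cpt (fun s => muln (@?a s) (@?b s)) => refine (@cpt_mul a b _ _)
  | |- cpt (fun s => expn (@?a s) (@?b s)) => refine (@cpt_exp a b _ _)
  | |- cpt (fun s => get (@?a s) (@?b s)) => refine (@cpt_get a b _ _)
  | |- cpt (fun s => top (@?a s)) => refine (@cpt_top a _)
  | |- cpt (fun s => pop (@?a s)) => refine (@cpt_pop a _)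
  | |- cpt (fun s => snoc (@?a s) (@?b s)) => refine (@cpt_snoc a b _ _)
  end.

Ltac cpt_arith := cbv beta; repeat (first [ assumption | cpt_nat ]; cbv beta).

Lemma cpt_block a : cpt a -> cpt (fun s => block (a s)).
Proof. by move=> ca; rewrite /block; cpt_arith. Qed.

Lemma cpt_width a : cpt a -> cpt (fun s => width (a s)).
Proof. by move=> ca; rewrite /width; cpt_arith. Qed.

Lemma cpt_offset c k i j : cpt c -> cpt k -> cpt i -> cpt j ->
  cpt (fun s => offset (c s) (k s) (i s) (j s)).
Proof.
move=> cc ck ci cj; rewrite /offset; have cb := cpt_block cc; cpt_arith.
Qed.

Lemma cptQ_frac_at c i : cpt c -> cpt i -> cptQ (fun s => frac_at (c s) (i s)).
Proof. by move=> cc ci; apply: cptQ_frac; cpt_arith. Qed.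

Lemma cptQ_cell t i : cpt t -> cpt i -> cptQ (fun s => cell (t s) (i s)).
Proof. by move=> ct ci; apply: cptQ_frac; cpt_arith. Qed.

Lemma cptQ_inP c k i j k' l : cpt c -> cpt k -> cpt i -> cpt j -> cpt k' -> cpt l ->
  cptQ (fun s => inP (c s) (k s) (i s) (j s) (k' s) (l s)).
Proof.
move=> cc ck ci cj ck' cl; apply: cptQ_frac_at => //.
by have co := cpt_offset cc ck ci cj; cpt_arith.
Qed.

Lemma cptQ_ing c k i j : cpt c -> cpt k -> cpt i -> cpt j ->
  cptQ (fun s => ing (c s) (k s) (i s) (j s)).
Proof.
move=> cc ck ci cj; apply: cptQ_frac_at => //.
by have co := cpt_offset cc ck ci cj; cpt_arith.
Qed.

Lemma cptQ_inb c k : cpt c -> cpt k -> cptQ (fun s => inb (c s) (k s)).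
Proof.
by move=> cc ck; apply: cptQ_frac_at => //; have cb := cpt_block cc; cpt_arith.
Qed.

Lemma cptQ_cmu c t nd k : cpt c -> cpt t -> cpt nd -> cpt k ->
  cptQ (fun s => cmu (c s) (t s) (nd s) (k s)).
Proof.
by move=> cc ct cn ck; apply: cptQ_cell => //; have cb := cpt_width cc; cpt_arith.
Qed.

Lemma cptQ_cw c t nd : cpt c -> cpt t -> cpt nd ->
  cptQ (fun s => cw (c s) (t s) (nd s)).
Proof.
by move=> cc ct cn; apply: cptQ_cell => //; have cb := cpt_width cc; cpt_arith.
Qed.

Lemma cptQ_cx c t nd k : cpt c -> cpt t -> cpt nd -> cpt k ->
  cptQ (fun s => cx (c s) (t s) (nd s) (k s)).
Proof.
by move=> cc ct cn ck; apply: cptQ_cell => //; have cb := cpt_width cc; cpt_arith.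
Qed.

Lemma cptQ_cy c t nd k : cpt c -> cpt t -> cpt nd -> cpt k ->
  cptQ (fun s => cy (c s) (t s) (nd s) (k s)).
Proof.
by move=> cc ct cn ck; apply: cptQ_cell => //; have cb := cpt_width cc; cpt_arith.
Qed.

Lemma cpt_horizon c c2 : cpt c -> cpt c2 -> cpt (fun s => horizon (c s) (c2 s)).
Proof. by move=> cc cc2; rewrite /horizon; cpt_arith. Qed.

Lemma cpt_nodes a n : cpt a -> cpt n -> cpt (fun s => nodes (a s) (n s)).
Proof.
move=> ca cn; apply: (cpt_sum (F := fun l s => a s ^ l)%N) => //.
exact: cpt_exp (cpt_shift ca) (cpt_var 0).
Qed.

Lemma cpt_child I J S nd i j l : cpt I -> cpt J -> cpt S -> cpt nd -> cpt i ->
  cpt j -> cpt l ->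
  cpt (fun s => child (I s) (J s) (S s) (nd s) (i s) (j s) (l s)).
Proof. by move=> *; rewrite /child; cpt_arith. Qed.

Ltac cpt_all := cbv beta; repeat (first
  [ assumption
  | cpt_nat
  | match goal with
    | |- cpt (fun s => horizon (@?a s) (@?b s)) => refine (@cpt_horizon a b _ _)
    | |- cpt (fun s => nodes (@?a s) (@?b s)) => refine (@cpt_nodes a b _ _)
    | |- cpt (fun s => child (@?a s) (@?b s) (@?c s) (@?d s) (@?e s) (@?f s) (@?g s)) =>
        refine (@cpt_child a b c d e f g _ _ _ _ _ _ _)
    | |- cptQ (fun s => inP (@?a s) (@?b s) (@?c s) (@?d s) (@?e s) (@?f s)) =>
        refine (@cptQ_inP a b c d e f _ _ _ _ _ _)
    | |- cptQ (fun s => ing (@?a s) (@?b s) (@?c s) (@?d s)) =>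
        refine (@cptQ_ing a b c d _ _ _ _)
    | |- cptQ (fun s => inb (@?a s) (@?b s)) => refine (@cptQ_inb a b _ _)
    | |- cptQ (fun s => cmu (@?a s) (@?b s) (@?c s) (@?d s)) =>
        refine (@cptQ_cmu a b c d _ _ _ _)
    | |- cptQ (fun s => cw (@?a s) (@?b s) (@?c s)) => refine (@cptQ_cw a b c _ _ _)
    | |- cptQ (fun s => cx (@?a s) (@?b s) (@?c s) (@?d s)) =>
        refine (@cptQ_cx a b c d _ _ _ _)
    | |- cptQ (fun s => cy (@?a s) (@?b s) (@?c s) (@?d s)) =>
        refine (@cptQ_cy a b c d _ _ _ _)
    | |- cptQ (fun s => sumq (@?n s) (fun i => @?f s i)) =>
        refine (@cptQ_sum n (fun i s => f s i) _ _)
    | |- cptQ (fun s => (@?a s) + (@?b s)) => refine (@cptQ_add a b _ _)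
    | |- cptQ (fun s => (@?a s) * (@?b s)) => refine (@cptQ_mul a b _ _)
    | |- cptQ (fun s => 1) => exact (cptQ_nat (cpt_const 1))
    | |- cptQ (fun s => 0) => exact (cptQ_nat (cpt_const 0))
    | |- cptb (fun s => (@?a s) && (@?b s)) => refine (@cptb_and a b _ _)
    | |- cptb (fun s => allf (@?n s) (fun i => @?p s i)) =>
        refine (@cptb_all n (fun i s => p s i) _ _)
    | |- cptb (fun s => leq (@?a s) (@?b s)) => refine (@cptb_leq a b _ _)
    end ]; cbv beta).

Lemma cptb_imp b c : cptb b -> cptb c -> cptb (fun s => b s ==> c s).
Proof.
move=> cb cc; apply: cpt_ext (cptb_neg (cptb_and cb (cptb_neg cc))) => s.
by case: (b s); case: (c s).
Qed.

Lemma cptb_valid : cptb (fun s => valid (s 0%N) (s 1%N) (s 2)).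
Proof.
rewrite /valid /certificate /stage_value.
apply: cptb_and; [|apply: cptb_and].
- apply: (@cptb_all _ (fun k s => cmu (s 0%N) (s 2) 0 k == inb (s 0%N) k)).
    by cpt_all.
  by apply: cptb_eqQ; cpt_all.
- cpt_all; try apply: cptb_eqQ; try apply: cptb_leQ; cpt_all.
- cpt_all; apply: cptb_imp; first by cpt_all.
  by apply: cptb_eqQ; cpt_all.
Qed.

(** * Reading the input *)

Lemma cpt_check : cpt (fun s => check (s 0%N) (s 1%N) (s 2)).
Proof. exact: cptb_neg cptb_valid. Qed.

Lemma cpt_iter_pop n c : cpt n -> cpt c -> cpt (fun s => iter (n s) pop (c s)).
Proof.
by move=> cn cc; exact: (cpt_iter (F := fun x _ => pop x) cn cc (cpt_pop (cpt_var 0))).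
Qed.

Lemma cpt_answer : cpt (fun s => answer (s 0%N) (s 1%N) (s 2)).
Proof.
apply: cpt_snoc; first exact: cpt_const.
apply: cptb_neg; apply: cptb_leQ.
  by apply: cptQ_cw; [exact: cpt_var | exact: cpt_var | exact: cpt_const].
apply: cptQ_mul; first exact: cptQ_nat (cpt_horizon (cpt_var 0) (cpt_var 1)).
by apply: cptQ_frac; apply: cpt_top; apply: cpt_iter_pop; cpt_arith.
Qed.

Lemma cpt_precode : cpt (fun s => precode (s 0%N)).
Proof.
rewrite /precode; apply: cpt_snoc; last by cpt_arith.
apply: cpt_snoc; last exact: cpt_const.
by apply: cpt_iter_pop; cpt_arith.
Qed.

Lemma nth_flatten_unif (T : Type) (x0 : T) (ss : seq (seq T)) w i r :
  all (fun s => size s == w) ss -> (r < w)%N -> (i < size ss)%N ->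
  nth x0 (flatten ss) (i * w + r) = nth x0 (nth [::] ss i) r.
Proof.
elim: ss i => [|s ss IH] [|i] //= /andP[/eqP sw al] rw hi; rewrite nth_cat sw.
  by rewrite rw.
by rewrite mulSn -addnA ltnNge leq_addr /= addKn IH.
Qed.

Lemma size_flatten_unif (T : Type) (ss : seq (seq T)) w :
  all (fun s => size s == w) ss -> size (flatten ss) = (size ss * w)%N.
Proof.
by elim: ss => //= s ss IH /andP[/eqP sw al]; rewrite size_cat sw IH // mulSn.
Qed.

Lemma nth_flatten_enum (C : finType) (f : C -> seq nat) w (c : C) r :
  (forall c, size (f c) = w) -> (r < w)%N ->
  nth 0%N (flatten [seq f c | c <- enum C]) (index c (enum C) * w + r) = nth 0%N (f c) r.
Proof.
move=> fw rw; rewrite (@nth_flatten_unif _ 0%N _ w) //.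
- by rewrite (nth_map c) ?nth_index ?index_mem ?mem_enum.
- by apply/allP => _ /mapP[c' _ ->]; rewrite fw.
- by rewrite size_map index_mem mem_enum.
Qed.

(** Products are enumerated lexicographically, which justifies the arithmetic offsets into the
    input. *)
Lemma index_enum_prod (C D : finType) (c : C) (d : D) :
  index (c, d) (enum {: C * D}) = (index c (enum C) * #|D| + index d (enum D))%N.
Proof.
set k := (_ + _)%N.
have eE : enum {: C * D} = flatten [seq [seq (x, y) | y <- enum D] | x <- enum C].
  by rewrite [LHS]enumT [in LHS]Finite.enum.unlock.
have hd : (index d (enum D) < #|D|)%N by rewrite cardE index_mem mem_enum.
have hc : (index c (enum C) < size (enum C))%N by rewrite index_mem mem_enum.
have kE : nth (c, d) (enum {: C * D}) k = (c, d).
  have al : all (fun s => size s == #|D|) [seq [seq (x, y) | y <- enum D] | x <- enum C].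
    by apply/allP => _ /mapP[x _ ->]; rewrite size_map -cardE.
  rewrite eE /k (nth_flatten_unif _ al hd) ?size_map //.
  rewrite (nth_map c) // nth_index ?mem_enum // (nth_map d) ?nth_index ?mem_enum //.
    by rewrite index_mem mem_enum.
  by rewrite -enumT.
rewrite -[in LHS]kE index_uniq ?enum_uniq // -cardE card_prod /k.
apply: (@leq_trans ((index c (enum C)).+1 * #|D|)); first by rewrite mulSn addnC ltn_add2r.
by rewrite leq_mul2r [#|C|]cardE hc orbT.
Qed.

Lemma index_ord n (i : 'I_n) : index i (enum 'I_n) = i.
Proof. by rewrite index_enum_ord. Qed.

Lemma nats_of_ratK (q : rat) : 0 <= q ->
  (nth 0%N (nats_of_rat q) 0)%:R / (nth 0%N (nats_of_rat q) 1)%:R = q.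
Proof.
move=> q0 /=; rewrite !natr_absz !ger0_norm ?numq_ge0 ?denq_ge0 //.
exact: divq_num_den.
Qed.

Lemma nats_of_rat_inv n : (0 < n)%N -> nats_of_rat n%:R^-1 = [:: 1%N; n].
Proof.
move=> n0; have e : n%:R^-1 = (1%:Z)%:~R / (n%:Z)%:~R :> rat by rewrite div1r.
rewrite /nats_of_rat e coprimeq_num ?coprimeq_den ?coprime1n //.
by rewrite gtr0_sg ?ltz_nat // eqz_nat gtn_eqF.
Qed.

Lemma size_nats_of_dist (C : finType) (d : dist rat C) :
  size (nats_of_dist d) = (#|C| * 2)%N.
Proof.
have al : all (fun s => size s == 2) [seq nats_of_rat (d c) | c <- enum C].
  by apply/allP => _ /mapP[c _ ->].
by rewrite (size_flatten_unif al) size_map cardE.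
Qed.

Lemma frac_at_code L i : (i.+1 < size L)%N ->
  frac_at (code L) i = (nth 0%N L i)%:R / (nth 0%N L i.+1)%:R.
Proof. by move=> h; rewrite /frac_at !get_code // ltnW. Qed.

Section Input.
Variables (G : rat_hsg) (b : dist rat 'I_(nK G)) (rest : seq nat).

Local Notation L := (nats_of_game G ++ nats_of_dist b ++ rest).
Local Notation c := (code L).
Local Notation blk := (#|{: 'I_(nK G) * 'I_(nS G)}| * 2 + 2)%N.

Definition entry (z : 'I_(nK G) * 'I_(nI G) * 'I_(nJ G)) : seq nat :=
  nats_of_dist (trans G z.1.1 z.1.2 z.2) ++ nats_of_rat (reward G z.1.1 z.1.2 z.2).

Lemma size_entry z : size (entry z) = blk.
Proof. by rewrite /entry size_cat size_nats_of_dist. Qed.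

Lemma size_nats_of_game :
  size (nats_of_game G) = (4 + nK G * nI G * nJ G * blk)%N.
Proof.
rewrite /nats_of_game size_cat; congr (_ + _)%N.
rewrite (@size_flatten_unif _ _ blk); last first.
  by apply/allP => _ /mapP[z _ ->]; rewrite size_entry.
by rewrite size_map -cardE !card_prod !card_ord.
Qed.

Lemma get_dims : [/\ get c 0 = nK G, get c 1 = nI G, get c 2 = nJ G & get c 3 = nS G].
Proof. by split; rewrite get_code //= !size_cat size_nats_of_game; lia. Qed.

Lemma blockE : block c = blk.
Proof.
by rewrite /block; have [-> _ _ ->] := get_dims; rewrite card_prod !card_ord mulnC.
Qed.

Lemma index_triple (k : 'I_(nK G)) (i : 'I_(nI G)) (j : 'I_(nJ G)) :
  index (k, i, j) (enum {: 'I_(nK G) * 'I_(nI G) * 'I_(nJ G)}) =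
  ((k * nI G + i) * nJ G + j)%N.
Proof. by rewrite !index_enum_prod !index_ord !card_ord. Qed.

Lemma nth_entry (k : 'I_(nK G)) (i : 'I_(nI G)) (j : 'I_(nJ G)) r : (r < blk)%N ->
  (offset c k i j + r < size L)%N /\
  nth 0%N L (offset c k i j + r) = nth 0%N (entry (k, i, j)) r.
Proof.
move=> hr; rewrite /offset blockE; have [_ -> -> _] := get_dims.
rewrite -index_triple; set z := index _ _.
have hz : (z < nK G * nI G * nJ G)%N.
  by rewrite -[X in (_ < X * _ * _)%N]card_ord -[X in (_ < _ * X * _)%N]card_ord
     -[X in (_ < _ * X)%N]card_ord -!card_prod cardE index_mem mem_enum.
have hs : (4 + z * blk + r < size (nats_of_game G))%N.
  rewrite size_nats_of_game -addnA ltn_add2l.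
  apply: (@leq_trans (z.+1 * blk)); first by rewrite mulSn addnC ltn_add2r.
  by rewrite leq_mul2r hz orbT.
split; first by rewrite size_cat (leq_trans hs) ?leq_addr.
rewrite nth_cat hs -addnA.
exact: (nth_flatten_enum _ size_entry hr).
Qed.

Lemma inP_code (k : 'I_(nK G)) (i : 'I_(nI G)) (j : 'I_(nJ G)) (k' : 'I_(nK G))
    (s : 'I_(nS G)) : inP c k i j k' s = trans G k i j (k', s).
Proof.
rewrite /inP; have [_ _ _ ->] := get_dims.
have e : ((k' * nS G + s) = index (k', s) (enum {: 'I_(nK G) * 'I_(nS G)}))%N.
  by rewrite index_enum_prod !index_ord card_ord.
rewrite e; set z := index _ _.
have hz : (z < #|{: 'I_(nK G) * 'I_(nS G)}|)%N by rewrite cardE index_mem mem_enum.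
have [h0 e0] := @nth_entry k i j (z * 2) ltac:(lia).
have [h1 e1] := @nth_entry k i j (z * 2).+1 ltac:(lia).
rewrite addnS in h1 e1; rewrite frac_at_code // e0 e1 /entry !nth_cat size_nats_of_dist.
have l0 : (z * 2 < #|{: 'I_(nK G) * 'I_(nS G)}| * 2)%N by lia.
have l1 : ((z * 2).+1 < #|{: 'I_(nK G) * 'I_(nS G)}| * 2)%N by lia.
rewrite l0 l1.
have h r : (r < 2)%N -> nth 0%N (nats_of_dist (trans G k i j)) (z * 2 + r) =
    nth 0%N (nats_of_rat (trans G k i j (k', s))) r.
  by move=> r2; apply: nth_flatten_enum.
by have := h 0%N isT; have := h 1%N isT; rewrite addn0 addn1 => -> ->;
  apply: nats_of_ratK; apply: dist_ge0.
Qed.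

Lemma ing_code (k : 'I_(nK G)) (i : 'I_(nI G)) (j : 'I_(nJ G)) :
  ing c k i j = reward G k i j.
Proof.
rewrite /ing; have [-> _ _ ->] := get_dims.
have e : (2 * (nK G * nS G) = #|{: 'I_(nK G) * 'I_(nS G)}| * 2)%N.
  by rewrite card_prod !card_ord mulnC.
rewrite e; set z := #|_|.
have [h0 e0] := @nth_entry k i j (z * 2) ltac:(rewrite -/z; lia).
have [h1 e1] := @nth_entry k i j (z * 2).+1 ltac:(rewrite -/z; lia).
rewrite addnS in h1 e1; rewrite frac_at_code // e0 e1 /entry !nth_cat size_nats_of_dist -/z.
rewrite ltnn subnn ltnNge leqnSn /= subSnn.
by apply: nats_of_ratK; case/andP: (reward01 G k i j).
Qed.

Lemma inb_code (k : 'I_(nK G)) : inb c k = b k.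
Proof.
rewrite /inb blockE; have [-> -> -> _] := get_dims.
rewrite -size_nats_of_game; set z := size _.
have h r : (r < 2)%N -> (z + (k * 2 + r) < size L)%N /\
    nth 0%N L (z + (k * 2 + r)) = nth 0%N (nats_of_rat (b k)) r.
  move=> r2; have hk : (k * 2 + r < size (nats_of_dist b))%N.
    by rewrite size_nats_of_dist card_ord; have := ltn_ord k; lia.
  split; first by rewrite !size_cat -/z ltn_add2l (leq_trans hk) ?leq_addr.
  rewrite nth_cat -/z ltnNge leq_addr /= addKn nth_cat hk.
  by rewrite -{1}(index_ord k); apply: nth_flatten_enum.
have [h0 e0] := h 0%N isT; have [h1 e1] := h 1%N isT.
rewrite addn0 in h0 e0; rewrite addn1 addnS in h1 e1.
by rewrite frac_at_code // e0 e1; apply: nats_of_ratK; apply: dist_ge0.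
Qed.

End Input.

(** * Certificates coded by numbers *)

Lemma common_denominator (qs : seq rat) : all (fun q => 0 <= q) qs ->
  exists N ms, [/\ (0 < N)%N, size ms = size qs &
    forall i, (i < size qs)%N -> (nth 0%N ms i)%:R / N%:R = nth 0 qs i].
Proof.
elim: qs => [_|q qs IH /= /andP[q0 /IH[N [ms [N0 sm h]]]]].
  by exists 1%N, [::].
have qE := nats_of_ratK q0; rewrite /= in qE.
set p := absz (numq q) in qE; set d := absz (denq q) in qE.
have d0 : (0 < d)%N by rewrite absz_gt0 denq_neq0.
have dn : d%:R != 0 :> rat by rewrite pnatr_eq0 -lt0n.
have Nn : N%:R != 0 :> rat by rewrite pnatr_eq0 -lt0n.
exists (N * d)%N, (p * N :: [seq m * d | m <- ms])%N; split=> /=.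
- by rewrite muln_gt0 N0.
- by rewrite size_map sm.
case=> [|i] hi /=; first by rewrite -qE !natrM; field; rewrite dn Nn.
by rewrite (nth_map 0%N) ?sm // -h // !natrM; field; rewrite dn Nn.
Qed.

Lemma child_lt I J S n nd i j s : (nd < nodes (I * J * S) n)%N ->
  (i < I)%N -> (j < J)%N -> (s < S)%N ->
  (child I J S nd i j s < nodes (I * J * S) n.+1)%N.
Proof.
move=> hn hi hj hs; rewrite nodesS /child ltnS.
have := letter_num_lt (Ordinal hi, Ordinal hj, Ordinal hs); rewrite /letter_num /=.
nia.
Qed.

(** The conditions involve only the nodes of depth at most n, so a finite table can stand for the
    infinite families. *)
Lemma certificate_ext K I J S P g b n mu w x y mu' w' x' y' :
  (forall nd k, (nd < nodes (I * J * S) n.+1)%N -> (k < K)%N -> mu nd k = mu' nd k) ->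
  (forall nd, (nd < nodes (I * J * S) n.+1)%N -> w nd = w' nd) ->
  (forall nd i, (nd < nodes (I * J * S) n.+1)%N -> (i < I)%N -> x nd i = x' nd i) ->
  (forall nd j, (nd < nodes (I * J * S) n.+1)%N -> (j < J)%N -> y nd j = y' nd j) ->
  certificate K I J S P g b n mu w x y -> certificate K I J S P g b n mu' w' x' y'.
Proof.
move=> em ew ex ey /and3P[/allfP c1 /allfP c2 /allfP c3].
have sumq_eq N (f f' : nat -> rat) : (forall i, (i < N)%N -> f i = f' i) ->
    sumq N f = sumq N f' by move=> h; apply: eq_bigr => i _; apply: h.
have up nd : (nd < nodes (I * J * S) n)%N -> (nd < nodes (I * J * S) n.+1)%N.
  by move=> h; apply: leq_trans h (leq_nodes _ (leqnSn n)).
have st nd i j : (nd < nodes (I * J * S) n)%N -> (i < I)%N -> (j < J)%N ->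
    stage_value K I J S g mu w nd i j = stage_value K I J S g mu' w' nd i j.
  move=> hn hi hj; congr (_ + _); apply: sumq_eq => l hl.
    by rewrite em // up.
  by rewrite ew // child_lt.
apply/and3P; split.
- by apply/allfP => k hk; rewrite -em ?c1 // nodesS.
- apply/allfP => nd hn; have /and5P[s1 s2 /allfP p1 /allfP p2 /allfP p3] := c2 _ hn.
  apply/and5P; split.
  + by rewrite -(sumq_eq _ _ _ (fun i hi => ex nd i (up _ hn) hi)).
  + by rewrite -(sumq_eq _ _ _ (fun i hi => ey nd i (up _ hn) hi)).
  + apply/allfP => i hi; apply/allfP => j hj; apply/allfP => s hs; apply/allfP => k hk.
    have /allfP/(_ j hj)/allfP/(_ s hs)/allfP/(_ k hk) := p1 i hi.
    rewrite em ?child_lt // => /eqP->; apply/eqP/sumq_eq => l hl.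
    by rewrite em // up.
  + apply/allfP => j hj; rewrite -ew ?up //; apply: le_trans (p2 j hj) _.
    rewrite le_eqVlt; apply/orP; left; apply/eqP/sumq_eq => i hi.
    by rewrite ex ?up // st.
  + apply/allfP => i hi; rewrite -ew ?up //; apply: le_trans _ (p3 i hi).
    rewrite le_eqVlt; apply/orP; left; apply/eqP/sumq_eq => j hj.
    by rewrite ey ?up // st.
- by apply/allfP => nd hn; rewrite -ew ?c3.
Qed.

Lemma table_exists c (mu : nat -> nat -> rat) (w : nat -> rat) (x y : nat -> nat -> rat)
    T (K := get c 0) (I := get c 1) (J := get c 2) :
  (forall nd k, 0 <= mu nd k) -> (forall nd, 0 <= w nd) ->
  (forall nd i, 0 <= x nd i) -> (forall nd j, 0 <= y nd j) ->
  exists t, [/\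
    forall nd k, (nd < T)%N -> (k < K)%N -> mu nd k = cmu c t nd k,
    forall nd, (nd < T)%N -> w nd = cw c t nd,
    forall nd i, (nd < T)%N -> (i < I)%N -> x nd i = cx c t nd i &
    forall nd j, (nd < T)%N -> (j < J)%N -> y nd j = cy c t nd j].
Proof.
move=> mu0 w0 x0 y0; pose W := width c.
pose row nd r : rat := if (r < K)%N then mu nd r else if r == K then w nd
  else if (r < K + 1 + I)%N then x nd (r - (K + 1))%N else y nd (r - (K + 1 + I))%N.
have row0 nd r : 0 <= row nd r by rewrite /row; do !case: ifP => _ //.
have all0 : all (fun q => 0 <= q) (mkseq (fun i => row (i %/ W)%N (i %% W)%N) (T * W)).
  by apply/allP => _ /mapP[i _ ->]; apply: row0.
have [N [ms [N0 sm h]]] := common_denominator all0.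
rewrite size_mkseq in sm h.
have cellE nd r : (nd < T)%N -> (r < W)%N -> cell (code (N :: ms)) (nd * W + r) = row nd r.
  move=> hn hr; have hi : (nd * W + r < T * W)%N by nia.
  rewrite /cell !get_code /= ?ltnS ?sm // h // nth_mkseq //.
  by rewrite divnMDl ?(leq_ltn_trans _ hr) // divn_small // addn0 modnMDl modn_small.
have WE : W = (K + 1 + I + J)%N by [].
exists (code (N :: ms)); split=> [nd k hn hk|nd hn|nd i hn hi|nd j hn hj].
- by rewrite /cmu cellE ?WE /row ?hk //; lia.
- by rewrite /cw cellE ?WE /row -/K ?ltnn ?eqxx //; lia.
- have hr : (K + 1 + i < W)%N by rewrite WE; lia.
  rewrite /cx (cellE _ _ hn hr) /row.
  rewrite (_ : (K + 1 + i < K)%N = false); last by lia.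
  rewrite (_ : (K + 1 + i == K)%N = false); last by lia.
  by rewrite (_ : (K + 1 + i < K + 1 + I)%N) ?addKn //; lia.
- have hr : (K + 1 + I + j < W)%N by rewrite WE; lia.
  rewrite /cy (cellE _ _ hn hr) /row.
  rewrite (_ : (K + 1 + I + j < K)%N = false); last by lia.
  rewrite (_ : (K + 1 + I + j == K)%N = false); last by lia.
  rewrite (_ : (K + 1 + I + j < K + 1 + I)%N = false); last by lia.
  by rewrite addKn.
Qed.

(** * The decision procedure *)

Lemma valid_exists (G : rat_hsg) (b : dist rat 'I_(nK G)) rest c2 :
  let c := code (nats_of_game G ++ nats_of_dist b ++ rest) in
  exists t, valid c c2 t.
Proof.
move=> c; have [k i j l] := get_dims b rest.
have [mu [w [x [y [cert mu0 w0 x0 y0]]]]] :=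
  certificate_exists (inP_code b rest) (ing_code b rest) (inb_code b rest) (horizon c c2).
have [t [em ew ex ey]] := table_exists c (nodes (nI G * nJ G * nS G) (horizon c c2).+1)
  mu0 w0 x0 y0.
rewrite -/c k i j in em ex ey ew.
exists t; rewrite /valid /c k i j l -/c.
exact: certificate_ext em ew ex ey cert.
Qed.

Lemma valid_V (G : rat_hsg) (b : dist rat 'I_(nK G)) rest c2 t :
  let c := code (nats_of_game G ++ nats_of_dist b ++ rest) in
  valid c c2 t -> V (rat_game G) (horizon c c2) b = cw c t 0.
Proof.
move=> c; have [k i j l] := get_dims b rest; rewrite /valid /c k i j l -/c => v.
apply: (certificate_sound (inP_code b rest) (ing_code b rest) (inb_code b rest) v).
  by move=> nd r; rewrite /cx /cell divr_ge0.
by move=> nd r; rewrite /cy /cell divr_ge0.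
Qed.

(** As delta >= 1 / d and eps >= 1 / q, both summands are at most m d^2 = n / (2 q), and n / q <= n
    eps. *)
Lemma precision_bound (m n q : nat) (delta eps : rat) :
  0 < delta -> 0 < eps -> q = `|denq eps|%N -> 
  n = (2 * m * `|denq delta| ^ 2 * q)%N ->
  m%:R / delta ^+ 2 + n%:R * (2 * (4 * q)%:R^-1) <= n%:R * eps.
Proof.
move=> d0 e0 qE nE.
have q0 : 0 < q%:R :> rat by rewrite qE ltr0n absz_gt0 denq_neq0.
have e1 : 1 <= q%:R * eps.
  rewrite qE natr_absz ger0_norm ?denq_ge0 // mulrC -numqE.
  by rewrite -[1](mulr1z 1) ler_int -gtz0_ge1 numq_gt0.
pose d : rat := `|denq delta|%:R.
have dd0 : 0 < d by rewrite ltr0n absz_gt0 denq_neq0.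
have e2 : 1 <= d * delta.
  rewrite /d natr_absz ger0_norm ?denq_ge0 // mulrC -numqE.
  by rewrite -[1](mulr1z 1) ler_int -gtz0_ge1 numq_gt0.
have h1 : m%:R / delta ^+ 2 <= m%:R * d ^+ 2.
  rewrite ler_pdivrMr ?exprn_gt0 // -mulrA ler_peMr // -exprMn.
  by rewrite exprn_ege1.
have nR : n%:R = 2 * m%:R * d ^+ 2 * q%:R by rewrite nE -mulnn !natrM -/d; ring.
have h2 : n%:R * (2 * (4 * q)%:R^-1) = m%:R * d ^+ 2.
  by rewrite nR natrM; field; rewrite gt_eqF.
rewrite h2; apply: le_trans (lerD h1 (lexx _)) _.
have -> : n%:R * eps = 2 * (m%:R * d ^+ 2) * (q%:R * eps) by rewrite nR; ring.
have h0 : 0 <= m%:R * d ^+ 2 by rewrite mulr_ge0 ?ler0n // exprn_ge0 // ltW.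
nra.
Qed.

Lemma code_precode (G : rat_hsg) (b : dist rat 'I_(nK G)) (x eps : rat) :
  precode (code (nats_of_game G ++ nats_of_dist b ++ nats_of_rat x ++ nats_of_rat eps)) =
  code (nats_of_game G ++ nats_of_rat (4 * `|denq eps|)%:R^-1).
Proof.
rewrite /precode; have [-> _ _ _] := get_dims b (nats_of_rat x ++ nats_of_rat eps).
set L := _ ++ _; have sL : (size L - (nK G * 2 + 4))%N = size (nats_of_game G).
  by rewrite !size_cat size_nats_of_dist card_ord addnK.
rewrite iter_pop_code sL take_size_cat // nats_of_rat_inv; last first.
  by rewrite muln_gt0 absz_gt0 denq_neq0.
have -> : top (code L) = `|denq eps|%N.
  have -> : L = rcons (nats_of_game G ++ nats_of_dist b ++ nats_of_rat x ++
      [:: `|numq eps|%N]) `|denq eps|%N by rewrite -cats1 /L -!catA.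
  by rewrite code_rcons top_snoc.
by rewrite -[_ ++ [:: 1%N; _]]/(_ ++ rcons [:: 1%N] _) -rcons_cat code_rcons cats1 code_rcons.
Qed.

Theorem theorem3p2 (R : realType) :
  (forall (K I J S : finType) (G : hsg R K I J S), doeblin G ->
     (exists v : dist R K -> R, uniform_value G v) /\
     (forall v : dist R K -> R, uniform_value G v ->
        forall b b' : dist R K, v b = v b')) /\
  (forall CC : rat_hsg -> Prop,
     (forall G : rat_hsg, CC G -> doeblin (real_game R G)) ->
     (exists M : turing_machine, computes_doeblin_mapping R CC M) ->
     exists M : turing_machine, solves_approximation_problem R CC M).
Proof.
split=> [K I J S G doe|CC doe [M hM]].
  split=> [|v uv b b']; last exact: uniform_value_unique doe uv b b'.
  have [v [v01 bnd]] := limit_value doe.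
  by exists (fun=> v); apply: uniform_value_exists.
have [M' hM'] := search_machine M cpt_precode cpt_check cpt_answer.
exists M' => G b x eps CG /andP[x0 _] eps0.
set q := `|denq eps|%N.
have q0 : (0 < q)%N by rewrite absz_gt0 denq_neq0.
have e'0 : 0 < (4 * q)%:R^-1 :> rat by rewrite invr_gt0 ltr0n muln_gt0.
have [m [delta [comp m0 d0 dat]]] := hM G _ CG e'0.
pose rest := nats_of_rat x ++ nats_of_rat eps.
pose L := nats_of_game G ++ nats_of_dist b ++ rest.
pose c := code L; pose c2 := code (m :: nats_of_rat delta); pose n := horizon c c2.
have ext : exists t, valid c c2 t := valid_exists b rest c2.
(* The search stops at the least valid table; minimality shows that it does not stop earlier. *)
case: (ex_minnP ext) => t tv tmin.
have xE : (top (iter 3 pop c))%:R / (top (iter 2 pop c))%:R = x.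
  have e2 : top (iter 2 pop c) = `|denq x|%N.
    rewrite /c /L /rest !catA iter_pop_code size_cat addnK take_size_cat //.
    have -> : (nats_of_game G ++ nats_of_dist b) ++ nats_of_rat x =
      rcons ((nats_of_game G ++ nats_of_dist b) ++ [:: `|numq x|%N]) `|denq x|%N.
      by rewrite -cats1 -!catA.
    by rewrite code_rcons top_snoc.
  have e3 : top (iter 3 pop c) = `|numq x|%N.
    have LE : L = (nats_of_game G ++ nats_of_dist b ++ [:: `|numq x|%N]) ++
        `|denq x|%N :: nats_of_rat eps by rewrite /L /rest -!catA.
    rewrite /c LE iter_pop_code size_cat addnK take_size_cat //.
    by rewrite catA cats1 code_rcons top_snoc.
  by rewrite e2 e3; apply: nats_of_ratK.
have topc : top c = q.
  have -> : c = code (rcons (nats_of_game G ++ nats_of_dist b ++ nats_of_rat x ++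
      [:: `|numq eps|%N]) q) by rewrite /c /L /rest -cats1 -!catA.
  by rewrite code_rcons top_snoc.
have nE : n = (2 * m * `|denq delta| ^ 2 * q)%N.
  by rewrite /n /horizon topc /c2 !get_code.
have n0 : (0 < n)%N.
  by rewrite nE -mulnn !muln_gt0 m0 !absz_gt0 !denq_neq0.
exists (~~ (cw c t 0 <= n%:R * x)); split.
  apply: (hM' _ _ _ _ t (code_precode b x eps) comp).
  - move=> t' lt; rewrite /check -/(code _) -/L -/c -/c2.
    by case: (boolP (valid c c2 t')) => // /tmin; rewrite leqNgt lt.
  - by rewrite /check -/rest -/L -/c -/c2 tv.
  - by rewrite /answer -/rest -/L -/c -/c2 xE.
move=> v uv y far.
have osc := doeblin_osc (ltW _) _ dat n.
have {}osc : osc_le (real_game R G) n (n%:R * ratr eps).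
  apply: osc_mono (osc _ _); rewrite ?ltr0q //.
  have := precision_bound d0 eps0 erefl nE; rewrite -(ler_rat R).
  by rewrite rmorphD !rmorphM /= !fmorphV /= rmorphXn !rmorph_nat.
have := uniform_value_bound (real_dist R b) uv n0 osc.
have -> : V (real_game R G) n (real_dist R b) = ratr (cw c t 0).
  rewrite -(valid_V tv); apply: V_ratr => k; exact: ffunE.
rewrite -/y -ltNge -(ltr_rat R) rmorphM /= rmorph_nat ler_norml => /andP[h1 h2].
have np : 0 < n%:R :> R by rewrite ltr0n.
have er : 0 < ratr eps :> R by rewrite ltr0q.
rewrite rmorphB rmorphD /= in far; rewrite rmorphD /=.
(* V n is within n eps of n y. A positive answer with y <= x + eps would put y in the tolerance
   interval, and y > x + eps forces V n > n x. *)
split=> [h|h].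
  rewrite ltNge; apply/negP => yle; apply: far; rewrite yle andbT.
  by rewrite -(ler_pM2l np); lra.
have : n%:R * (ratr x + ratr eps) < n%:R * y by rewrite ltr_pM2l.
lra.
Qed.
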